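(* Let $R \in \mathbb{C}_p(z)$ be a rational function of degree at least two and let $C_0 \subset \mathbb{P}(\mathbb{C}_p)$ be a periodic component of the Fatou set $F(R)$ (that is, a component of $F(R)$ with $R^k(C_0) = C_0$ for some $k \ge 1$). Then one of the following two cases holds. (1) $C_0$ is an immediate basin of attraction (of some attracting periodic point of $R$). (2) $C_0$ is an analytic component of the quasi-periodicity domain $\mathcal{E}(R)$ of $R$.
   Context: $p$ is a prime, $\mathbb{C}_p$ is the completion of an algebraic closure of $\mathbb{Q}_p$, $|\cdot|$ its norm, $\mathbb{P}(\mathbb{C}_p) = \mathbb{C}_p \cup \{\infty\}$, and $\Delta$ is the chordal distance, $\Delta([x,y],[x',y']) = |xy'-x'y| / (\max\{|x|,|y|\}\max\{|x'|,|y'|\})$. Balls: for $a \in \mathbb{C}_p$ and $r \in |\mathbb{C}_p^*|$, $\{|z-a|<r\}$ is an open ball and $\{|z-a|\le r\}$ a closed ball of $\mathbb{C}_p$. An open ball (of $\mathbb{P}(\mathbb{C}_p)$) is an open ball of $\mathbb{C}_p$ or the complement in $\mathbb{P}(\mathbb{C}_p)$ of a closed ball of $\mathbb{C}_p$. An open affinoid is a nonempty finite intersection of open balls. Analytic component: for $U \subset \mathbb{P}(\mathbb{C}_p)$ open and $x \in U$, the analytic component of $U$ containing $x$ is the union of all open affinoids $X \subset U$ containing $x$. Fatou set: $F(R)$ is the set of points having a neighbourhood $X \subset \mathbb{P}(\mathbb{C}_p)$ such that $\bigcup_{n\ge 0} R^n(X)$ omits at least 3 points of $\mathbb{P}(\mathbb{C}_p)$.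 Component of $F(R)$: for $x \in F(R)$, the component of $F(R)$ containing $x$ is the union of all open affinoids $X \subset F(R)$ containing $x$ such that $\bigcup_{n \ge 0} R^n(X)$ omits at least 3 points of $\mathbb{P}(\mathbb{C}_p)$. A periodic point $z_0$ with $R^n(z_0)=z_0$ ($n$ its primitive period) is attracting if its multiplier $\lambda=(R^n)'(z_0)$ satisfies $|\lambda|<1$. Its basin of attraction is the set of $x \in \mathbb{P}(\mathbb{C}_p)$ with $\Delta(R^n(x),R^n(z_0)) \to 0$ as $n\to\infty$, and its immediate basin of attraction is the analytic component of its basin that contains $z_0$. The quasi-periodicity domain $\mathcal{E}(R)$ is the interior of the set of points of $\mathbb{P}(\mathbb{C}_p)$ that are recurrent under $R$ (i.e. $x$ is the limit of $R^{n_j}(x)$ for some $n_j \to \infty$). *)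

(* Defs.v *)
From HB Require Import structures.
From mathcomp Require Import all_boot all_order all_algebra.
From mathcomp Require Import all_classical all_reals all_analysis.

Set Implicit Arguments.
Unset Strict Implicit.
Unset Printing Implicit Defensive.

Import Order.TTheory GRing.Theory Num.Theory.
Import numFieldNormedType.Exports.

Local Open Scope classical_set_scope.
Local Open Scope ring_scope.

(* Absolute values are unbundled, real-valued functions. *)

Definition ultrametric_abs (R : realType) (K : fieldType) (v : K -> R) : Prop :=
  [/\ forall x, 0 <= v x,
      forall x, v x = 0 <-> x = 0,
      forall x y, v (x * y) = v x * v y
    & forall x y, v (x + y) <= Num.max (v x) (v y)].

Definition complete_abs (R : realType) (K : fieldType) (v : K -> R) : Prop :=
  forall u : nat -> K,
    (forall e : R, 0 < e -> exists N : nat, forall m n : nat,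
       (N <= m)%N -> (N <= n)%N -> v (u m - u n) < e) ->
    exists l : K, v (u n - l) @[n --> \oo] --> (0 : R).

Definition is_completion (R : realType) (F K : fieldType)
    (vF : F -> R) (vK : K -> R) (iota : {rmorphism F -> K}) : Prop :=
  [/\ ultrametric_abs vK,
      forall x, vK (iota x) = vF x,
      forall (y : K) (e : R), 0 < e -> exists x : F, vK (y - iota x) < e
    & complete_abs vK].

Definition padic_abs (R : realType) (p : nat) (q : rat) : R :=
  if q == 0 then 0
  else (p%:R : R) ^ ((logn p `|denq q|)%:Z - (logn p `|numq q|)%:Z).

(* The conjunct on the absolute value of the algebraic closure Qa of Qp says  *)
(* that it is the (unique) extension of the absolute value of Qp.             *)
Definition is_Cp (R : realType) (p : nat) (K : fieldType) (v : K -> R) : Prop :=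
  exists (Qp : fieldType) (vQp : Qp -> R) (i : {rmorphism rat -> Qp})
         (Qa : closedFieldType) (vQa : Qa -> R) (j : {rmorphism Qp -> Qa})
         (k : {rmorphism Qa -> K}),
    [/\ is_completion (padic_abs R p) vQp i,
        forall x : Qa, algebraicOver j x,
        ultrametric_abs vQa /\ (forall x, vQa (j x) = vQp x)
      & is_completion vQa v k].

(* The projective line: [Some z] is the point z of K, [None] is infinity.     *)

Definition proj_line (K : fieldType) := option K.

Section ChordalMetric.
Variables (R : realType) (K : fieldType) (v : K -> R).
Local Notation P1 := (proj_line K).

Definition hcoord (z : P1) : K * K := if z is Some a then (a, 1) else (1, 0).

(* The formula is invariant under scaling of the homogeneous coordinates, so  *)
(* the representatives chosen by [hcoord] do not matter.                      *)
Definition chordal (z w : P1) : R :=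
  let: (x, y) := hcoord z in let: (x', y') := hcoord w in
  v (x * y' - x' * y) / (Num.max (v x) (v y) * Num.max (v x') (v y')).

Definition P1_nbhs (z : P1) (X : set P1) : Prop :=
  exists2 e : R, 0 < e & [set w | chordal z w < e] `<=` X.

Definition P1_interior (X : set P1) : set P1 := [set z | P1_nbhs z X].

Definition value_group (r : R) : Prop := exists2 c : K, c != 0 & r = v c.

Definition K_open_ball (a : K) (r : R) : set P1 :=
  [set Some z | z in [set z : K | v (z - a) < r]].

Definition K_closed_ball (a : K) (r : R) : set P1 :=
  [set Some z | z in [set z : K | v (z - a) <= r]].

Definition P1_open_ball (B : set P1) : Prop :=
  exists (a : K) (r : R),
    value_group r /\ (B = K_open_ball a r \/ B = ~` K_closed_ball a r).

Definition open_affinoid (X : set P1) : Prop :=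
  exists (n : nat) (B : 'I_n.+1 -> set P1),
    [/\ forall i, P1_open_ball (B i),
        X = \bigcap_(i in [set: 'I_n.+1]) B i
      & X !=set0].

(* Meant for U open and x in U. *)
Definition analytic_component (U : set P1) (x : P1) : set P1 :=
  \bigcup_(X in [set X | [/\ open_affinoid X, X `<=` U & X x]]) X.

Definition omits3 (S : set P1) : Prop :=
  exists a b c : P1,
    [/\ a <> b, a <> c & b <> c] /\ [/\ ~ S a, ~ S b & ~ S c].

End ChordalMetric.

(* Rational functions f in K(z), as elements of the fraction field of K[z].   *)

Section RationalFunctions.
Variable K : fieldType.
Local Notation P1 := (proj_line K).
Implicit Type f : {fraction {poly K}}.

(* The chosen numerator and denominator of [repr f] may have a common factor. *)
Definition ratnum f : {poly K} :=
  let r : {ratio {poly K}} := repr f in r.1 %/ gcdp r.1 r.2.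
Definition ratden f : {poly K} :=
  let r : {ratio {poly K}} := repr f in r.2 %/ gcdp r.1 r.2.

Lemma ratden_neq0 f : ratden f != 0.
Proof.
have d0 := denom_ratioP (repr f).
by rewrite /ratden dvdp_div_eq0 ?dvdp_gcdr.
Qed.

Lemma coprimep_ratnum_ratden f : coprimep (ratnum f) (ratden f).
Proof. by apply: coprimep_div_gcd; rewrite denom_ratioP orbT. Qed.

Lemma ratnum_div_ratden f :
  f = FracField.tofrac (ratnum f) / FracField.tofrac (ratden f).
Proof.
have d0 := ratden_neq0 f.
apply: (canRL (mulfK _)); first by rewrite tofrac_eq0.
rewrite -[X in X * _](reprK f) !piE.
apply/eqmodP; rewrite /= FracField.equivfE /FracField.mulf.
rewrite !numden_Ratio ?mulf_neq0 ?oner_neq0 ?denom_ratioP //.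
rewrite !mulr1 /ratnum /ratden.
set n := (repr f).1; set d := (repr f).2.
apply/eqP.
have nE := divpK (dvdp_gcdl n d); have dE := divpK (dvdp_gcdr n d).
set a := n %/ _ in nE *; set b := d %/ _ in dE *.
by rewrite -[in LHS]nE -[in RHS]dE mulrC mulrA mulrAC.
Qed.

Definition ratdeg f : nat := (maxn (size (ratnum f)) (size (ratden f))).-1.

(* The self-map of the projective line induced by f.  The value at infinity   *)
(* is the quotient of the coefficients of degree [ratdeg f].                  *)
Definition rateval f (z : P1) : P1 :=
  match z with
  | Some a =>
      if (ratden f).[a] == 0 then None
      else Some ((ratnum f).[a] / (ratden f).[a])
  | None =>
      if (ratden f)`_(ratdeg f) == 0 then None
      else Some ((ratnum f)`_(ratdeg f) / (ratden f)`_(ratdeg f))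
  end.

Definition P1_inv (z : P1) : P1 :=
  match z with
  | Some a => if a == 0 then None else Some a^-1
  | None => Some 0
  end.

End RationalFunctions.

Section Dynamics.
Variables (R : realType) (K : fieldType) (v : K -> R).
Local Notation P1 := (proj_line K).
Variable f : {fraction {poly K}}.

Definition ratiter (n : nat) : P1 -> P1 := iter n (rateval f).

Definition orbit_union (X : set P1) : set P1 :=
  \bigcup_(n in [set: nat]) (ratiter n @` X).

Definition Fatou : set P1 :=
  [set x | exists2 X, P1_nbhs v x X & omits3 (orbit_union X)].

(* Meant for x in [Fatou]. *)
Definition Fatou_component (x : P1) : set P1 :=
  \bigcup_(X in [set X | [/\ open_affinoid v X, X `<=` Fatou, X x
                          & omits3 (orbit_union X)]]) X.

(* g'(a) = l for a self-map g of the line fixing the finite point a. *)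
Definition has_derivative_at (g : P1 -> P1) (a l : K) : Prop :=
  forall e : R, 0 < e -> exists2 d : R, 0 < d &
    forall z : K, z != a -> v (z - a) < d ->
      exists2 w : K, g (Some z) = Some w & v ((w - a) / (z - a) - l) < e.

(* At infinity the derivative is taken in the coordinate 1/z. *)
Definition has_multiplier (g : P1 -> P1) (z0 : P1) (l : K) : Prop :=
  match z0 with
  | Some a => has_derivative_at g a l
  | None => has_derivative_at (@P1_inv K \o g \o @P1_inv K) 0 l
  end.

Definition primitive_period (z0 : P1) (n : nat) : Prop :=
  [/\ (0 < n)%N, ratiter n z0 = z0
    & forall m : nat, (0 < m)%N -> ratiter m z0 = z0 -> (n <= m)%N].

Definition attracting_periodic (z0 : P1) : Prop :=
  exists (n : nat) (l : K),
    [/\ primitive_period z0 n, has_multiplier (ratiter n) z0 l & v l < 1].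

Definition basin (z0 : P1) : set P1 :=
  [set x | chordal v (ratiter n x) (ratiter n z0) @[n --> \oo] --> (0 : R)].

Definition immediate_basin (z0 : P1) : set P1 :=
  analytic_component v (basin z0) z0.

Definition recurrent (x : P1) : Prop :=
  exists2 s : nat -> nat, s j @[j --> \oo] --> \oo
    & chordal v (ratiter (s j) x) x @[j --> \oo] --> (0 : R).

Definition quasi_periodicity_domain : set P1 := P1_interior v recurrent.

End Dynamics.

(* Main.v *)
Require Import Defs.
From HB Require Import structures.
From mathcomp Require Import all_boot all_order all_algebra.
From mathcomp Require Import all_classical all_reals all_analysis.
From mathcomp Require Import ring zify.

Set Implicit Arguments.
Unset Strict Implicit.
Unset Printing Implicit Defensive.

Import Order.TTheory GRing.Theory Num.Theory.
Import numFieldNormedType.Exports.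

Local Open Scope classical_set_scope.
Local Open Scope ring_scope.

(** Let g be the iterate of R that fixes C0, let x be a point of C0 and X an
    affinoid of C0 containing x and g x; the union V of the g^n(X) is contained
    in C0 and omits points.  Consider closed discs almost all of whose residue
    classes are contained in V.  On such a disc either g is shrinking, and one
    descends on the number of poles, or g permutes the residue classes through
    a rational map over a finite field and some class is periodic.  So an open
    disc meeting V is mapped into itself by an iterate h of g.  By Schwarz'
    lemma h is there either a contraction, whose iterates converge to a fixed
    point, or an isometry, and then h^(N p^j) converges to the identity for
    some N.

    A non-archimedean Vitali theorem spreads this local uniform convergence to
    all of C0: since the iterates omit infinitely many values on each affinoid,
    counting roots in the holes shows that they stay away from one of these
    values, and a two-constants inequality propagates smallness.  In the first
    case C0 is the immediate basin of the limit; in the second case all points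
    of C0 are recurrent.  Maximality of C0 follows because the basin of a cycle
    and the set of recurrent points each miss at least three points. *)

(** Besides the ultrametric absolute value, five properties of the field enter: completeness,
    algebraic closedness, characteristic 0, |p| < 1, and a residue field algebraic over F_p
    ([v_res]). The last one supplies the finite fields, both for the periodic residue class and for
    the exponent N that makes the slope of an isometry a 1-unit.

    The field is not locally compact, so no compactness argument yields convergent subsequences:
    convergence is produced with explicit rates on one disc and carried elsewhere by inequalities
    whose constants do not depend on the iterate. These are stated with Gauss norms, defined by the
    roots so that multiplicativity is built in; the ultrametric inequality comes from generic
    points.

    For an affinoid given by n + 1 balls the Vitali argument needs n + 3 omitted finite values
    besides infinity, so three omitted values do not suffice. They are multiplied by backward
    invariance: a finite backward invariant set consists of totally ramified points, and in
    characteristic 0 it has at most two elements. An omitted value is sent to infinity by an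
    inversion, so most estimates are affine. *)

Section Dynamics.
Variables (R : realType) (K : fieldType) (v : K -> R) (p : nat).
Hypothesis p_prime : prime p.
Hypothesis v_um : ultrametric_abs v.
Hypothesis v_complete : complete_abs v.
Hypothesis K_closed : forall P : {poly K}, (1 < size P)%N -> exists x, root P x.
Hypothesis v_p : v p%:R < 1.
Hypothesis K_char0 : forall n : nat, (0 < n)%N -> n%:R != 0 :> K.
Hypothesis v_res : forall z : K, v z <= 1 ->
  exists2 k : nat, (0 < k)%N & v (z ^+ (p ^ k) - z) < 1.
Local Notation P1 := (proj_line K).

(** * Polynomials and Gauss norms *)

Lemma v_ge0 x : 0 <= v x. Proof. by case: v_um. Qed.
Lemma v_eq0 x : (v x == 0) = (x == 0).
Proof. by case: v_um => _ h _ _; apply/eqP/eqP => /h. Qed.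
Lemma vM x y : v (x * y) = v x * v y. Proof. by case: v_um. Qed.
Lemma vD x y : v (x + y) <= Num.max (v x) (v y). Proof. by case: v_um. Qed.
Lemma v0 : v 0 = 0. Proof. by apply/eqP; rewrite v_eq0. Qed.
Lemma v_gt0 x : (0 < v x) = (x != 0). Proof. by rewrite lt_neqAle v_ge0 andbT eq_sym v_eq0. Qed.
Lemma v1 : v 1 = 1.
Proof.
have h : v 1 != 0 by rewrite v_eq0 oner_eq0.
by apply: (mulfI h); rewrite -vM !mulr1.
Qed.
Lemma vN x : v (- x) = v x.
Proof.
have h : v (-1) = 1.
  apply/eqP; rewrite -(eqrXn2 (n := 2)) ?v_ge0 ?ler01 //.
  by rewrite expr1n expr2 -vM mulrNN mulr1 v1.
by rewrite -mulN1r vM h mul1r.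
Qed.
Lemma vX x n : v (x ^+ n) = v x ^+ n.
Proof. by elim: n => [|n IH]; rewrite ?expr0 ?v1 // !exprS vM IH. Qed.
Lemma vV x : v x^-1 = (v x)^-1.
Proof.
have [->|x0] := eqVneq x 0; first by rewrite invr0 v0 invr0.
have h : v x != 0 by rewrite v_eq0.
by apply: (mulfI h); rewrite -vM !divff // v1.
Qed.
Lemma vB_sym x y : v (x - y) = v (y - x). Proof. by rewrite -vN opprB. Qed.
Lemma vD_le x y e : v x <= e -> v y <= e -> v (x + y) <= e.
Proof. by move=> hx hy; rewrite (le_trans (vD _ _)) // ge_max hx. Qed.
Lemma vD_lt x y e : v x < e -> v y < e -> v (x + y) < e.
Proof. by move=> hx hy; rewrite (le_lt_trans (vD _ _)) // gt_max hx. Qed.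
Lemma vD_eq x y : v x < v y -> v (x + y) = v y.
Proof.
move=> h; apply/eqP; rewrite eq_le vD_le ?(ltW h) //=.
rewrite leNgt; apply/negP => h2.
have : v (- x + (x + y)) < v y by rewrite vD_lt // vN.
by rewrite addKr ltxx.
Qed.
Lemma vtri_le y x z e : v (x - y) <= e -> v (y - z) <= e -> v (x - z) <= e.
Proof. by move=> h1 h2; rewrite -(subrKA y) vD_le. Qed.
Lemma vtri_lt y x z e : v (x - y) < e -> v (y - z) < e -> v (x - z) < e.
Proof. by move=> h1 h2; rewrite -(subrKA y) vD_lt. Qed.
Lemma vtri_eq y x z : v (x - y) < v (y - z) -> v (x - z) = v (y - z).
Proof. by move=> h; rewrite -(subrKA y) vD_eq. Qed.
Lemma max_recenter e e' a r : v (e - e') <= r ->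
  Num.max r (v (e - a)) = Num.max r (v (e' - a)).
Proof.
have H x y : v (x - y) <= r -> Num.max r (v (x - a)) <= Num.max r (v (y - a)).
  move=> h; rewrite ge_max le_max lexx /=.
  by apply: (@vtri_le y); rewrite le_max ?h // lexx orbT.
by move=> h; apply/eqP; rewrite eq_le !H // vB_sym.
Qed.
Lemma v_prod (I : Type) (s : seq I) (F : I -> K) :
  v (\prod_(i <- s) F i) = \prod_(i <- s) v (F i).
Proof. by elim/big_rec2: _ => [|i y x _ <-]; rewrite ?v1 // vM. Qed.
Lemma v_sum_le (I : Type) (s : seq I) (F : I -> K) e :
  0 <= e -> (forall i, v (F i) <= e) -> v (\sum_(i <- s) F i) <= e.
Proof. by move=> e0 h; elim/big_rec: _ => [|i x _ hx]; rewrite ?v0 // vD_le. Qed.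
Lemma v_nat_le1 n : v n%:R <= 1.
Proof. by elim: n => [|n IH]; rewrite ?v0 ?ler01 // -natr1 vD_le // v1. Qed.

Lemma root_split (P : {poly K}) :
  exists s : seq K, P == lead_coef P *: \prod_(a <- s) ('X - a%:P).
Proof.
have [n] := ubnP (size P); elim: n P => // n IH P Pn.
have [P1|P1] := leqP (size P) 1.
  exists [::]; rewrite big_nil; have := size1_polyC P1 => {1 2}->.
  by rewrite lead_coefC alg_polyC.
have [x /factor_theorem [Q QE]] := K_closed P1.
have Q0 : Q != 0 by apply: contraTneq P1 => q0; rewrite QE q0 mul0r size_poly0.
have /IH [s /eqP sE] : (size Q < n)%N.
  by move: Pn; rewrite QE size_Mmonic ?monicXsubC // size_XsubC addn2.
exists (x :: s); rewrite big_cons QE lead_coefM lead_coefXsubC mulr1 {1}sE.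
by rewrite mulrC -scalerAr.
Qed.
(** The roots with multiplicity. For P = 0 the list is arbitrary, which is harmless because the
    leading coefficient 0 annihilates the products in [horner_rts] and [nrm]. *)
Definition rts (P : {poly K}) : seq K := xchoose (root_split P).
Lemma rtsE P : P = lead_coef P *: \prod_(a <- rts P) ('X - a%:P).
Proof. by apply/eqP; apply: (xchooseP (root_split P)). Qed.
Lemma horner_rts P z : P.[z] = lead_coef P * \prod_(a <- rts P) (z - a).
Proof.
rewrite {1}[P]rtsE hornerZ horner_prod; congr (_ * _).
by apply: eq_bigr => a _; rewrite !hornerE.
Qed.
Lemma v_horner P z : v P.[z] = v (lead_coef P) * \prod_(a <- rts P) v (z - a).
Proof. by rewrite horner_rts vM v_prod. Qed.
Lemma mem_rts P z : P != 0 -> (z \in rts P) = root P z.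
Proof.
move=> P0; rewrite /root horner_rts mulf_eq0 lead_coef_eq0 (negbTE P0) /=.
rewrite prodf_seq_eq0; apply/idP/hasP => [zs|[a as_]]; first by exists z => //=; rewrite subrr.
by rewrite /= subr_eq0 => /eqP ->.
Qed.

(* The Gauss norm of P on the disc |z - e| <= r. *)
Definition nrm (P : {poly K}) (e : K) (r : R) : R :=
  v (lead_coef P) * \prod_(a <- rts P) Num.max r (v (e - a)).

Lemma nrm_ge0 P e r : 0 <= nrm P e r.
Proof. by rewrite mulr_ge0 ?v_ge0 // prodr_ge0 // => a _; rewrite le_max v_ge0 orbT. Qed.
Lemma nrm_gt0 P e r : 0 < r -> (0 < nrm P e r) = (P != 0).
Proof.
move=> r0; have h : 0 < \prod_(a <- rts P) Num.max r (v (e - a)).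
  by rewrite prodr_gt0 // => a _; rewrite lt_max r0.
by rewrite pmulr_lgt0 // v_gt0 lead_coef_eq0.
Qed.
Lemma nrm_recenter P e e' r : v (e - e') <= r -> nrm P e r = nrm P e' r.
Proof.
by move=> h; congr (_ * _); apply: eq_bigr => a _; apply: max_recenter.
Qed.
Lemma v_le_nrm P e r z : v (z - e) <= r -> v P.[z] <= nrm P e r.
Proof.
move=> h; rewrite v_horner ler_wpM2l ?v_ge0 // ler_prod // => a _.
rewrite v_ge0 /= -(max_recenter a h) le_max lexx orbT //.
Qed.
(** Such a point lies in a residue class of the disc without roots, and there each factor |z - a|
    equals max(r, |e - a|). Inequalities between values thereby become inequalities between Gauss
    norms. *)
Lemma v_generic P e r z : v (z - e) <= r ->
  (forall a, a \in rts P -> r <= v (z - a)) -> v P.[z] = nrm P e r.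
Proof.
move=> h gen; rewrite v_horner; congr (_ * _); apply: eq_big_seq => a as_.
by rewrite -(max_recenter a h) max_r // gen.
Qed.
Lemma nrm_mono P e r t : r <= t -> nrm P e r <= nrm P e t.
Proof.
move=> h; rewrite ler_wpM2l ?v_ge0 // ler_prod // => a _.
by rewrite le_max v_ge0 orbT /= ge_max !le_max h lexx orbT.
Qed.

Lemma K_root (c : K) n : (0 < n)%N -> exists d, d ^+ n = c.
Proof.
move=> n0; have [|x] := @K_closed ('X^n - c%:P); first by rewrite size_XnsubC.
by rewrite /root !hornerE subr_eq0 => /eqP; exists x.
Qed.
Lemma v_root_exp (r : R) (c : K) n : (0 < n)%N -> 0 <= r -> r ^+ n = v c ->
  exists d, r = v d.
Proof.
move=> n0 r0 h; have [d dE] := K_root c n0; exists d.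
by apply/eqP; rewrite -(eqrXn2 n0) ?v_ge0 // h -dE vX.
Qed.
Lemma v_p_gt0 : 0 < v p%:R. Proof. by rewrite v_gt0 K_char0 // prime_gt0 // p_prime. Qed.

Lemma expr_lt_eps (x e : R) : 0 <= x -> x < 1 -> 0 < e -> exists n, x ^+ n < e.
Proof.
move=> x0 x1 e0; have /cvgrPdist_lt /(_ e e0) : (x ^+ n @[n --> \oo] --> (0 : R))%classic.
  by apply: cvg_expr; rewrite ger0_norm.
case=> N _ /(_ N (leqnn N)) /= h; exists N.
by move: h; rewrite sub0r normrN ger0_norm ?exprn_ge0.
Qed.

(** An (n+1)-th root t of p has absolute value below 1 but as close to 1 as desired. Once |t| > a /
    b, the decreasing sequence |c t^j|, which starts above b, cannot jump over the interval between
    a and b. *)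
Lemma value_dense (a b : R) : 0 < a -> a < b -> exists2 c : K, c != 0 & a < v c < b.
Proof.
move=> a0 ab; have b0 := lt_trans a0 ab.
have [n npow] : exists n, (a / b) ^+ n < v p%:R.
  by apply: expr_lt_eps v_p_gt0; rewrite ?divr_ge0 ?ltW // ltr_pdivrMr // mul1r.
have [t tE] := K_root p%:R (ltn0Sn n).
have tE' : v t ^+ n.+1 = v p%:R by rewrite -vX tE.
have t1 : v t < 1.
  by rewrite -(@expr_lt1 _ n.+1) ?v_ge0 // tE' v_p.
have t0 : 0 < v t.
  rewrite lt_neqAle v_ge0 andbT eq_sym; apply: contraTneq v_p_gt0 => h.
  by rewrite -tE' h expr0n ltxx.
have abt : a / b < v t.
  rewrite ltNge; apply/negP => h.
  have h0 : 0 <= a / b by rewrite divr_ge0 ?ltW.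
  have : v t ^+ n.+1 <= (a / b) ^+ n.+1 by rewrite lerXn2r // nnegrE v_ge0.
  rewrite tE' => h3; have := lt_le_trans npow h3.
  rewrite exprS ltNge ler_piMl ?exprn_ge0 // ltW // ltr_pdivrMr // mul1r //.
have tn0 : t != 0 by rewrite -v_gt0.
have [m mE] : exists m, v t ^+ m < b^-1.
  by apply: expr_lt_eps; rewrite ?v_ge0 ?invr_gt0.
pose c := (t ^+ m)^-1.
have cE : b < v c.
  by rewrite /c vV vX -[b]invrK ltf_pV2 ?posrE ?exprn_gt0 ?invr_gt0.
have ex : exists j, v c * v t ^+ j < b.
  have [j jE] : exists j, v t ^+ j < b / v c.
    by apply: expr_lt_eps; rewrite ?v_ge0 // divr_gt0 // (lt_trans b0).
  by exists j; rewrite mulrC -ltr_pdivlMr // (lt_trans b0).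
pose j := ex_minn ex; exists (c * t ^+ j).
  by rewrite mulf_neq0 ?invr_eq0 ?expf_neq0.
rewrite vM vX /j; case: ex_minnP => -[|i] hi mini.
  by move: hi; rewrite expr0 mulr1 => /(lt_trans cE); rewrite ltxx.
rewrite hi andbT exprSr mulrA.
have hb : b <= v c * v t ^+ i by rewrite leNgt; apply/negP => /mini; rewrite ltnn.
apply: lt_le_trans (_ : b * v t <= _); last by rewrite ler_wpM2r // ltW.
by rewrite mulrC -ltr_pdivrMr.
Qed.

(** Let u solve prod (u - a) = 1, the product over those a in the closed unit disc. Then |u| <= 1,
    each factor has absolute value at most 1, and since the product is 1 each equals 1. Algebraic
    closedness thus provides the infinitude of the residue field. *)
Lemma generic_unit (l : seq K) :
  exists2 u : K, v u <= 1 & forall a, a \in l -> 1 <= v (u - a).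
Proof.
pose l' := [seq a <- l | v a <= 1].
pose f : {poly K} := \prod_(a <- l') ('X - a%:P).
have sf : size f = (size l').+1 by rewrite size_prod_XsubC.
have [l0|l0] := posnP (size l').
  exists 0; first by rewrite v0 ler01.
  move=> a al; rewrite sub0r vN leNgt; apply/negP => h.
  have : a \in l' by rewrite mem_filter al ltW.
  by rewrite (size0nil l0).
have [|u] := @K_closed (f - 1%:P).
  by rewrite size_polyDl sf // size_polyN size_polyC oner_neq0.
rewrite /root !hornerE subr_eq0 horner_prod => /eqP fu.
have vfu : \prod_(a <- l') v (u - a) = 1.
  transitivity (v (\prod_(a <- l') ('X - a%:P).[u])); last by rewrite fu v1.
  by rewrite v_prod; apply: eq_bigr => a _; rewrite !hornerE.
have u1 : v u <= 1.
  rewrite leNgt; apply/negP => u1.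
  have E : \prod_(a <- l') v (u - a) = v u ^+ size l'.
    transitivity (\prod_(a <- l') v u); last first.
      by rewrite big_const_seq count_predT iter_mulr_1.
    rewrite big_seq [RHS]big_seq; apply: eq_bigr => a.
    rewrite mem_filter => /andP[a1 _]; rewrite addrC vD_eq // vN.
    exact: le_lt_trans u1.
  have : 1 < v u ^+ size l' by rewrite exprn_egt1 // -lt0n.
  by rewrite -E vfu ltxx.
exists u => // a al; rewrite leNgt; apply/negP => h.
have al' : a \in l'.
  rewrite mem_filter al andbT; have -> : a = - (u - a) + u by ring.
  by rewrite vD_le // vN ltW.
move: vfu; rewrite (big_rem a al') /= => E.
suff : v (u - a) * \prod_(y <- rem a l') v (u - y) < 1 by rewrite E ltxx.
apply: le_lt_trans h; rewrite ler_piMr ?v_ge0 //.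
suff /andP[] : 0 <= \prod_(y <- rem a l') v (u - y) <= 1 by [].
rewrite big_seq; elim/big_ind: _ => [|x y /andP[x0 x1] /andP[y0 y1]|y yl]; first by rewrite ler01 lexx.
  by rewrite mulr_ge0 // mulr_ile1.
by rewrite v_ge0 vD_le // vN; have := mem_rem yl; rewrite mem_filter => /andP[].
Qed.

Lemma generic_point e c (l : seq K) : c != 0 ->
  exists2 z, v (z - e) <= v c & forall a, a \in l -> v c <= v (z - a).
Proof.
move=> c0; have [u u1 ul] := generic_unit [seq (a - e) / c | a <- l].
exists (e + c * u); first by rewrite addrAC subrr add0r vM ler_piMr ?v_ge0.
move=> a al; have /ul : (a - e) / c \in [seq (a - e) / c | a <- l].
  by apply/mapP; exists a.
have -> : e + c * u - a = c * (u - (a - e) / c) by field.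
by rewrite vM => h; rewrite ler_peMr ?v_ge0.
Qed.

(** Not formal, since [nrm] is defined by the roots: it is the ultrametric inequality at a point
    generic for P, Q and P + Q at once, hence the radius in the value group. *)
Lemma nrmD P Q e c : c != 0 ->
  nrm (P + Q) e (v c) <= Num.max (nrm P e (v c)) (nrm Q e (v c)).
Proof.
move=> c0; have [z ze zl] := generic_point e (rts P ++ rts Q ++ rts (P + Q)) c0.
have gen S : {subset rts S <= rts P ++ rts Q ++ rts (P + Q)} ->
    v S.[z] = nrm S e (v c).
  by move=> sS; apply: v_generic => // a as_; apply/zl/sS.
rewrite -!gen ?hornerD ?vD // => a; rewrite !mem_cat => ->; rewrite ?orbT //.
Qed.
Lemma nrmZ (a : K) P e c : c != 0 -> nrm (a *: P) e (v c) = v a * nrm P e (v c).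
Proof.
move=> c0; have [z ze zl] := generic_point e (rts P ++ rts (a *: P)) c0.
by rewrite -(@v_generic P e _ z) // -1?(@v_generic (a *: P) e _ z) ?hornerZ ?vM // => x xs;
  apply: zl; rewrite mem_cat xs ?orbT.
Qed.
Lemma v_noroot P e r z : (forall a, v (a - e) < r -> ~~ root P a) ->
  v (z - e) < r -> v P.[z] = nrm P e r.
Proof.
move=> noroot ze; have [->|P0] := eqVneq P 0.
  by rewrite horner0 v0 /nrm lead_coef0 v0 mul0r.
apply: v_generic; first exact: ltW.
move=> a; rewrite mem_rts // leNgt => aP; apply/negP => h.
have /noroot : v (a - e) < r by apply: (@vtri_lt z) => //; rewrite vB_sym.
by rewrite aP.
Qed.

(** * Rational maps in homogeneous coordinates *)

Definition pr (w : K * K) : P1 := if w.2 == 0 then None else Some (w.1 / w.2).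
Definition nz (w : K * K) : bool := (w.1 != 0) || (w.2 != 0).
Definition wedge (w w' : K * K) : K := w.1 * w'.2 - w'.1 * w.2.
Definition nm (w : K * K) : R := Num.max (v w.1) (v w.2).

Lemma nz_hcoord (z : P1) : nz (hcoord z).
Proof. by case: z => [a|]; rewrite /nz /= oner_neq0 ?orbT. Qed.
Lemma hcoordK (z : P1) : pr (hcoord z) = z.
Proof. by case: z => [a|]; rewrite /pr /= ?oner_eq0 ?divr1 ?eqxx. Qed.
Lemma hcoord_pr w : nz w -> exists2 l, l != 0 & w = (l * (hcoord (pr w)).1, l * (hcoord (pr w)).2).
Proof.
case: w => x y; rewrite /nz /pr /=; have [->|y0] := eqVneq y 0 => /=.
  by rewrite orbF => x0; exists x; rewrite // mulr1 mulr0.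
by move=> _; exists y; rewrite // mulr1 mulrCA divff // mulr1.
Qed.
Lemma nm_gt0 w : nz w -> 0 < nm w.
Proof. by rewrite lt_max !v_gt0. Qed.
Lemma nm_scale l x y : nm (l * x, l * y) = v l * nm (x, y).
Proof. by rewrite /nm /= !vM -maxr_pMr ?v_ge0. Qed.
Lemma chordal_pr w w' : nz w -> nz w' ->
  chordal v (pr w) (pr w') = v (wedge w w') / (nm w * nm w').
Proof.
move=> /hcoord_pr [l l0 wE] /hcoord_pr [m m0 wE'].
move: (pr w) (pr w') wE wE' => z z' -> ->.
rewrite !nm_scale /chordal /wedge; case: (hcoord z) (nz_hcoord z) => x y nx /=.
case: (hcoord z') (nz_hcoord z') => x' y' nx' /=.
have -> : l * x * (m * y') - m * x' * (l * y) = (l * m) * (x * y' - x' * y) by ring.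
rewrite !vM -/(nm (x, y)) -/(nm (x', y')).
have := nm_gt0 nx; have := nm_gt0 nx'; rewrite -v_gt0 in l0; rewrite -v_gt0 in m0.
move: (nm _) (nm _) (v l) (v m) l0 m0 => a b c d *; field.
by rewrite !gt_eqF.
Qed.
Lemma chordalE z w : chordal v z w = v (wedge (hcoord z) (hcoord w)) / (nm (hcoord z) * nm (hcoord w)).
Proof. by rewrite -chordal_pr ?nz_hcoord ?hcoordK. Qed.
Lemma chordal_ge0 z w : 0 <= chordal v z w.
Proof. by rewrite chordalE divr_ge0 ?v_ge0 // mulr_ge0 // ltW // nm_gt0 ?nz_hcoord. Qed.
Lemma pr_eq w w' : nz w -> nz w' -> (pr w == pr w') = (wedge w w' == 0).
Proof.
case: w => x y; case: w' => x' y'; rewrite /nz /pr /wedge /=.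
have [->|y0] := eqVneq y 0; have [->|y0'] := eqVneq y' 0; rewrite ?orbF ?mulr0 ?subr0 ?sub0r /=.
- by rewrite !eqxx.
- by move=> x0 _; rewrite mulf_eq0 (negbTE x0) (negbTE y0').
- by move=> _ x0; rewrite oppr_eq0 mulf_eq0 (negbTE x0) (negbTE y0).
move=> _ _; rewrite subr_eq0.
have -> : (Some (x / y) == Some (x' / y')) = (x / y == x' / y') by [].
by rewrite eqr_div.
Qed.
Lemma chordal_eq0 z w : (chordal v z w == 0) = (z == w).
Proof.
rewrite chordalE mulf_eq0 v_eq0 invr_eq0 mulf_eq0 !gt_eqF ?nm_gt0 ?nz_hcoord //= orbF.
by rewrite -pr_eq ?nz_hcoord ?hcoordK.
Qed.
Lemma chordal_xx z : chordal v z z = 0.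
Proof. by apply/eqP; rewrite chordal_eq0. Qed.
Lemma chordal_sym z w : chordal v z w = chordal v w z.
Proof. by rewrite !chordalE [nm _ * _]mulrC /wedge vB_sym. Qed.

(** The homogenisation of P in degree d, which treats infinity like the other points. *)
Definition heval (d : nat) (P : {poly K}) (w : K * K) : K :=
  \sum_(i < d.+1) P`_i * w.1 ^+ i * w.2 ^+ (d - i).
Definition hmap d P Q (w : K * K) : K * K := (heval d P w, heval d Q w).

Lemma heval_scale d P l x y : heval d P (l * x, l * y) = l ^+ d * heval d P (x, y).
Proof.
rewrite /heval mulr_sumr; apply: eq_bigr => i _ /=.
rewrite !exprMn; have -> : l ^+ d = l ^+ i * l ^+ (d - i) by rewrite -exprD subnKC // -ltnS.
ring.
Qed.
Lemma heval_affine d (P : {poly K}) a : (size P <= d.+1)%N -> heval d P (a, 1) = P.[a].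
Proof.
move=> sP; rewrite /heval (horner_coef_wide _ sP); apply: eq_bigr => i _ /=.
by rewrite expr1n mulr1.
Qed.
Lemma heval_ne0 d (P : {poly K}) x y : (size P <= d.+1)%N -> y != 0 ->
  heval d P (x, y) = y ^+ d * P.[x / y].
Proof.
move=> sP y0; rewrite -(heval_affine _ sP) -heval_scale; congr heval.
by rewrite mulr1 mulrCA divff ?mulr1.
Qed.
Lemma heval_inf d (P : {poly K}) x : heval d P (x, 0) = P`_d * x ^+ d.
Proof.
rewrite /heval big_ord_recr /= subnn expr0 mulr1 big1 ?add0r // => i _.
by rewrite expr0n subn_eq0 leqNgt ltn_ord mulr0.
Qed.
Lemma hevalD d P Q w : heval d (P + Q) w = heval d P w + heval d Q w.
Proof. by rewrite /heval -big_split; apply: eq_bigr => i _; rewrite coefD !mulrDl. Qed.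
Lemma hevalZ d a P w : heval d (a *: P) w = a * heval d P w.
Proof. by rewrite /heval mulr_sumr; apply: eq_bigr => i _; rewrite coefZ !mulrA. Qed.
Lemma heval_sum d (I : Type) (r : seq I) (F : I -> {poly K}) w :
  heval d (\sum_(i <- r) F i) w = \sum_(i <- r) heval d (F i) w.
Proof.
elim: r => [|i r IH]; last by rewrite !big_cons hevalD IH.
by rewrite !big_nil /heval big1 // => i _; rewrite coef0 !mul0r.
Qed.
Lemma hevalM d e (P Q : {poly K}) w : (size P <= d.+1)%N -> (size Q <= e.+1)%N ->
  heval (d + e) (P * Q) w = heval d P w * heval e Q w.
Proof.
case: w => x y sP sQ.
have sPQ : (size (P * Q)%R <= (d + e).+1)%N.
  by apply: leq_trans (size_polyMleq _ _) _; have := leq_add sP sQ; lia.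
have [->|y0] := eqVneq y 0; last first.
  by rewrite !heval_ne0 // hornerM exprD; ring.
have hd : (d < (d + e).+1)%N by rewrite ltnS leq_addr.
rewrite !heval_inf coefM (bigD1 (Ordinal hd)) //=.
rewrite big1 => [|[i hi] /= ne]; last first.
  have [lt|ge] := ltnP d i; first by rewrite nth_default ?mul0r // (leq_trans sP).
  rewrite [Q`__]nth_default ?mulr0 // (leq_trans sQ) //.
  have : i != d by apply: contraNneq ne => h; apply/eqP/val_inj.
  lia.
by rewrite addr0 addKn exprD; ring.
Qed.
Lemma hevalX d (P : {poly K}) n w : (size P <= d.+1)%N ->
  (size (P ^+ n) <= (n * d).+1)%N /\ heval (n * d) (P ^+ n) w = heval d P w ^+ n.
Proof.
move=> sP; elim: n => [|n [s1 IH]].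
  by rewrite !expr0 size_poly1 mul0n /heval big_ord1 coef1 !mulr1.
rewrite !exprS mulSn hevalM // IH; split=> //.
by apply: leq_trans (size_polyMleq _ _) _; have := leq_add sP s1; lia.
Qed.

(** The condition on [nz] says that P and Q, homogenised in degree d, have no common zero on the
    projective line, infinity included; so d is the exact degree of the map. In this form
    composition needs no computation of a gcd. *)
Definition rat_rep d (P Q : {poly K}) (F : P1 -> P1) : Prop :=
  [/\ (size P <= d.+1)%N, (size Q <= d.+1)%N, forall w, nz w -> nz (hmap d P Q w)
    & forall z, F z = pr (hmap d P Q (hcoord z))].
Definition ratmap (F : P1 -> P1) : Prop := exists d P Q, rat_rep d P Q F.

Lemma pr_scale l x y : l != 0 -> pr (l * x, l * y) = pr (x, y).
Proof.
move=> l0; rewrite /pr /= mulf_eq0 (negbTE l0) /=; case: eqVneq => // y0.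
by congr Some; field; rewrite y0.
Qed.
Lemma rat_rep_pr d P Q F w : rat_rep d P Q F -> nz w -> F (pr w) = pr (hmap d P Q w).
Proof.
move=> [_ _ _ FE] /hcoord_pr [l l0 wE]; rewrite FE [in RHS]wE /hmap !heval_scale.
by rewrite pr_scale ?expf_neq0 //; case: (hcoord _).
Qed.
Definition hcomp d (P S T : {poly K}) : {poly K} := \sum_(i < d.+1) P`_i *: (S ^+ i * T ^+ (d - i)).
Lemma heval_comp d e (P S T : {poly K}) w : (size S <= e.+1)%N -> (size T <= e.+1)%N ->
  (size (hcomp d P S T) <= (d * e).+1)%N /\
  heval (d * e) (hcomp d P S T) w = heval d P (hmap e S T w).
Proof.
move=> sS sT; have E (i : 'I_d.+1) : (d * e = i * e + (d - i) * e)%N.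
  by rewrite -mulnDl subnKC // -ltnS.
split.
  apply: leq_trans (size_sum _ _ _) _; apply/bigmax_leqP => i _.
  apply: leq_trans (size_scale_leq _ _) _; rewrite (E i).
  apply: leq_trans (size_polyMleq _ _) _.
  have := leq_add (proj1 (hevalX i w sS)) (proj1 (hevalX (d - i) w sT)).
  set a := size _; set b := size _; set c := (i * e)%N; set f := ((d - i) * e)%N.
  lia.
rewrite /hcomp heval_sum {2}/heval; apply: eq_bigr => i _ /=; rewrite hevalZ (E i).
have [s1 e1] := hevalX i w sS; have [s2 e2] := hevalX (d - i) w sT.
by rewrite hevalM // e1 e2 mulrA.
Qed.
Lemma rat_rep_comp d P Q F e S T G : rat_rep d P Q F -> rat_rep e S T G ->
  rat_rep (d * e) (hcomp d P S T) (hcomp d Q S T) (F \o G).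
Proof.
move=> rF rG; have [sP sQ nF FE] := rF; have [sS sT nG GE] := rG.
have hE w : hmap (d * e) (hcomp d P S T) (hcomp d Q S T) w = hmap d P Q (hmap e S T w).
  by rewrite /hmap !(proj2 (heval_comp _ _ _ sS sT)).
split; try by have [] := heval_comp d P (0, 0) sS sT.
- by have [] := heval_comp d Q (0, 0) sS sT.
- by move=> w wn; rewrite hE nF // nG.
by move=> z; rewrite /= hE GE (rat_rep_pr rF) // nG // nz_hcoord.
Qed.
Lemma ratmap_comp F G : ratmap F -> ratmap G -> ratmap (F \o G).
Proof.
move=> [d [P [Q rF]]] [e [S [T rG]]]; exists (d * e)%N, (hcomp d P S T), (hcomp d Q S T).
exact: rat_rep_comp.
Qed.
Lemma ratmap_id : ratmap id.
Proof.
exists 1%N, 'X, 1; have hE w : hmap 1 'X 1 w = w.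
  case: w => x y; rewrite /hmap /heval !big_ord_recl !big_ord0 /= !coefX !coef1 /=.
  by rewrite !expr0 !expr1 !mulr1 !mul1r !mul0r !addr0 add0r.
by split=> [|||z]; rewrite ?size_polyX ?size_poly1 //; [move=> w; rewrite hE|rewrite hE hcoordK].
Qed.
Lemma ratmap_iter F n : ratmap F -> ratmap (iter n F).
Proof.
move=> rF; elim: n => [|n IH]; first exact: ratmap_id.
exact: (@ratmap_comp F (iter n F)).
Qed.
Lemma ratmap_rateval f : rat_rep (ratdeg f) (ratnum f) (ratden f) (rateval f).
Proof.
have sN : (size (ratnum f) <= (ratdeg f).+1)%N.
  by rewrite /ratdeg; have := leq_maxl (size (ratnum f)) (size (ratden f)); lia.
have sD : (size (ratden f) <= (ratdeg f).+1)%N.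
  by rewrite /ratdeg; have := leq_maxr (size (ratnum f)) (size (ratden f)); lia.
split=> //.
  move=> [x y]; rewrite /nz /hmap /=; have [->|y0 _] := eqVneq y 0 => /=.
    rewrite orbF !heval_inf => x0; rewrite !mulf_eq0 !negb_or !expf_neq0 // !andbT.
    have := ratden_neq0 f; rewrite -size_poly_gt0 /ratdeg => s0.
    case: leqP => h.
      by apply/orP; right; rewrite -lead_coefE lead_coef_eq0 -size_poly_gt0.
    by apply/orP; left; rewrite -lead_coefE lead_coef_eq0 -size_poly_gt0 (ltn_trans s0 h).
  rewrite !heval_ne0 // !mulf_eq0 !(negbTE (expf_neq0 _ y0)) /=.
  have := coprimep_ratnum_ratden f => cp; case: eqP => //= /eqP h.
  exact: (coprimep_root cp).
case=> [a|] /=; first by rewrite /hmap !heval_affine /pr.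
by rewrite /hmap !heval_inf !expr1n !mulr1 /pr.
Qed.

Section RatMap.
Variables (d : nat) (P Q : {poly K}) (F : P1 -> P1).
Hypothesis rF : rat_rep d P Q F.
Let sP : (size P <= d.+1)%N. Proof. by case: rF. Qed.
Let sQ : (size Q <= d.+1)%N. Proof. by case: rF. Qed.

Lemma ratE z : F (Some z) = if Q.[z] == 0 then None else Some (P.[z] / Q.[z]).
Proof. by case: rF => _ _ _ ->; rewrite /hmap !heval_affine. Qed.
Lemma ratE_inf : F None = if Q`_d == 0 then None else Some (P`_d / Q`_d).
Proof. by case: rF => _ _ _ ->; rewrite /hmap !heval_inf !expr1n !mulr1. Qed.
Lemma rat_coprime z : (P.[z] != 0) || (Q.[z] != 0).
Proof.
case: rF => _ _ h _; have := h (z, 1); rewrite /nz /= oner_neq0 orbT => /(_ isT).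
by rewrite /hmap !heval_affine.
Qed.
Lemma rat_inf_ne0 : (P`_d != 0) || (Q`_d != 0).
Proof.
case: rF => _ _ h _; have := h (1, 0); rewrite /nz /= oner_neq0 => /(_ isT).
by rewrite /hmap !heval_inf !expr1n !mulr1.
Qed.
Lemma rat_pole z : (F (Some z) = None) <-> root Q z.
Proof. by rewrite ratE /root; case: ifP. Qed.
Lemma rat_fiber z c : (F (Some z) = Some c) <-> root (P - c *: Q) z.
Proof.
rewrite ratE /root !hornerE subr_eq0; case: eqVneq => [q0|q0].
  split=> // /eqP; rewrite q0 mulr0 => h; have := rat_coprime z.
  by rewrite h q0 eqxx.
split=> [[<-]|/eqP ->]; first by rewrite divfK.
by rewrite mulfK.
Qed.
(** If P - c Q is constant, its coefficient of degree d > 0 vanishes and infinity is sent to c. *)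
Lemma rat_surj : (0 < d)%N -> forall w, exists z, F z = w.
Proof.
move=> d0 [c|].
  have [|s1] := ltnP 1 (size (P - c *: Q)).
    by move=> /K_closed [z zr]; exists (Some z); apply/rat_fiber.
  exists None; rewrite ratE_inf.
  have : (P - c *: Q)`_d = 0 by rewrite nth_default // (leq_trans s1).
  rewrite coefB coefZ => /eqP; rewrite subr_eq0 => /eqP h.
  have := rat_inf_ne0; rewrite h; case: (eqVneq Q`_d 0) => [->|q0 _]; first by rewrite mulr0 eqxx.
  by rewrite mulfK.
have [|s1] := ltnP 1 (size Q).
  by move=> /K_closed [z zr]; exists (Some z); apply/rat_pole.
by exists None; rewrite ratE_inf nth_default ?eqxx // (leq_trans s1).
Qed.
End RatMap.

(** * Discs mapped into themselves *)

(** Telescoping over the linear factors: each root is at distance at least rho from z', so a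
    displacement of at most k rho changes each factor by at most k times its absolute value. *)
Lemma noroot_close (P : {poly K}) c (rho k : R) z z' : 0 < rho ->
  (forall a, v (a - c) < rho -> ~~ root P a) ->
  v (z - c) < rho -> v (z' - c) < rho -> v (z - z') <= k * rho ->
  v (P.[z] - P.[z']) <= k * v P.[z'].
Proof.
move=> rho0 noroot zc zc' zz; have k0 : 0 <= k.
  by have := le_trans (v_ge0 _) zz; rewrite pmulr_lge0.
have [->|P0] := eqVneq P 0; first by rewrite !horner0 subr0 v0 mulr0.
have far a : a \in rts P -> rho <= v (z' - a).
  rewrite mem_rts // leNgt => ra; apply/negP => h.
  have /noroot : v (a - c) < rho by apply: (@vtri_lt z') => //; rewrite vB_sym.
  by rewrite ra.
rewrite !horner_rts -mulrBr !vM mulrCA ler_wpM2l ?v_ge0 //.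
elim: (rts P) far => [|a s IH] far; first by rewrite !big_nil subrr v0 v1 mulr1.
rewrite !big_cons; set A := \prod_(_ <- _) _; set B := \prod_(_ <- _) _.
have -> : (z - a) * A - (z' - a) * B = (z - a) * (A - B) + (z - z') * B by ring.
have fa : rho <= v (z' - a) by apply: far; rewrite mem_head.
have za : v (z - a) = v (z' - a).
  apply: vtri_eq; apply: lt_le_trans fa; apply: (@vtri_lt c) => //; by rewrite vB_sym.
apply: vD_le; rewrite !vM.
  rewrite za mulrCA ler_wpM2l ?v_ge0 // IH // => x xs; apply: far; by rewrite inE xs orbT.
rewrite mulrA ler_wpM2r ?v_ge0 // (le_trans zz) // ler_wpM2l //.
Qed.
Lemma v_noroot_closed (P : {poly K}) c (r : R) z : 
  (forall a, v (a - c) <= r -> ~~ root P a) -> v (z - c) <= r -> v P.[z] = v P.[c].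
Proof.
move=> noroot zc; have [->|P0] := eqVneq P 0; first by rewrite !horner0.
rewrite !v_horner; congr (_ * _); apply: eq_big_seq => a; rewrite mem_rts // => ra.
rewrite (@vtri_eq c) // (le_lt_trans zc) // ltNge vB_sym; apply/negP => /noroot.
by rewrite ra.
Qed.

(** Schwarz' lemma for S / Q, which vanishes at b. Generic points w of discs of radius |t| < rho
    satisfy |w - b| = |t|, which bounds T / Q by M / |t|; letting |t| approach rho gives the
    constant M / rho. *)
Lemma schwarz (S T Q : {poly K}) c b (rho M : R) : 0 < rho -> v (b - c) < rho ->
  (forall a, v (a - c) < rho -> ~~ root Q a) ->
  (forall z, v (z - c) < rho -> v S.[z] <= M * v Q.[z]) -> S = T * ('X - b%:P) ->
  forall z, v (z - c) < rho -> v T.[z] * rho <= M * v Q.[z].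
Proof.
move=> rho0 bc noroot SM SE z zc; set q := v Q.[z].
have qE w : v (w - c) < rho -> v Q.[w] = q.
  by move=> h; rewrite /q !(v_noroot noroot).
rewrite leNgt; apply/negP => lt.
have [T0|T0] := eqVneq (v T.[z]) 0.
  move: lt; rewrite T0 mul0r ltNge => /negP; apply.
  by rewrite -(qE z) // (le_trans (v_ge0 S.[z])) // SM.
have T1 : 0 < v T.[z] by rewrite lt_neqAle eq_sym T0 v_ge0.
(* The first bound is below rho exactly by the inequality assumed for contradiction; the disc of
   radius |t| must also contain b and z. *)
pose m := Num.max (M * q / v T.[z]) (Num.max (v (b - c)) (v (z - c))).
have [t t0 /andP[mt trho]] : exists2 t, t != 0 & Num.max (rho / 2) m < v t < rho.
  apply: value_dense; first by rewrite lt_max divr_gt0.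
  have h1 : M * q / v T.[z] < rho by rewrite ltr_pdivrMr // [X in _ < X]mulrC.
  rewrite !gt_max bc zc h1 /= andbT.
  by rewrite ltr_pdivrMr // ltr_pMr // ltr1n.
move: mt; rewrite !gt_max => /and4P[_ mt bt zt].
have [w wc wl] := generic_point c (b :: rts T) t0.
have wc' := le_lt_trans wc trho.
have := SM w wc'; rewrite qE // SE hornerM !hornerE vM.
have -> : v (w - b) = v t.
  apply/eqP; rewrite eq_le (wl b) ?mem_head // andbT.
  by rewrite (@vtri_le c) // vB_sym ltW.
rewrite (@v_generic T c (v t) w) // => [h|a aT]; last by rewrite wl // inE aT orbT.
have h2 : v T.[z] * v t <= M * q.
  by apply: le_trans h; rewrite ler_wpM2r ?v_ge0 // v_le_nrm // ltW.
by move: mt; rewrite ltr_pdivrMr // ltNge mulrC h2.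
Qed.

Section BallDynamics.
Variables (P Q : {poly K}) (c : K) (rho : R).
Hypothesis rho0 : 0 < rho.
Hypothesis nopole : forall a, v (a - c) < rho -> ~~ root Q a.
Let h (z : K) : K := P.[z] / Q.[z].
Hypothesis hU : forall z, v (z - c) < rho -> v (h z - c) < rho.

Let Q0 z : v (z - c) < rho -> Q.[z] != 0. Proof. exact: nopole. Qed.
Let vQ0 z : v (z - c) < rho -> 0 < v Q.[z]. Proof. by move=> zc; rewrite v_gt0 Q0. Qed.
(** [T w] over Q is the difference quotient of h with base point w (see [hB]); as a polynomial it
    can be controlled by its roots. *)
Let T (w : K) : {poly K} := (P - h w *: Q) %/ ('X - w%:P).
Let TE w : v (w - c) < rho -> P - h w *: Q = T w * ('X - w%:P).
Proof.
move=> wc; rewrite divpK // dvdp_XsubCl /root !hornerE /h divfK ?subrr //.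
exact: Q0.
Qed.
Let hB w z : v (w - c) < rho -> v (z - c) < rho -> h z - h w = (z - w) * ((T w).[z] / Q.[z]).
Proof.
move=> wc zc; have E : P.[z] - h w * Q.[z] = (T w).[z] * (z - w).
  by have := congr1 (horner^~ z) (TE wc); rewrite !hornerE.
have -> : (z - w) * ((T w).[z] / Q.[z]) = (P.[z] - h w * Q.[z]) / Q.[z] by rewrite E; ring.
rewrite /h; field.
by rewrite !Q0.
Qed.
(** Schwarz' lemma with M = rho, since h maps into a ball of radius rho; in effect h is
    1-Lipschitz. *)
Let TQ w z : v (w - c) < rho -> v (z - c) < rho -> v (T w).[z] <= v Q.[z].
Proof.
move=> wc zc.
have := @schwarz _ (T w) Q c w rho rho rho0 wc nopole _ (TE wc) z zc.
rewrite [rho * _]mulrC ler_pM2r //; apply=> x xc.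
have -> : (P - h w *: Q).[x] = (h x - h w) * Q.[x].
  by rewrite !hornerE /h; field; rewrite !Q0.
rewrite vM ler_wpM2r ?v_ge0 // ltW // (@vtri_lt c) ?hU // vB_sym hU //.
Qed.
(** A second application of Schwarz' lemma, to T / Q with bound 1: a root b of the difference
    quotient gains a factor |z - b| / rho. *)
Let Troot w b z : v (w - c) < rho -> v (b - c) < rho -> root (T w) b -> v (z - c) < rho ->
  v (T w).[z] * rho <= v (z - b) * v Q.[z].
Proof.
move=> wc bc /factor_theorem [T' T'E] zc.
have /(_ _ z zc) := @schwarz (T w) T' Q c b rho 1 rho0 bc nopole _ T'E.
rewrite mul1r => H; rewrite T'E hornerM !hornerE vM mulrAC mulrC ler_wpM2l ?v_ge0 //.
by apply: H => x xc; rewrite mul1r TQ.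
Qed.
Let Tsym w z : v (w - c) < rho -> v (z - c) < rho -> z != w ->
  (T w).[z] / Q.[z] = (T z).[w] / Q.[w].
Proof.
move=> wc zc zw; have zw' : z - w != 0 by rewrite subr_eq0.
apply: (mulfI zw'); rewrite -hB // -[z - w]opprB mulNr -hB // opprB //.
Qed.
Let vTsym w z : v (w - c) < rho -> v (z - c) < rho -> z != w ->
  v (T w).[z] / v Q.[z] = v (T z).[w] / v Q.[w].
Proof. by move=> wc zc zw; rewrite -!vV -!vM Tsym. Qed.

Definition isometric := forall z w, v (z - c) < rho -> v (w - c) < rho ->
  v (h z - h w) = v (z - w).
Definition contracting r k := forall z w, v (z - c) <= r -> v (w - c) <= r ->
  v (h z - h w) <= k * v (z - w).

Let w_isom := exists w, v (w - c) < rho /\ forall z, v (z - c) < rho -> v (T w).[z] = v Q.[z].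

(** By symmetry T_w / Q has absolute value 1 at w0, the largest possible. A root of T_w would make
    it smaller there by [Troot]; so T_w has no root and |T_w / Q| is constant. *)
Let isom_T : w_isom -> forall w, v (w - c) < rho ->
  (forall a, v (a - c) < rho -> ~~ root (T w) a) /\
  (forall z, v (z - c) < rho -> v (T w).[z] = v Q.[z]).
Proof.
move=> [w0 [w0c w0T]] w wc.
have noroot0 a : v (a - c) < rho -> ~~ root (T w0) a.
  by move=> ac; rewrite /root -v_eq0 w0T // gt_eqF // vQ0.
have [<-|ww] := eqVneq w0 w; first by split.
have E : v (T w).[w0] = v Q.[w0].
  have := vTsym wc w0c ww; rewrite (w0T w) // divff ?gt_eqF ?vQ0 // => /(canRL (divfK _)) ->;
  by rewrite ?mul1r // gt_eqF // vQ0.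
have nor a : v (a - c) < rho -> ~~ root (T w) a.
  move=> ac; apply/negP => /(Troot wc ac)/(_ w0c); rewrite E mulrC ler_pM2r ?vQ0 //.
  by rewrite leNgt (@vtri_lt c) // vB_sym.
by split=> // z zc; rewrite (v_noroot nor zc) -(v_noroot nor w0c) E (v_noroot nopole w0c) -(v_noroot nopole zc).
Qed.

(** If no base point has |T_w| = |Q| throughout, then |T_c / Q| <= k < 1 on the smaller disc: either
    a root of T_c gives k through [Troot], or |T_c / Q| is a constant below 1. For another base
    point w, a root of T_w in the disc gives r / rho; otherwise |T_w / Q| is constant there and
    equals |T_c(w) / Q(w)| by symmetry. *)
Lemma isometric_or_contracting :
  isometric \/ forall r, 0 <= r -> r < rho -> exists k, [/\ 0 <= k, k < 1 & contracting r k].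
Proof.
case: (pselect w_isom) => [wi|nwi].
  left=> z w zc wc; rewrite hB // !vM vV (proj2 (isom_T wi wc) z zc) divff ?mulr1 //.
  by rewrite gt_eqF // vQ0.
right=> r r0 rrho.
have cc : v (c - c) < rho by rewrite subrr v0.
have [k [k0 k1 kc]] : exists k, [/\ 0 <= k, k < 1 &
    forall z, v (z - c) <= r -> v (T c).[z] <= k * v Q.[z]].
  case: (pselect (exists2 b, v (b - c) < rho & root (T c) b)) => [[b bc rb]|nob].
    exists (Num.max r (v (b - c)) / rho); split.
    - by rewrite divr_ge0 ?le_max ?r0 // ltW.
    - by rewrite ltr_pdivrMr // mul1r gt_max rrho.
    move=> z zr; have zc := le_lt_trans zr rrho.
    rewrite mulrAC ler_pdivlMr // (le_trans (Troot cc bc rb zc)) // ler_wpM2r ?v_ge0 //.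
    by rewrite (@vtri_le c) ?le_max ?zr // vB_sym lexx orbT.
  have nor a : v (a - c) < rho -> ~~ root (T c) a.
    by move=> ac; apply/negP => ra; apply: nob; exists a.
  exists (v (T c).[c] / v Q.[c]); split; first by rewrite divr_ge0 ?v_ge0.
    rewrite lt_neqAle ler_pdivrMr ?vQ0 // mul1r TQ // andbT; apply/negP => /eqP E.
    apply: nwi; exists c; split=> // z zc.
    have E2 : v (T c).[c] = v Q.[c] by rewrite -[RHS]mul1r -E divfK // gt_eqF // vQ0.
    by rewrite (v_noroot nor zc) -(v_noroot nor cc) E2 (v_noroot nopole cc) -(v_noroot nopole zc).
  move=> z zr; have zc := le_lt_trans zr rrho.
  rewrite (v_noroot nopole zc) -(v_noroot nopole cc) divfK ?gt_eqF ?vQ0 //.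
  by rewrite (v_noroot nor zc) -(v_noroot nor cc).
exists (Num.max k (r / rho)); split; first by rewrite le_max k0.
  by rewrite gt_max k1 ltr_pdivrMr // mul1r.
move=> z w zr wr; have zc := le_lt_trans zr rrho; have wc := le_lt_trans wr rrho.
rewrite hB // vM [X in _ <= X]mulrC ler_wpM2l ?v_ge0 // vM vV ler_pdivrMr ?vQ0 //.
case: (pselect (exists2 b, v (b - c) <= r & root (T w) b)) => [[b br rb]|nob].
  apply: (@le_trans _ _ ((r / rho) * v Q.[z])); last first.
    by rewrite ler_wpM2r ?v_ge0 // le_max lexx orbT.
  have bc := le_lt_trans br rrho.
  rewrite mulrAC ler_pdivlMr // (le_trans (Troot wc bc rb zc)) // ler_wpM2r ?v_ge0 //.
  by rewrite (@vtri_le c) // vB_sym.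
apply: (@le_trans _ _ (k * v Q.[z])); last by rewrite ler_wpM2r ?v_ge0 // le_max lexx.
have [wE|wne] := eqVneq w c; first by rewrite wE kc.
have nor a : v (a - c) <= r -> ~~ root (T w) a.
  by move=> ac; apply/negP => ra; apply: nob; exists a.
rewrite (v_noroot_closed nor zr) (v_noroot nopole zc) -(v_noroot nopole cc).
have wne' : c != w by rewrite eq_sym.
have := vTsym wc cc wne' => /(canRL (divfK _)) ->; last by rewrite gt_eqF // vQ0.
by rewrite ler_wpM2r ?v_ge0 // ler_pdivrMr ?vQ0 // kc.
Qed.

(** The slope b is the difference quotient at (c, c). All difference quotients are root-free of
    absolute value 1, so moving either argument within the smaller disc changes them by at most r /
    rho. *)
Lemma isometric_affine r : isometric -> 0 < r -> r < rho ->
  exists b, v b = 1 /\ forall z w, v (z - c) <= r -> v (w - c) <= r ->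
    v (h z - h w - b * (z - w)) <= r / rho * v (z - w).
Proof.
move=> iso r0 rrho.
have cc : v (c - c) < rho by rewrite subrr v0.
(* Isometry controls |T_c / Q| only off c; but a root of T_c in the ball would by [Troot] push the
   quotient below 1 at c + t as well. *)
have wi : w_isom.
  apply: contrapT => nwi.
  have [t t0 /andP[_ tr]] : exists2 t, t != 0 & r / 2 < v t < r.
    by apply: value_dense; rewrite ?divr_gt0 // ltr_pdivrMr // ltr_pMr // ltr1n.
  have H w : v (w - c) < rho -> w != c -> v (T c).[w] = v Q.[w].
    move=> wc wne; have := iso w c wc cc; rewrite hB // !vM vV.
    have w0 : v (w - c) != 0 by rewrite v_eq0 subr_eq0.
    move=> /(canRL (mulKf w0)); rewrite mulVf // => /(canRL (divfK _)); rewrite mul1r; apply.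
    by rewrite gt_eqF // vQ0.
  have [b [bc rb]] : exists b, v (b - c) < rho /\ root (T c) b.
    apply: contrapT => nob; apply: nwi; exists c; split=> // z zc.
    have nor a : v (a - c) < rho -> ~~ root (T c) a.
      by move=> ac; apply/negP => ra; apply: nob; exists a.
    have tc : v (c + t - c) < rho by rewrite addrAC subrr add0r (lt_trans tr).
    rewrite (v_noroot nor zc) -(v_noroot nor tc) H //; last first.
      by rewrite -subr_eq0 addrAC subrr add0r.
    by rewrite (v_noroot nopole tc) -(v_noroot nopole zc).
  have tc : v (c + t - c) < rho by rewrite addrAC subrr add0r (lt_trans tr).
  have := Troot cc bc rb tc; rewrite H //; last by rewrite -subr_eq0 addrAC subrr add0r.
  rewrite mulrC ler_pM2r ?vQ0 // leNgt (@vtri_lt c) // vB_sym //.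
have clo w z z' : v (w - c) <= r -> v (z - c) <= r -> v (z' - c) <= r ->
    v ((T w).[z] / Q.[z] - (T w).[z'] / Q.[z']) <= r / rho.
  move=> wr zr zr'; have wc := le_lt_trans wr rrho.
  have zc := le_lt_trans zr rrho; have zc' := le_lt_trans zr' rrho.
  have [nor E] := isom_T wi wc.
  have zz : v (z - z') <= r / rho * rho.
    by rewrite divfK ?gt_eqF // (@vtri_le c) // vB_sym.
  have -> : (T w).[z] / Q.[z] - (T w).[z'] / Q.[z'] =
    ((T w).[z] - (T w).[z']) / Q.[z] - (T w).[z'] / Q.[z'] * ((Q.[z] - Q.[z']) / Q.[z]).
    by field; rewrite !Q0.
  have QE : v Q.[z] = v Q.[z'] by rewrite (v_noroot nopole zc) (v_noroot nopole zc').
  apply: vD_le; rewrite ?vN !vM !vV QE.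
    by rewrite ler_pdivrMr ?vQ0 // -(E z') // (noroot_close rho0 nor).
  rewrite E // divff ?gt_eqF ?vQ0 // mul1r ler_pdivrMr ?vQ0 //.
  by rewrite (noroot_close rho0 nopole).
exists ((T c).[c] / Q.[c]); split.
  by rewrite vM vV (proj2 (isom_T wi cc)) // divff // gt_eqF // vQ0.
have cr : v (c - c) <= r by rewrite subrr v0 ltW.
move=> z w zr wr; have zc := le_lt_trans zr rrho; have wc := le_lt_trans wr rrho.
rewrite hB // [_ * (z - w)]mulrC -mulrBr vM mulrC ler_wpM2r ?v_ge0 //.
have [wE|wne] := eqVneq w c; first by rewrite wE clo.
apply: (@vtri_le ((T w).[c] / Q.[c])); first exact: clo.
by rewrite Tsym // 1?eq_sym // clo.
Qed.
End BallDynamics.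

(** * Iteration of contractions and isometries on a closed disc *)

Lemma sum_shift (F : nat -> K) a n :
  \sum_(i < n) F i = n%:R * a + \sum_(i < n) (F i - a).
Proof. by rewrite sumrB sumr_const card_ord mulr_natl [RHS]addrC subrK. Qed.
Lemma expr_anti (k : R) m n : 0 <= k -> k < 1 -> (m <= n)%N -> k ^+ n <= k ^+ m.
Proof.
move=> k0 k1 h; rewrite -(subnK h) exprD ler_piMl ?exprn_ge0 //.
by rewrite exprn_ile1 // ltW.
Qed.
Section DiscMaps.
Variables (f : K -> K) (c : K) (r : R).
Hypothesis r0 : 0 <= r.
Hypothesis f_disc : forall z, v (z - c) <= r -> v (f z - c) <= r.
Let iter_disc n z : v (z - c) <= r -> v (iter n f z - c) <= r.
Proof. by move=> zr; elim: n => //= n; apply: f_disc. Qed.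
Let cc : v (c - c) <= r. Proof. by rewrite subrr v0. Qed.

Lemma contraction_fixpoint k : 0 <= k -> k < 1 ->
  (forall z w, v (z - c) <= r -> v (w - c) <= r -> v (f z - f w) <= k * v (z - w)) ->
  exists2 l, v (l - c) <= r &
    forall j z, v (z - c) <= r -> v (iter j f z - l) <= k ^+ j * r.
Proof.
move=> k0 k1 fk.
have lip j z w : v (z - c) <= r -> v (w - c) <= r ->
    v (iter j f z - iter j f w) <= k ^+ j * r.
  move=> zr wr; apply: (@le_trans _ _ (k ^+ j * v (z - w))); last first.
    by rewrite ler_wpM2l ?exprn_ge0 // (@vtri_le c) // vB_sym.
  elim: j => [|j IH]; first by rewrite expr0 mul1r.
  rewrite /= (le_trans (fk _ _ (iter_disc j zr) (iter_disc j wr))) //.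
  by rewrite exprS -mulrA ler_wpM2l.
have cau m n : (n <= m)%N -> v (iter m f c - iter n f c) <= k ^+ n * r.
  move=> nm_; rewrite -(subnK nm_) addnC iterD lip //; exact: iter_disc.
have [l ul] : exists l, v (iter n f c - l) @[n --> \oo] --> (0 : R).
  apply: v_complete => e e0.
  have [N Ne] : exists N, k ^+ N * (r + 1) < e.
    have [N h] := expr_lt_eps k0 k1 (divr_gt0 e0 (ltr_wpDl r0 ltr01)).
    by exists N; rewrite -ltr_pdivlMr // ltr_wpDl.
  have Ne' n : (N <= n)%N -> k ^+ n * r < e.
    move=> h; apply: le_lt_trans Ne; apply: ler_pM; rewrite ?exprn_ge0 ?lerDl //.
    exact: expr_anti k0 k1 h.
  exists N => m n mN nN; have [mn|/ltnW mn] := leqP n m.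
    exact: le_lt_trans (cau _ _ mn) (Ne' _ nN).
  by rewrite vB_sym; exact: le_lt_trans (cau _ _ mn) (Ne' _ mN).
have lim n : v (iter n f c - l) <= k ^+ n * r.
  apply/ler_addgt0Pr => e e0.
  move/cvgrPdist_lt/(_ e e0): ul => [N _ /(_ (maxn N n) (leq_maxl _ _))] /=.
  rewrite sub0r normrN ger0_norm ?v_ge0 // => h.
  apply: (@vtri_le (iter (maxn N n) f c)).
    by rewrite vB_sym (le_trans (cau _ _ (leq_maxr _ _))) // lerDl ltW.
  by rewrite (le_trans (ltW h)) // lerDr mulr_ge0 ?exprn_ge0.
exists l; first by have := lim 0%N; rewrite vB_sym expr0 mul1r.
by move=> j z zr; apply: (@vtri_le (iter j f c)); [apply: lip|apply: lim].
Qed.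

(* Iterating an isometry that is affine with unit slope b up to a factor k < 1:
   for b^N = 1 + small, f^N is close to the identity, and each further p-th
   iteration brings it closer. *)
Lemma isometry_recurrent b k : v b = 1 -> 0 <= k -> k < 1 ->
  (forall z w, v (z - c) <= r -> v (w - c) <= r -> v (f z - f w) = v (z - w)) ->
  (forall z w, v (z - c) <= r -> v (w - c) <= r ->
     v (f z - f w - b * (z - w)) <= k * v (z - w)) ->
  exists N k', [/\ (0 < N)%N, 0 <= k', k' < 1 &
    forall j z, v (z - c) <= r -> v (iter (N * p ^ j) f z - z) <= k' ^+ j * r].
Proof.
move=> vb k0 k1 iso aff.
have isoN n z w : v (z - c) <= r -> v (w - c) <= r ->
    v (iter n f z - iter n f w) = v (z - w).
  by move=> zr wr; elim: n => //= n <-; apply: iso; apply: iter_disc.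
have affN n z w : v (z - c) <= r -> v (w - c) <= r ->
    v (iter n f z - iter n f w - b ^+ n * (z - w)) <= k * v (z - w).
  move=> zr wr; elim: n => [|n IH].
    by rewrite expr0 mul1r subrr v0 mulr_ge0 ?v_ge0.
  rewrite exprS -mulrA /=.
  set A := iter n f z in IH *; set B := iter n f w in IH *.
  have -> : f A - f B - b * (b ^+ n * (z - w)) =
    (f A - f B - b * (A - B)) + b * (A - B - b ^+ n * (z - w)) by ring.
  apply: vD_le; last by rewrite vM vb mul1r.
  by rewrite -(isoN n z w) // aff //; apply: iter_disc.
(* The reduction of b lies in a field of p^e elements, so b^N is 1 modulo the maximal ideal for N =
   p^e - 1. *)
have [|e e0 eb] := @v_res b; first by rewrite vb.
set N := (p ^ e).-1.
have pe1 : (1 < p ^ e)%N by rewrite -(exp1n e) ltn_exp2r // prime_gt1 // p_prime.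
have NE : N.+1 = (p ^ e)%N by rewrite /N prednK // ltnW.
have N0 : (0 < N)%N by rewrite -ltnS NE.
have bN : v (b ^+ N - 1) < 1.
  by rewrite -[v _]mul1r -{1}vb -vM mulrBr mulr1 -exprS NE.
(* k1' is a Lipschitz constant of f^N - id; k' also absorbs |p|, which appears at each further p-th
   iteration. *)
set k1' := Num.max k (v (b ^+ N - 1)); set k' := Num.max k1' (v p%:R).
have k1'0 : 0 <= k1' by rewrite le_max k0.
have k'0 : 0 <= k' by rewrite le_max k1'0.
exists N, k'; split => //; first by rewrite !gt_max k1 bN v_p.
have main j : (forall z w, v (z - c) <= r -> v (w - c) <= r ->
    v ((iter (N * p ^ j) f z - z) - (iter (N * p ^ j) f w - w)) <= k1' * v (z - w))
  /\ (forall z, v (z - c) <= r -> v (iter (N * p ^ j) f z - z) <= k' ^+ j * r).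
  elim: j => [|j [IH1 IH2]].
    rewrite expn0 muln1; split=> [z w zr wr|z zr]; last first.
      rewrite expr0 mul1r; apply: (@vtri_le c); last by rewrite vB_sym.
      exact: iter_disc.
    have -> : iter N f z - z - (iter N f w - w) =
      (iter N f z - iter N f w - b ^+ N * (z - w)) + (b ^+ N - 1) * (z - w) by ring.
    apply: vD_le; last by rewrite vM ler_wpM2r ?v_ge0 // le_max lexx orbT.
    by rewrite (le_trans (affN _ _ _ zr wr)) // ler_wpM2r ?v_ge0 // le_max lexx.
  set G := iter (N * p ^ j) f.
  have GE n z : iter (N * p ^ j * n) f z = iter n G z.
    by elim: n => [|n IHn]; rewrite ?muln0 // mulnS iterD IHn.
  have E z : iter (N * p ^ j.+1) f z - z = \sum_(i < p) (G (iter i G z) - iter i G z).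
    rewrite expnS mulnCA mulnC GE; elim: (p) => [|n IHn]; first by rewrite big_ord0 subrr.
    by rewrite big_ord_recr /= -IHn; ring.
  have Gd n z : v (z - c) <= r -> v (iter n G z - c) <= r.
    by move=> zr; rewrite -GE; apply: iter_disc.
  have Giso n z w : v (z - c) <= r -> v (w - c) <= r ->
    v (iter n G z - iter n G w) = v (z - w) by rewrite -!GE; apply: isoN.
  split=> [z w zr wr|z zr].
    rewrite !E -sumrB; apply: v_sum_le; first by rewrite mulr_ge0 ?v_ge0.
    by move=> i; rewrite -(Giso i z w) // IH1 //; apply: Gd.
  have Gz n : v (iter n G z - z) <= v (G z - z).
    elim: n => [|n IHn]; first by rewrite subrr v0 v_ge0.
    apply: (@vtri_le (iter n G z)) => //.
    by rewrite iterSr Giso //; exact: (Gd 1%N).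
  (* The displacement of G^p is a sum of p displacements along the orbit. Each differs from G z - z
     by at most k1' |G z - z|, and p copies of G z - z have size |p| |G z - z|. *)
  rewrite E (sum_shift (fun i => G (iter i G z) - iter i G z) (G z - z)).
  apply: (@le_trans _ _ (k' * v (G z - z))); last first.
    by rewrite exprS -mulrA ler_wpM2l // IH2.
  apply: vD_le; first by rewrite vM ler_wpM2r ?v_ge0 // le_max lexx orbT.
  apply: v_sum_le; first by rewrite mulr_ge0 ?v_ge0.
  move=> i; rewrite (le_trans (IH1 _ _ _ zr)) //; first exact: Gd.
  by apply: ler_pM; rewrite ?v_ge0 // le_max lexx.
by move=> j z zr; apply: (proj2 (main j)).
Qed.
End DiscMaps.

(** * Locally uniform convergence for the chordal metric *)

Lemma chordal_SS a b : chordal v (Some a) (Some b) =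
  v (a - b) / (Num.max (v a) 1 * Num.max (v b) 1).
Proof. by rewrite /chordal /= !mulr1 v1. Qed.
Lemma chordal_SN a : chordal v (Some a) None = (Num.max (v a) 1)^-1.
Proof. by rewrite /chordal /= !mulr0 mul1r sub0r vN v1 v0 div1r (max_idPl ler01) mulr1. Qed.
Lemma max1_ge1 (x : R) : 1 <= Num.max x 1. Proof. by rewrite le_max lexx orbT. Qed.
Lemma max1_gt0 (x : R) : 0 < Num.max x 1. Proof. exact: lt_le_trans ltr01 (max1_ge1 x). Qed.
Lemma chordal_le a b : chordal v (Some a) (Some b) <= v (a - b).
Proof.
rewrite chordal_SS ler_pdivrMr ?mulr_gt0 ?max1_gt0 // ler_peMr ?v_ge0 //.
by rewrite mulr_ege1 ?max1_ge1.
Qed.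
Lemma chordal_small_bounded (M r : R) : 0 < r -> exists2 d, 0 < d &
  forall a, v a <= M -> forall w, chordal v w (Some a) < d -> exists2 b, w = Some b & v (b - a) < r.
Proof.
move=> r0; set N := Num.max M 1; have N0 : 0 < N := max1_gt0 _.
have N1 : 1 <= N := max1_ge1 _.
exists (Num.min 1 r / (N * N)); first by rewrite divr_gt0 ?mulr_gt0 // lt_min ltr01.
move=> a aM; have aN : Num.max (v a) 1 <= N by rewrite ge_max N1 andbT le_max aM.
have dN : Num.min 1 r / (N * N) <= N^-1.
  rewrite ler_pdivrMr ?mulr_gt0 // mulKf ?gt_eqF //.
  by rewrite (le_trans _ N1) // ge_min lexx.
have dN' : Num.min 1 r / (N * N) <= (Num.max (v a) 1)^-1.
  by rewrite (le_trans dN) // lef_pV2 ?posrE ?max1_gt0.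
case=> [b|]; last by rewrite chordal_sym chordal_SN => /lt_le_trans/(_ dN'); rewrite ltxx.
rewrite chordal_SS => h; exists b => //.
have [bN|Nb] := leP (v b) N.
  have bN' : Num.max (v b) 1 <= N by rewrite ge_max bN.
  move: h; rewrite ltr_pdivrMr ?mulr_gt0 ?max1_gt0 // => /lt_le_trans; apply.
  rewrite mulrAC ler_pdivrMr ?mulr_gt0 //; apply: ler_pM.
  - by rewrite le_min ler01 ltW.
  - by rewrite mulr_ge0 // ltW // max1_gt0.
  - by rewrite ge_min lexx orbT.
  - by apply: ler_pM; rewrite // ltW // max1_gt0.
have ab : v a < v b by rewrite (le_lt_trans _ Nb) // (le_trans _ aN) // le_max lexx.
have ba : v (b - a) = v b by rewrite addrC vD_eq // vN.
have b1 : Num.max (v b) 1 = v b by rewrite max_l // (le_trans N1) // ltW.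
have vb0 : v b != 0 by rewrite gt_eqF // (lt_trans N0).
by move: h; rewrite ba b1 invfM mulrA divff // mul1r => /lt_le_trans/(_ dN'); rewrite ltxx.
Qed.
Lemma chordal_small a (r : R) : 0 < r -> exists2 d, 0 < d &
  forall w, chordal v w (Some a) < d -> exists2 b, w = Some b & v (b - a) < r.
Proof.
move=> /(chordal_small_bounded (v a)) [d d0 H]; exists d => // w.
exact: H (lexx _) w.
Qed.

(** Uniform convergence on one neighbourhood of z: the radius d is fixed before e. This is the
    property that propagates along affinoids. *)
Definition unif (F : nat -> P1 -> P1) (phi : P1 -> P1) (z : P1) : Prop :=
  exists2 d : R, 0 < d & forall e : R, 0 < e -> exists J : nat, forall j, (J <= j)%N ->
    forall w, chordal v w z < d -> chordal v (F j w) (phi w) < e.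
(** The convergence at z0 itself is included because it later makes z0 an attracting periodic
    point. *)
Definition attracted_pt (g : P1 -> P1) z := exists z0 n, [/\ (0 < n)%N,
  unif (fun j => iter (n * j) g) (fun=> z0) z & unif (fun j => iter (n * j) g) (fun=> z0) z0].
Definition recurrent_pt (g : P1 -> P1) z := exists2 s : nat -> nat, forall j, (j <= s j)%N &
  unif (fun j => iter (s j) g) id z.
Definition good g z := attracted_pt g z \/ recurrent_pt g z.

Lemma unif_disc (F : nat -> P1 -> P1) (G : nat -> K -> K) (phi : P1 -> P1) (psi : K -> K) c r z k :
  0 < r -> v (z - c) <= r -> 0 <= k -> k < 1 ->
  (forall j w, v (w - c) <= r -> [/\ F j (Some w) = Some (G j w), phi (Some w) = Some (psi w)
     & v (G j w - psi w) <= k ^+ j * r]) ->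
  unif F phi (Some z).
Proof.
move=> r0 zr k0 k1 H; have [d d0 dH] := chordal_small z r0; exists d => // e e0.
have [J Je] := expr_lt_eps k0 k1 (divr_gt0 e0 r0); exists J => j Jj w /dH [b -> bz].
have bc : v (b - c) <= r by apply: (@vtri_le z) => //; apply: ltW.
have [-> -> h] := H j b bc; apply: le_lt_trans (chordal_le _ _) _.
apply: le_lt_trans h _; rewrite -ltr_pdivlMr // (le_lt_trans _ Je) //.
exact: expr_anti k0 k1 Jj.
Qed.

Lemma ball_good d P Q F c rho z : rat_rep d P Q F ->
  (forall a, v (a - c) < rho -> ~~ root Q a) ->
  (forall z, v (z - c) < rho -> v (P.[z] / Q.[z] - c) < rho) ->
  v (z - c) < rho -> good F (Some z).
Proof.
move=> rF nopole hU zc; set h := fun z => P.[z] / Q.[z] in hU *.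
have rho0 : 0 < rho := le_lt_trans (v_ge0 _) zc.
have FE w : v (w - c) < rho -> F (Some w) = Some (h w).
  by move=> wc; rewrite (ratE rF); have := nopole w wc; rewrite /root => /negbTE ->.
have FiE n w : v (w - c) < rho -> iter n F (Some w) = Some (iter n h w) /\ v (iter n h w - c) < rho.
  by move=> wc; elim: n => //= n [-> IH]; rewrite FE //; split=> //; apply: hU.
have cc : v (c - c) < rho by rewrite subrr v0.
(* A smaller closed disc containing z and h c: as h is 1-Lipschitz, it maps this disc into itself,
   and there the contraction and affinity constants are below 1. *)
set m := Num.max (rho / 2) (Num.max (v (z - c)) (v (h c - c))).
have [t t0 /andP[mt trho]] : exists2 t, t != 0 & m < v t < rho.
  apply: value_dense; first by rewrite lt_max divr_gt0.
  by rewrite !gt_max zc hU // andbT ltr_pdivrMr // ltr_pMr // ltr1n.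
move: mt; rewrite !gt_max => /and3P[_ zt ht]; set r := v t in trho zt ht.
have r0 : 0 < r by rewrite v_gt0.
have small w : v (w - c) <= r -> v (w - c) < rho by move=> wr; apply: le_lt_trans wr trho.
have disc : (forall z w, v (z - c) <= r -> v (w - c) <= r -> v (h z - h w) <= v (z - w)) ->
    forall w, v (w - c) <= r -> v (h w - c) <= r.
  move=> lip w wr; apply: (@vtri_le (h c)); last exact: ltW.
  by apply: le_trans (lip _ _ wr _) _ => //; rewrite subrr v0 ltW.
have [iso|con] := isometric_or_contracting rho0 nopole hU.
  right; have [b [b1 aff]] := isometric_affine rho0 nopole hU iso r0 trho.
  have iso' x y : v (x - c) <= r -> v (y - c) <= r -> v (h x - h y) = v (x - y).
    by move=> xr yr; apply: iso; apply: small.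
  have disc' w : v (w - c) <= r -> v (h w - c) <= r.
    by apply: disc => x y xr yr; rewrite iso'.
  have q0 : 0 <= r / rho by rewrite divr_ge0 // ltW.
  have q1 : r / rho < 1 by rewrite ltr_pdivrMr // mul1r.
  have [N [k [N0 k0 k1 H]]] := isometry_recurrent disc' b1 q0 q1 iso' aff.
  exists (fun j => (N * p ^ j)%N).
    move=> j; apply: leq_trans (leq_pmull _ N0); apply: ltnW; apply: ltn_expl.
    by rewrite prime_gt1 // p_prime.
  apply: (@unif_disc _ (fun j => iter (N * p ^ j) h) _ id c r z k) => //; first exact: ltW.
  by move=> j w wr; have [-> _] := FiE (N * p ^ j)%N w (small _ wr); split=> //; apply: H.
left; have [k [k0 k1 kc]] := con r (ltW r0) trho.
have disc' w : v (w - c) <= r -> v (h w - c) <= r.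
  by apply: disc => x y xr yr; rewrite (le_trans (kc _ _ xr yr)) // ler_piMl ?v_ge0 // ltW.
have [l lr H] := contraction_fixpoint (ltW r0) disc' k0 k1 kc.
exists (Some l), 1%N; split=> //.
  apply: (@unif_disc _ (fun j => iter j h) _ (fun=> l) c r z k) => //; first exact: ltW.
  by move=> j w wr; rewrite mul1n; have [-> _] := FiE j w (small _ wr); split=> //; apply: H.
apply: (@unif_disc _ (fun j => iter j h) _ (fun=> l) c r l k) => //.
by move=> j w wr; rewrite mul1n; have [-> _] := FiE j w (small _ wr); split=> //; apply: H.
Qed.

(** * Values omitted on affinoids *)

Lemma unit1M (u w : K) : v (u - 1) < 1 -> v (w - 1) < 1 -> v (u * w - 1) < 1.
Proof.
move=> u1 w1; have -> : u * w - 1 = (u - 1) * w + (w - 1) by ring.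
apply: vD_lt => //; rewrite vM (le_lt_trans _ u1) // ler_piMr ?v_ge0 //.
by rewrite -(subrK 1 w) vD_le ?v1 // ltW.
Qed.
Lemma unit1_v (u : K) : v (u - 1) < 1 -> v u = 1.
Proof. by move=> h; rewrite -(subrK 1 u) vD_eq ?v1. Qed.
Lemma unit1V (u : K) : v (u - 1) < 1 -> v (u^-1 - 1) < 1.
Proof.
move=> h; have u0 : u != 0 by rewrite -v_gt0 unit1_v.
have -> : u^-1 - 1 = - ((u - 1) / u) by field.
by rewrite vN vM vV (unit1_v h) invr1 mulr1.
Qed.

(* The cross ratio of two points inside and two points outside of an open
   ball of the projective line is 1 + something small. *)
Lemma ball_cross B z1 z2 a e : P1_open_ball v B -> B (Some z1) -> B (Some z2) ->
  ~ B (Some a) -> ~ B (Some e) -> v ((z1 - z2) * (a - e)) < v ((z2 - a) * (z1 - e)).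
Proof.
move=> [c [r [[t t0 rE] HB]]]; have r0 : 0 < r by rewrite rE v_gt0.
case: HB => ->.
  move=> [x xr [xE]] [y yr [yE]] na ne; subst x y; rewrite /= in xr yr.
  have far b : ~ K_open_ball v c r (Some b) -> r <= v (b - c).
    by move=> nb; rewrite leNgt; apply/negP => br; apply: nb; exists b.
  have eq_ b z : r <= v (b - c) -> v (z - c) < r -> v (z - b) = v (b - c).
    by move=> rb zr; rewrite (@vtri_eq c) (vB_sym c) // (lt_le_trans zr).
  have fa := far a na; have fe := far e ne.
  rewrite !vM (eq_ _ _ fa yr) (eq_ _ _ fe xr).
  have zz : v (z1 - z2) < r by apply: (@vtri_lt c) => //; rewrite vB_sym.
  have ae : v (a - e) <= Num.max (v (a - c)) (v (e - c)).
    by rewrite (@vtri_le c) ?le_max ?lexx // vB_sym lexx orbT.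
  apply: (@le_lt_trans _ _ (v (z1 - z2) * Num.max (v (a - c)) (v (e - c)))).
    by rewrite ler_wpM2l ?v_ge0.
  apply: (@lt_le_trans _ _ (r * Num.max (v (a - c)) (v (e - c)))).
    by rewrite ltr_pM2r // lt_max (lt_le_trans r0 fa).
  by case: (leP (v (a - c))) => _; [rewrite ler_wpM2r ?v_ge0|rewrite mulrC ler_wpM2l ?v_ge0].
move=> n1 n2 na ne.
have out z : (~` K_closed_ball v c r) (Some z) -> r < v (z - c).
  by move=> nz_; rewrite ltNge; apply/negP => h; apply: nz_; exists z.
have in_ b : ~ (~` K_closed_ball v c r) (Some b) -> v (b - c) <= r.
  by move=> /contrapT [x /= h [<-]].
have o1 := out _ n1; have o2 := out _ n2; have ia := in_ _ na; have ie := in_ _ ne.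
have eq_ z b : r < v (z - c) -> v (b - c) <= r -> v (z - b) = v (z - c).
  by move=> rz br; rewrite vB_sym (@vtri_eq c) (vB_sym c) // (le_lt_trans br).
rewrite !vM (eq_ _ _ o2 ia) (eq_ _ _ o1 ie).
have ae : v (a - e) <= r by apply: (@vtri_le c) => //; rewrite vB_sym.
have zz : v (z1 - z2) <= Num.max (v (z1 - c)) (v (z2 - c)).
  by rewrite (@vtri_le c) ?le_max ?lexx // vB_sym lexx orbT.
apply: (@le_lt_trans _ _ (Num.max (v (z1 - c)) (v (z2 - c)) * r)).
  by rewrite ler_pM ?v_ge0.
have p1 := lt_trans r0 o1; have p2 := lt_trans r0 o2.
by case: (leP (v (z1 - c))) => _; [rewrite ltr_pM2l|rewrite mulrC ltr_pM2r].
Qed.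
Lemma cross_identity (z1 z2 a e : K) :
  (z1 - a) * (z2 - e) - (z2 - a) * (z1 - e) = (z1 - z2) * (a - e).
Proof. ring. Qed.

Definition affinoid_rep n (B : 'I_n.+1 -> set P1) (X : set P1) :=
  (forall i, P1_open_ball v (B i)) /\ X = \bigcap_(i in [set: 'I_n.+1]) B i.

Section Holes.
Variables (n : nat) (B : 'I_n.+1 -> set P1) (X : set P1).
Hypothesis rX : affinoid_rep B X.

(** A chosen ball that misses a; its complement is the hole of a. The default [ord0] is taken at
    points of X. *)
Definition hole (a : K) : 'I_n.+1 := odflt ord0 [pick i | `[< ~ B i (Some a) >]].
Definition hole_pt (k : 'I_n.+1) : K := xget 0 [set e | ~ B k (Some e)].
Definition hole_count (S : {poly K}) (k : 'I_n.+1) := count (fun a => hole a == k) (rts S).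

Lemma holeP a : ~ X (Some a) -> ~ B (hole a) (Some a).
Proof.
case: rX => _ ->; rewrite /hole; case: pickP => [i /asboolP //|none] nX _.
by apply: nX => i _; apply: contrapT => /asboolP; rewrite none.
Qed.
Lemma hole_ptP a : ~ X (Some a) -> ~ B (hole a) (Some (hole_pt (hole a))).
Proof. by move=> /holeP h; apply: (@xgetPex _ 0 [set e | ~ B (hole a) (Some e)]); exists a. Qed.

(** By [ball_cross], replacing a root a by the chosen point of its hole multiplies (z1 - a) / (z2 -
    a) by a 1-unit. So up to a 1-unit the ratio only depends on the numbers of roots in the
    holes. *)
Lemma hole_ratio (S : {poly K}) z1 z2 : X (Some z1) -> X (Some z2) ->
  (forall a, root S a -> ~ X (Some a)) -> S != 0 ->
  exists2 u, v (u - 1) < 1 & S.[z1] / S.[z2] =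
    u * \prod_k ((z1 - hole_pt k) / (z2 - hole_pt k)) ^+ hole_count S k.
Proof.
move=> X1 X2 rS S0; rewrite !horner_rts /hole_count.
have rS' a : a \in rts S -> ~ X (Some a) by rewrite mem_rts //; apply: rS.
have l0 : lead_coef S != 0 by rewrite lead_coef_eq0.
rewrite -mulf_div divff // mul1r.
have XB i z : X z -> B i z by case: rX => _ -> ; apply.
elim: (rts S) rS' => [|a s IH] rs.
  exists 1; first by rewrite subrr v0.
  by rewrite !big_nil divr1 mul1r big1 // => k _; rewrite /= expr0.
have [|u u1 uE] := IH; first by move=> b bs; apply: rs; rewrite inE bs orbT.
have na : ~ X (Some a) by apply: rs; rewrite mem_head.
have hB := proj1 rX (hole a).
set e := hole_pt (hole a).
have cr := ball_cross hB (XB _ _ X1) (XB _ _ X2) (holeP na) (hole_ptP na).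
have : 0 < v ((z2 - a) * (z1 - e)) by apply: le_lt_trans cr; apply: v_ge0.
rewrite v_gt0 mulf_eq0 negb_or => /andP[za ze].
have ze2 : z2 - e != 0.
  rewrite subr_eq0; apply/eqP => E; apply: (hole_ptP na); rewrite -/e -E; exact: XB.
exists ((z1 - a) * (z2 - e) / ((z2 - a) * (z1 - e)) * u).
  apply: unit1M => //.
  have -> : (z1 - a) * (z2 - e) / ((z2 - a) * (z1 - e)) - 1 =
     ((z1 - z2) * (a - e)) / ((z2 - a) * (z1 - e)).
    by rewrite -cross_identity; field; rewrite za ze.
  by rewrite vM vV ltr_pdivrMr ?v_gt0 ?mulf_neq0 // mul1r.
rewrite !big_cons -[LHS]mulf_div uE mulrA.
under [in RHS]eq_bigr => k _ do rewrite /= exprD.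
rewrite big_split /= [X in _ = _ * (X * _)](bigD1 (hole a)) //= eqxx expr1.
rewrite [X in _ = _ * (_ * X * _)]big1 ?mulr1; last first.
  by move=> k; rewrite eq_sym => /negbTE ->.
rewrite -/e; set pr_ := \prod_(_ < _) _.
by field; rewrite ze ze2 za.
Qed.

Variables (d : nat) (P Q : {poly K}) (F : P1 -> P1).
Hypothesis rF : rat_rep d P Q F.

Let S a : {poly K} := P - a *: Q.
Let SE a z w : F (Some z) = Some w -> (S a).[z] = (w - a) * Q.[z].
Proof.
by rewrite (ratE rF); case: eqVneq => // q0 [<-]; rewrite !hornerE mulrBl divfK.
Qed.
Let Q0 z w : F (Some z) = Some w -> Q.[z] != 0.
Proof. by rewrite (ratE rF); case: eqVneq. Qed.

(** Otherwise arbitrarily many values of the disc, at distance at least |c| from each other and from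
    w1, w2, are omitted on X. Two of them, a and b, have equal root counts in the holes, so by
    [hole_ratio] the cross ratio of w1, w2, a, b is a 1-unit, that is |(w1 - w2)(a - b)| < |(w2 -
    a)(w1 - b)|. But |w2 - a| <= |w1 - w2| and |w1 - b| <= |a - b|. *)
Lemma separated_values_cofinite z1 z2 w1 w2 e c : c != 0 -> X (Some z1) -> X (Some z2) ->
  F (Some z1) = Some w1 -> F (Some z2) = Some w2 ->
  v (w1 - e) <= v c -> v c <= v (w1 - w2) ->
  exists l : seq K, forall a, v (a - e) <= v c -> (forall b, b \in l -> v c <= v (a - b)) ->
    exists2 z, X z & F z = Some a.
Proof.
move=> c0 X1 X2 F1 F2 w1e w12; apply: contrapT => nol.
have next (l : seq K) : exists a, [/\ v (a - e) <= v c, forall b, b \in l -> v c <= v (a - b)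
    & forall z, X z -> F z <> Some a].
  apply: contrapT => H; apply: nol; exists l => a ae al; apply: contrapT => nz_.
  by apply: H; exists a; split=> // z Xz Fz; apply: nz_; exists z.
have build N : exists s : seq K, [/\ size s = N, uniq s,
    forall a b, a \in s -> b \in s -> a != b -> v c <= v (a - b)
    & forall a, a \in s -> [/\ v (a - e) <= v c, v c <= v (a - w1), v c <= v (a - w2) &
       forall z, X z -> F z <> Some a]].
  elim: N => [|N [s [sN us sep sP]]]; first by exists [::].
  have [a [ae al aF]] := next [:: w1, w2 & s]; exists (a :: s).
  have as_ b : b \in s -> v c <= v (a - b) by move=> bs; apply: al; rewrite !inE bs !orbT.
  split.
  - by rewrite /= sN.
  - rewrite /= us andbT; apply/negP => /as_; rewrite subrr v0 leNgt v_gt0 c0 //.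
  - move=> x y; rewrite !inE => /orP[/eqP->|xs] /orP[/eqP->|ys] xy.
    + by rewrite eqxx in xy.
    + exact: as_.
    + by rewrite vB_sym; apply: as_.
    + exact: sep.
  move=> x; rewrite inE => /orP[/eqP->|xs]; last exact: sP.
  by split=> //; apply: al; rewrite !inE eqxx ?orbT.
(* The vector of root counts, each at most d; one more omitted value than there are such vectors
   forces a coincidence. *)
pose g a : {ffun 'I_n.+1 -> 'I_d.+1} := [ffun k => inord (hole_count (S a) k)].
have [s [sN us sep sP]] := build (#|{ffun 'I_n.+1 -> 'I_d.+1}|).+1.
have [a [b [as_ bs ab gab]]] : exists a b, [/\ a \in s, b \in s, a != b & g a = g b].
  apply: contrapT => H.
  have : uniq [seq g a | a <- s].
    rewrite map_inj_in_uniq // => a b as_ bs gab; apply/eqP; apply/negPn/negP => ab.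
    by apply: H; exists a, b.
  by move=> /card_uniqP E; have := max_card (mem [seq g a | a <- s]); rewrite E size_map sN ltnn.
have S0 x : x \in s -> S x != 0.
  move=> /sP [_ xw _ _]; apply/negP => /eqP Sx; move: (SE x F1); rewrite Sx horner0.
  move/esym/eqP; rewrite mulf_eq0 (negbTE (Q0 F1)) orbF subr_eq0 => /eqP E.
  by move: xw; rewrite E subrr v0 leNgt v_gt0 c0.
have rS x : x \in s -> forall y, root (S x) y -> ~ X (Some y).
  by move=> /sP [_ _ _ xF] y /(rat_fiber rF) Fy Xy; apply: (xF _ Xy).
have cnt x k : x \in s -> (hole_count (S x) k < d.+1)%N.
  move=> xs; rewrite ltnS (leq_trans (count_size _ _)) //.
  have : (size (S x) <= d.+1)%N.
    case: rF => sP' sQ' _ _; apply: leq_trans (size_polyD _ _) _.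
    by rewrite geq_max sP' size_polyN (leq_trans (size_scale_leq _ _)).
  rewrite {1}[S x]rtsE size_scale ?lead_coef_eq0 ?S0 // size_prod_XsubC //.
have cE k : hole_count (S a) k = hole_count (S b) k.
  have := congr1 (fun f : {ffun 'I_n.+1 -> 'I_d.+1} => val (f k)) gab.
  by rewrite /g !ffunE /= !inordK ?cnt.
have [u u1 uE] := hole_ratio X1 X2 (rS a as_) (S0 a as_).
have [u' u1' uE'] := hole_ratio X1 X2 (rS b bs) (S0 b bs).
move: uE uE'; under eq_bigr => k _ do rewrite cE.
set M := \prod_k _; rewrite !(SE _ F1) !(SE _ F2) => uE uE'.
have q1 := Q0 F1; have q2 := Q0 F2.
have [ae aw1 aw2 _] := sP a as_; have [be bw1 bw2 _] := sP b bs.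
have ne x y : v c <= v (x - y) -> y - x != 0.
  by move=> h; rewrite -v_gt0 vB_sym (lt_le_trans _ h) // v_gt0.
have n1 := ne _ _ aw1; have n2 := ne _ _ aw2; have n3 := ne _ _ bw1; have n4 := ne _ _ bw2.
have M0 : M != 0.
  apply/negP => /eqP M0; move: uE; rewrite M0 mulr0 => /eqP.
  by rewrite mulf_eq0 invr_eq0 !mulf_eq0 (negbTE q1) (negbTE q2) (negbTE n1) (negbTE n2).
have u'0 : u' != 0 by rewrite -v_gt0 unit1_v.
have E : (w1 - a) * (w2 - b) / ((w2 - a) * (w1 - b)) = u / u'.
  have -> : u / u' = (u * M) / (u' * M) by field; rewrite u'0 M0.
  by rewrite -uE -uE'; field; rewrite q1 q2 n2 n3 n4.
have : v ((w1 - w2) * (a - b)) < v ((w2 - a) * (w1 - b)).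
  have -> : (w1 - w2) * (a - b) = (u / u' - 1) * ((w2 - a) * (w1 - b)).
    by rewrite -E -cross_identity; field; rewrite n2 n3.
  rewrite [X in X < _]vM gtr_pMl; first by apply: unit1M => //; apply: unit1V.
  by rewrite v_gt0 mulf_neq0.
rewrite !vM ltNge => /negP; apply; apply: ler_pM; rewrite ?v_ge0 //.
  by rewrite (@vtri_le w1) // ?(vB_sym w2) // (le_trans _ w12) // (@vtri_le e) // vB_sym.
by rewrite (le_trans _ (sep _ _ as_ bs ab)) // (@vtri_le e) // vB_sym.
Qed.
End Holes.

Lemma linear_dependence m (M : 'M[R]_(m.+1, m)) :
  exists2 k : 'rV[R]_m.+1, k != 0 & k *m M = 0.
Proof.
have : kermx M != 0.
  by rewrite kermx_eq0 /row_free neq_ltn ltnS rank_leq_col.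
by case/rowV0Pn => k /sub_kermxP kM k0; exists k.
Qed.
Lemma ln_prod (I : Type) (s : seq I) (f : I -> R) : (forall i, 0 < f i) ->
  ln (\prod_(i <- s) f i) = \sum_(i <- s) ln (f i).
Proof.
move=> f0; elim: s => [|i s IH]; first by rewrite !big_nil ln1.
by rewrite !big_cons lnM ?posrE ?f0 ?prodr_gt0 // IH.
Qed.

Section Gap.
Variables (n : nat) (B : 'I_n.+1 -> set P1) (X : set P1).
Hypothesis rX : affinoid_rep B X.
Variables (x : K) (a : 'I_n.+3 -> K) (d0 M0 : R).
Hypotheses (Xx : X (Some x)) (a_inj : injective a) (d00 : 0 < d0).

(** Bounds the logarithms of all the data that do not depend on the map, so that the resulting gap
    is uniform in it. *)
Let L : R := `|ln d0| + `|ln M0| + \sum_i \sum_l `|ln (v (a i - a l))|.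
Let L0 : 0 <= L.
Proof. by rewrite !addr_ge0 ?normr_ge0 // sumr_ge0 // => i _; rewrite sumr_ge0. Qed.
Let La i l : `|ln (v (a i - a l))| <= L.
Proof.
apply: (@le_trans _ _ (\sum_i \sum_l `|ln (v (a i - a l))|)); last first.
  by rewrite lerDr addr_ge0.
rewrite (bigD1 i) //= (bigD1 l) //= -addrA lerDl addr_ge0 ?sumr_ge0 // => j _.
by rewrite sumr_ge0.
Qed.
Let Lw t : d0 <= t <= M0 -> `|ln t| <= L.
Proof.
move=> /andP[dt tM]; have t0 := lt_le_trans d00 dt; have M00 := lt_le_trans t0 tM.
apply: (@le_trans _ _ (`|ln d0| + `|ln M0|)); last first.
  by rewrite lerDl sumr_ge0 // => i _; rewrite sumr_ge0.
rewrite ler_norml; apply/andP; split.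
  rewrite opprD ler_wnDr ?oppr_le0 ?normr_ge0 //.
  by apply: (@le_trans _ _ (ln d0)); [rewrite lerNl ler_normr lexx orbT|rewrite ler_ln ?posrE].
apply: ler_wpDl; rewrite ?normr_ge0 //.
by apply: (@le_trans _ _ (ln M0)); [rewrite ler_ln ?posrE|rewrite ler_norm].
Qed.

(* The root counts of f - a_i in the holes of X are linearly dependent, so some
   monomial in the |f - a_i| is constant on X; f can therefore not come close
   to the a_i whose exponent is the largest. *)
Lemma omitted_value_gap : exists2 c, 0 < c & forall d P Q F w, rat_rep d P Q F ->
  (forall z i, X z -> F z <> Some (a i)) -> F (Some x) = Some w ->
  (forall i, d0 <= v (w - a i) <= M0) ->
  exists i, forall z w', X (Some z) -> F (Some z) = Some w' -> c <= v (w' - a i).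
Proof.
(* The values |w - a_i| and the distances |a_i0 - a_i|, at most n + 3 of each, contribute at most L
   with weights |k_i / k_i0| <= 1. *)
pose T : R := n.+3%:R * L + n.+3%:R * L.
have LT : L <= T.
  by rewrite /T -mulrDl ler_peMl // -natrD ler1n.
exists (expR (- T)); first exact: expR_gt0.
move=> d P Q F w rF Fa Fx wa.
pose S i : {poly K} := P - a i *: Q.
have SE i z t : F (Some z) = Some t -> (S i).[z] = (t - a i) * Q.[z].
  by rewrite (ratE rF); case: eqVneq => // q0 [<-]; rewrite !hornerE mulrBl divfK.
have Q0 z t : F (Some z) = Some t -> Q.[z] != 0 by rewrite (ratE rF); case: eqVneq.
have ne i z t : X (Some z) -> F (Some z) = Some t -> t - a i != 0.
  by move=> Xz Fz; apply/negP; rewrite subr_eq0 => /eqP E; apply: (Fa _ i Xz); rewrite Fz E.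
have S0 i : S i != 0.
  apply/negP => /eqP S0; have := SE i x w Fx; rewrite S0 horner0 => /esym/eqP.
  by rewrite mulf_eq0 (negbTE (ne i _ _ Xx Fx)) (negbTE (Q0 _ _ Fx)).
have rS i y : root (S i) y -> ~ X (Some y) by move/(rat_fiber rF) => Fy Xy; apply: (Fa _ i Xy).
pose cnt i k := hole_count B (S i) k.
(* One column of ones and n + 1 columns of root counts, hence a dependence between n + 3 rows. The
   column of ones makes the k_i sum to 0, which eliminates the denominator Q. *)
pose M : 'M[R]_(n.+3, n.+2) := \matrix_(i, j) oapp (fun k => (cnt i k)%:R) 1 (unlift ord0 j).
have [kv kv0 kvM] := linear_dependence M; pose k i := kv 0 i.
have k1 : \sum_i k i = 0.
  have := congr1 (fun A : 'rV[R]_n.+2 => A 0 ord0) kvM; rewrite !mxE => E; rewrite -[RHS]E.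
  by apply: eq_bigr => i _; rewrite !mxE unlift_none mulr1.
have kc l : \sum_i k i * (cnt i l)%:R = 0.
  have := congr1 (fun A : 'rV[R]_n.+2 => A 0 (lift ord0 l)) kvM; rewrite !mxE => E; rewrite -[RHS]E.
  by apply: eq_bigr => i _; rewrite !mxE liftK.
pose i0 := [arg max_(i > ord0) `|k i|]%O.
have i0P i : `|k i| <= `|k i0| by rewrite /i0; case: arg_maxP => // j _ /(_ i isT).
have ki0 : 0 < `|k i0|.
  rewrite normr_gt0; apply: contraNneq kv0 => E; apply/eqP/rowP => i; rewrite mxE.
  by apply/eqP; rewrite -normr_le0 (le_trans (i0P i)) // E normr0.
exists i0 => z t Xz Fz; set s := v (t - a i0).
have s0 : 0 < s by rewrite v_gt0 (ne _ z).
have aa i : i != i0 -> 0 < v (a i0 - a i).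
  by move=> ii; rewrite v_gt0 subr_eq0; apply: contraNneq ii => /a_inj ->.
case: (pselect (exists2 i, i != i0 & v (a i0 - a i) <= s)) => [[i ii si]|far].
  apply: le_trans si; rewrite -[leRHS]lnK ?posrE ?aa // ler_expR lerNl.
  by rewrite (le_trans _ LT) // (le_trans _ (La i0 i)) // -normrN ler_norm.
(* In the remaining case t is closer to a_i0 than every other a_i is, so |t - a_i0| is the only
   unknown in the relation [rel]. *)
have tE i : i != i0 -> v (t - a i) = v (a i0 - a i).
  by move=> ii; apply: vtri_eq; rewrite ltNge; apply/negP => h; apply: far; exists i.
pose E l := v ((z - hole_pt B l) / (x - hole_pt B l)).
have lnE i : ln (v (t - a i)) - ln (v (w - a i)) + (ln (v Q.[z]) - ln (v Q.[x])) =
    \sum_l (cnt i l)%:R * ln (E l).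
  have [u u1 uE] := hole_ratio rX Xz Xx (rS i) (S0 i).
  have vE : v ((S i).[z] / (S i).[x]) =
      \prod_l v (((z - hole_pt B l) / (x - hole_pt B l)) ^+ cnt i l).
    by rewrite uE vM (unit1_v u1) mul1r v_prod.
  have vpos : 0 < v ((S i).[z] / (S i).[x]).
    rewrite v_gt0 (SE _ _ _ Fz) (SE _ _ _ Fx) mulf_neq0 ?invr_eq0 ?mulf_neq0 //;
    by [apply: ne Xz Fz|apply: Q0 Fz|apply: ne Xx Fx|apply: Q0 Fx].
  have fpos l : 0 < v (((z - hole_pt B l) / (x - hole_pt B l)) ^+ cnt i l).
    rewrite lt_neqAle v_ge0 andbT eq_sym; apply/negP => /eqP f0.
    move: vpos; rewrite vE (bigD1 l) //= -/(cnt i l) f0 mul0r ltxx //.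
  transitivity (ln (v ((S i).[z] / (S i).[x]))).
    rewrite (SE _ _ _ Fz) (SE _ _ _ Fx) vM vV !vM.
    have p1 := ne i _ _ Xz Fz; have p2 := ne i _ _ Xx Fx; have p3 := Q0 _ _ Fz; have p4 := Q0 _ _ Fx.
    rewrite -!v_gt0 in p1 p2 p3 p4.
    rewrite ln_div ?posrE ?mulr_gt0 // !lnM ?posrE //; ring.
  rewrite vE ln_prod //; apply: eq_bigr => l _; rewrite -/(cnt i l).
  have := fpos l; case: (cnt i l) => [|m]; first by rewrite expr0 v1 ln1 mul0r.
  rewrite vX -/(E l) => h; have El : 0 < E l.
    rewrite lt_neqAle v_ge0 andbT eq_sym; apply: contraTneq h => ->.
    by rewrite expr0n ltxx.
  by rewrite lnXn ?mulr_natl.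
have rel : \sum_i k i * ln (v (t - a i)) = \sum_i k i * ln (v (w - a i)).
  apply/eqP; rewrite -subr_eq0 -sumrB.
  under eq_bigr => i _ do rewrite -mulrBr.
  have sum0 : \sum_i k i * (\sum_l (cnt i l)%:R * ln (E l)) = 0.
    under eq_bigr => i _ do rewrite mulr_sumr.
    rewrite exchange_big big1 // => l _ /=.
    by under eq_bigr => i _ do rewrite mulrA; rewrite -mulr_suml kc mul0r.
  apply/eqP; rewrite -[RHS]sum0.
  under [RHS]eq_bigr => i _ do rewrite -lnE mulrDr.
  by rewrite big_split /= -mulr_suml k1 mul0r addr0.
have bnd : `|k i0 * ln s| <= `|k i0| * T.
  have -> : k i0 * ln s = \sum_i k i * ln (v (w - a i)) -
      \sum_(i | i != i0) k i * ln (v (a i0 - a i)).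
    by rewrite -rel (bigD1 i0) //= (eq_bigr _ (fun i ii => congr1 (fun y => k i * ln y) (tE i ii))) addrK.
  have bd (f : 'I_n.+3 -> R) (Pr : pred 'I_n.+3) : (forall i, `|f i| <= L) ->
      `|\sum_(i | Pr i) k i * f i| <= `|k i0| * (n.+3%:R * L).
    move=> fL; apply: le_trans (ler_norm_sum _ _ _) _.
    rewrite big_mkcond; apply: (@le_trans _ _ (\sum_(i < n.+3) `|k i0| * L)).
      apply: ler_sum => i _; case: ifP => _; last by rewrite mulr_ge0.
      by rewrite normrM ler_pM.
    by rewrite sumr_const card_ord -[leLHS]mulr_natl mulrCA.
  rewrite (le_trans (ler_normB _ _)) // mulrDr lerD //.
    by apply: (bd _ predT) => i; apply: Lw.
  by apply: bd => i; apply: La.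
move: bnd; rewrite normrM ler_pM2l // ler_norml => /andP[h _].
by rewrite -[leRHS]lnK ?posrE // ler_expR.
Qed.
End Gap.

(** * The two-constants inequality *)

Lemma prodr_le_mem (s : seq K) (f g : K -> R) :
  (forall i, i \in s -> 0 <= f i <= g i) -> \prod_(i <- s) f i <= \prod_(i <- s) g i.
Proof.
elim: s => [|i s IH] h; first by rewrite !big_nil.
have /andP[f0 fg] := h i (mem_head _ _).
have h' j : j \in s -> 0 <= f j <= g j by move=> js; apply: h; rewrite inE js orbT.
rewrite !big_cons ler_pM ?IH // big_seq prodr_ge0 // => j /h' /andP[] //.
Qed.
Lemma prod_const_seq (s : seq K) (f : K -> R) c :
  (forall i, i \in s -> f i = c) -> \prod_(i <- s) f i = c ^+ size s.
Proof.
elim: s => [|i s IH] h; first by rewrite big_nil.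
by rewrite big_cons h ?mem_head // IH ?exprS // => j js; apply: h; rewrite inE js orbT.
Qed.

Section MeanInequality.
Variables (x : K) (cs : seq K) (r L : R).
Hypotheses (r0 : 0 < r) (L1 : 1 < L) (ucs : uniq cs) (xcs : x \in cs).
Hypothesis dcs : forall e e', e \in cs -> e' \in cs -> e != e' -> v (e - e') = r.
Let L0 : 0 < L. Proof. exact: lt_trans L1. Qed.
Let rL : r < r * L. Proof. by rewrite ltr_pMr. Qed.
Let rL' : r / L < r. Proof. by rewrite ltr_pdivrMr // ltr_pMr. Qed.
Let ex e : e \in cs -> v (e - x) <= r.
Proof.
move=> ecs; have [->|ne] := eqVneq e x; first by rewrite subrr v0 ltW.
by rewrite dcs.
Qed.

(** The case of one linear factor. In the tree of discs the node (x, r) has one branch upwards and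
    one towards each point of cs; the logarithm of the norm of X - a is convex along them, and its
    outgoing slopes have nonnegative sum. Equality holds if a lies beyond one of the neighbours (x,
    r L), (e, r / L). *)
Let factor a : Num.max r (v (x - a)) ^+ (size cs).+1 <=
    Num.max (r * L) (v (x - a)) * \prod_(e <- cs) Num.max (r / L) (v (e - a))
  /\ (r * L <= v (x - a) \/ (exists2 e, e \in cs & v (e - a) <= r / L) ->
      Num.max r (v (x - a)) ^+ (size cs).+1 =
      Num.max (r * L) (v (x - a)) * \prod_(e <- cs) Num.max (r / L) (v (e - a))).
Proof.
have [far|near] := ltP r (v (x - a)).
  have E e : e \in cs -> Num.max (r / L) (v (e - a)) = v (x - a).
    move=> ecs; rewrite (@vtri_eq x) ?max_r //; first exact: ltW (lt_trans rL' far).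
    exact: le_lt_trans (ex ecs) far.
  rewrite (prod_const_seq E) exprS; split.
    by rewrite ler_wpM2r ?exprn_ge0 ?v_ge0 // le_max lexx orbT.
  case=> [h|[e ecs h]]; first by rewrite max_r.
  have := E e ecs; rewrite max_l // => E'; move: far; rewrite -E' => /(lt_trans rL').
  by rewrite ltxx.
have m1 : Num.max (r * L) (v (x - a)) = r * L by rewrite max_l // (le_trans near) // ltW.
have ea e : e \in cs -> v (e - a) <= r by move=> /ex h; apply: (@vtri_le x).
rewrite m1; case: (pselect (exists2 e, e \in cs & v (e - a) < r)) => [[e ecs er]|none].
  have E e' : e' \in rem e cs -> Num.max (r / L) (v (e' - a)) = r.
    move=> h; have := h; rewrite (mem_rem_uniq _ ucs) !inE => /andP[ne e'cs].
    have E : v (e' - a) = r.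
      have E' : v (e - e') = r by rewrite dcs // eq_sym.
      by rewrite vB_sym (@vtri_eq e) E' // vB_sym.
    by rewrite E max_r // ltW.
  rewrite (big_rem e ecs) /= (prod_const_seq E) size_rem //.
  have s0 : (0 < size cs)%N by case: (cs) ecs.
  have -> : r ^+ (size cs).+1 = r * r * r ^+ (size cs).-1.
    by rewrite -{1}(prednK s0) !exprS mulrA.
  have EL : r * L * (r / L) = r * r by field; rewrite gt_eqF.
  split.
    rewrite mulrA ler_wpM2r ?exprn_ge0 ?(ltW r0) // -EL ler_wpM2l ?le_max ?lexx //.
    by rewrite mulr_ge0 ?(ltW r0) ?(ltW L0).
  case=> [h|[e' e'cs h]]; first by have := le_trans h near; rewrite leNgt rL.
  suff -> : Num.max (r / L) (v (e - a)) = r / L by rewrite mulrA EL.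
  have -> : e = e' => [|]; last by rewrite max_l.
  apply: contrapT => /eqP ne; have := dcs ecs e'cs ne => E'.
  have : v (e - e') < r.
    by apply: (@vtri_lt a) => //; rewrite vB_sym (le_lt_trans h).
  by rewrite E' ltxx.
have E e : e \in cs -> Num.max (r / L) (v (e - a)) = r.
  move=> ecs; have -> : v (e - a) = r; last by rewrite max_r // ltW.
  by apply/eqP; rewrite eq_le ea //= leNgt; apply/negP => h; apply: none; exists e.
rewrite (prod_const_seq E) exprS; split.
  by rewrite ler_wpM2r ?exprn_ge0 // ltW.
case=> [h|[e ecs h]]; first by have := le_trans h near; rewrite leNgt rL.
by case: none; exists e => //; apply: le_lt_trans h rL'.
Qed.

Let nrm_prod (S : {poly K}) : nrm S x (r * L) * \prod_(e <- cs) nrm S e (r / L) =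
  v (lead_coef S) ^+ (size cs).+1 * \prod_(a <- rts S)
   (Num.max (r * L) (v (x - a)) * \prod_(e <- cs) Num.max (r / L) (v (e - a))).
Proof.
rewrite big_split /= exchange_big /= /nrm big_split /= exprS.
rewrite (@prod_const_seq cs (fun=> v (lead_coef S)) (v (lead_coef S))) //.
by rewrite mulrACA.
Qed.
Let nrm_exp (S : {poly K}) : nrm S x r ^+ (size cs).+1 =
  v (lead_coef S) ^+ (size cs).+1 * \prod_(a <- rts S) Num.max r (v (x - a)) ^+ (size cs).+1.
Proof. by rewrite /nrm exprMn prodrXl. Qed.

(** The product of [factor] over the roots: subharmonicity of log |S| on the tree of discs, in a
    discrete form. *)
Lemma mean_inequality S : nrm S x r ^+ (size cs).+1 <=
  nrm S x (r * L) * \prod_(e <- cs) nrm S e (r / L).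
Proof.
rewrite nrm_prod nrm_exp ler_wpM2l ?exprn_ge0 ?v_ge0 //.
apply: prodr_le_mem => a _; rewrite (proj1 (factor a)) exprn_ge0 //.
by rewrite le_max v_ge0 orbT.
Qed.
Lemma mean_equality S : (forall a, root S a ->
    r * L <= v (x - a) \/ exists2 e, e \in cs & v (e - a) <= r / L) -> S != 0 ->
  nrm S x r ^+ (size cs).+1 = nrm S x (r * L) * \prod_(e <- cs) nrm S e (r / L).
Proof.
move=> h S0; rewrite nrm_prod nrm_exp; congr (_ * _); apply: eq_big_seq => a as_.
by apply: (proj2 (factor a)); apply: h; rewrite -mem_rts.
Qed.
End MeanInequality.

(** Serves to enlarge a radius so slightly that growth of degree k stays within a margin y. *)
Lemma root_gt1 (y : R) k : 1 < y -> exists2 i, 1 < i & i ^+ k <= y.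
Proof.
move=> y1; have y0 := lt_trans ltr01 y1; set i := y `^ (k.+1%:R^-1).
have i0 : 0 <= i by apply: powR_ge0.
have iE : i ^+ k.+1 = y.
  by rewrite -powR_mulrn // -powRrM mulVf ?pnatr_eq0 // powRr1 // ltW.
have i1 : 1 < i.
  rewrite ltNge; apply/negP => i1; have : i ^+ k.+1 <= 1 by rewrite exprn_ile1.
  by rewrite iE leNgt y1.
by exists i => //; rewrite -iE exprS ler_peMl ?exprn_ge0 // ltW.
Qed.
Lemma nrm_growth (S : {poly K}) e t t' : 0 < t -> t <= t' ->
  nrm S e t' <= (t' / t) ^+ size (rts S) * nrm S e t.
Proof.
move=> t0 tt; have q1 : 1 <= t' / t by rewrite ler_pdivlMr // mul1r.
rewrite /nrm mulrCA ler_wpM2l ?v_ge0 //.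
elim: (rts S) => [|a s IH]; first by rewrite !big_nil mulr1.
rewrite !big_cons /=.
have step : Num.max t' (v (e - a)) <= t' / t * Num.max t (v (e - a)).
  rewrite maxr_pMr ?(le_trans ler01) // divfK ?gt_eqF // ge_max !le_max lexx /=.
  by rewrite ler_peMl ?v_ge0 // orbT.
set A := \prod_(_ <- _) _ in IH *; set A' := \prod_(_ <- _) _ in IH *.
have -> : (t' / t) ^+ (size s).+1 * (Num.max t (v (e - a)) * A') =
  (t' / t * Num.max t (v (e - a))) * ((t' / t) ^+ size s * A') by rewrite exprS; ring.
apply: ler_pM => //; first by rewrite le_max v_ge0 orbT.
by rewrite prodr_ge0 // => b _; rewrite le_max v_ge0 orbT.
Qed.

Section TwoConstants.
Variables (n : nat) (B : 'I_n.+1 -> set P1) (X : set P1).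
Hypothesis rX : affinoid_rep B X.
Variable C : R.
Hypothesis C0 : 0 < C.

(* The pair (U, W) stands for the function U / W. *)
Definition admissible (U W : {poly K}) := [/\ W != 0, forall a, root W a -> ~ X (Some a) &
  forall z, X (Some z) -> v U.[z] <= C * v W.[z]].

(** For a radius in the value group a generic point of the sphere lies in X. A real radius t is
    approximated by |c| slightly above t: the norm of U increases with the radius, and that of W
    grows by less than the margin. *)
Lemma admissible_bound U W e (t0 t t1 : R) : admissible U W -> 0 < t0 -> t0 < t -> t < t1 ->
  (forall z, t0 < v (z - e) -> v (z - e) < t1 -> X (Some z)) ->
  nrm U e t <= C * nrm W e t.
Proof.
move=> [W0 _ UW] t00 tt tt1 zX; have tpos := lt_trans t00 tt.
have val c : t0 < v c -> v c < t1 -> nrm U e (v c) <= C * nrm W e (v c).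
  move=> c0 c1; have cn0 : c != 0 by rewrite -v_gt0 (lt_trans t00).
  have [z ze zl] := generic_point e (e :: rts U ++ rts W) cn0.
  have E : v (z - e) = v c by apply/eqP; rewrite eq_le ze zl ?mem_head.
  rewrite -(@v_generic U e _ z) // -1?(@v_generic W e _ z) //.
  - by apply: UW; apply: zX; rewrite E.
  - by move=> a aW; apply: zl; rewrite inE mem_cat aW !orbT.
  - by move=> a aU; apply: zl; rewrite inE mem_cat aU orbT.
have nW : 0 < nrm W e t by rewrite nrm_gt0.
rewrite leNgt; apply/negP => lt.
have CW : 0 < C * nrm W e t by rewrite mulr_gt0.
have y1 : 1 < (nrm U e t / (C * nrm W e t) + 1) / 2.
  by rewrite ltr_pdivlMr // mul1r ltrD2r ltr_pdivlMr // mul1r.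
have y2 : (nrm U e t / (C * nrm W e t) + 1) / 2 < nrm U e t / (C * nrm W e t).
  by rewrite ltr_pdivrMr // mulrDr mulr1 ltrD2l ltr_pdivlMr // mul1r.
have [i i1 ik] := root_gt1 (size (rts W)) y1.
have [|c c0 /andP[tc ct]] := @value_dense t (Num.min t1 (t * i)) tpos.
  by rewrite lt_min tt1 ltr_pMr.
move: ct; rewrite lt_min => /andP[ct1 cti].
have := val c (lt_trans tt tc) ct1; apply/negP; rewrite -ltNge.
apply: (@lt_le_trans _ _ (nrm U e t)); last by rewrite nrm_mono // ltW.
apply: le_lt_trans (_ : i ^+ size (rts W) * (C * nrm W e t) < _).
  rewrite [leRHS]mulrCA ler_wpM2l ?(ltW C0) // (le_trans (nrm_growth _ _ tpos (ltW tc))) //.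
  rewrite ler_wpM2r ?nrm_ge0 // lerXn2r ?nnegrE ?(ltW (lt_trans ltr01 i1)) //.
    by rewrite divr_ge0 ?v_ge0 // ltW.
  by rewrite ler_pdivrMr // mulrC ltW.
by rewrite -ltr_pdivlMr // (le_lt_trans ik).
Qed.

Variables (x y : K).
Hypotheses (Xx : X (Some x)) (Xy : X (Some y)) (xy : x != y).
Let rho := v (x - y).
Let rho0 : 0 < rho. Proof. by rewrite v_gt0 subr_eq0. Qed.

(* Near the radius r0 the holes of X seen from x lie in finitely many
   directions, represented by the points of es. *)
Lemma local_holes r0 : 0 < r0 -> r0 <= rho -> exists L0 es, [/\ 1 < L0,
  uniq es, forall e, e \in es -> v (e - x) = r0,
  forall e e', e \in es -> e' \in es -> e != e' -> v (e - e') = r0 &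
  forall a, ~ X (Some a) -> [\/ v (a - x) * L0 <= r0, r0 * L0 <= v (a - x) |
     exists2 e, e \in es & v (a - e) * L0 <= r0]].
Proof.
move=> r00 r0rho.
suff H (s : seq 'I_n.+1) : exists L0 es, [/\ 1 < L0,
  uniq es, forall e, e \in es -> v (e - x) = r0,
  forall e e', e \in es -> e' \in es -> e != e' -> v (e - e') = r0 &
  forall a, (exists2 i, i \in s & ~ B i (Some a)) ->
   [\/ v (a - x) * L0 <= r0, r0 * L0 <= v (a - x) |
     exists2 e, e \in es & v (a - e) * L0 <= r0]].
  have [L0 [es [h1 h2 h3 h4 h5]]] := H (enum 'I_n.+1); exists L0, es; split=> // a na.
  by apply: h5; exists (hole B a); [rewrite mem_enum|apply: (holeP rX)].
elim: s => [|i s [L0 [es [L01 ues ex ee H]]]].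
  by exists 2, [::]; split=> //; [rewrite ltr1n|move=> a []].
have shrink L' a : 1 < L' -> L' <= L0 ->
   [\/ v (a - x) * L0 <= r0, r0 * L0 <= v (a - x) | exists2 e, e \in es & v (a - e) * L0 <= r0] ->
   [\/ v (a - x) * L' <= r0, r0 * L' <= v (a - x) | exists2 e, e \in es & v (a - e) * L' <= r0].
  move=> L1' LL; case=> [h|h|[e he h]].
  - by apply: Or31; apply: le_trans h; rewrite ler_wpM2l ?v_ge0.
  - by apply: Or32; apply: le_trans h; rewrite ler_wpM2l // ltW.
  - by apply: Or33; exists e => //; apply: le_trans h; rewrite ler_wpM2l ?v_ge0.
have split_ a : (exists2 j, j \in i :: s & ~ B j (Some a)) ->
    ~ B i (Some a) \/ exists2 j, j \in s & ~ B j (Some a).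
  by case=> j; rewrite inE => /orP[/eqP->|js] h; [left|right; exists j].
have XB z : X z -> B i z by case: rX => _ ->; apply.
have [c [t [[u u0 tE] HB]]] := proj1 rX i; have t0 : 0 < t by rewrite tE v_gt0.
have Bx := XB _ Xx; have By := XB _ Xy.
case: HB => HB.
  move: Bx By; rewrite HB => -[x' xt [x'E]] [y' yt [y'E]]; subst x' y'; rewrite /= in xt yt.
  (* A disc containing x and y has radius above rho >= r0, so its complement is far from x. *)
  have rt : r0 < t by apply: le_lt_trans r0rho _; apply: (@vtri_lt c) => //; rewrite vB_sym.
  have q1 : 1 < t / r0 by rewrite ltr_pdivlMr // mul1r.
  exists (Num.min L0 (t / r0)), es; split=> //; first by rewrite lt_min L01.
  move=> a /split_[na|/H]; last by apply: shrink; rewrite ?lt_min ?L01 // ge_min lexx.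
  have ac : t <= v (a - c).
    by rewrite leNgt; apply/negP => h; apply: na; rewrite HB; exists a.
  apply: Or32; have -> : v (a - x) = v (a - c).
    by rewrite vB_sym (@vtri_eq c) ?(vB_sym c) // (lt_le_trans xt).
  apply: le_trans ac; rewrite -[leRHS](divfK (lt0r_neq0 r00)) mulrC ler_wpM2r ?(ltW r00) //.
  by rewrite ge_min lexx orbT.
have xt : t < v (x - c).
  by rewrite ltNge; apply/negP => h; move: Bx; rewrite HB; apply; exists x.
have in_ a : ~ B i (Some a) -> v (a - c) <= t.
  by rewrite HB => /contrapT [b /= h [<-]].
have ax a : ~ B i (Some a) -> v (a - x) = v (c - x).
  by move=> /in_ h; rewrite (@vtri_eq c) // (vB_sym c) (le_lt_trans h).
have cx0 : 0 < v (c - x) by rewrite vB_sym (lt_trans t0).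
(* The hole is a disc seen from x at distance |c - x|; only when this distance is r0 can it give a
   new direction. *)
have [lt|gt|E] := ltgtP (v (c - x)) r0.
- have q1 : 1 < r0 / v (c - x) by rewrite ltr_pdivlMr // mul1r.
  exists (Num.min L0 (r0 / v (c - x))), es; split=> //; first by rewrite lt_min L01.
  move=> a /split_[na|/H]; last by apply: shrink; rewrite ?lt_min ?L01 // ge_min lexx.
  apply: Or31; rewrite ax // -[leRHS](divfK (lt0r_neq0 cx0)) mulrC ler_wpM2r ?v_ge0 //.
  by rewrite ge_min lexx orbT.
- have q1 : 1 < v (c - x) / r0 by rewrite ltr_pdivlMr // mul1r.
  exists (Num.min L0 (v (c - x) / r0)), es; split=> //; first by rewrite lt_min L01.
  move=> a /split_[na|/H]; last by apply: shrink; rewrite ?lt_min ?L01 // ge_min lexx.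
  apply: Or32; rewrite ax // -[leRHS](divfK (lt0r_neq0 r00)) mulrC ler_wpM2r ?(ltW r00) //.
  by rewrite ge_min lexx orbT.
have tr : t < r0 by rewrite -E vB_sym.
case: (pselect (exists2 e, e \in es & v (c - e) < r0)) => [[e he ce]|none].
  set m := Num.max t (v (c - e)).
  have m0 : 0 < m by rewrite lt_max t0.
  have q1 : 1 < r0 / m by rewrite ltr_pdivlMr // mul1r gt_max tr.
  exists (Num.min L0 (r0 / m)), es; split=> //; first by rewrite lt_min L01.
  move=> a /split_[na|/H]; last by apply: shrink; rewrite ?lt_min ?L01 // ge_min lexx.
  apply: Or33; exists e => //; rewrite -[leRHS](divfK (lt0r_neq0 m0)) mulrC.
  apply: ler_pM; rewrite ?v_ge0 ?le_min ?ge_min ?lexx ?orbT ?(ltW (lt_trans ltr01 L01)) ?(ltW (lt_trans ltr01 q1)) //.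
  by apply: (@vtri_le c); rewrite le_max ?in_ // lexx orbT.
have q1 : 1 < r0 / t by rewrite ltr_pdivlMr // mul1r.
have ce e : e \in es -> v (c - e) = r0.
  move=> he; apply/eqP; rewrite eq_le; apply/andP; split.
    by apply: (@vtri_le x); rewrite ?E // vB_sym ex.
  by rewrite leNgt; apply/negP => h; apply: none; exists e.
exists (Num.min L0 (r0 / t)), (c :: es); split; first by rewrite lt_min L01.
- rewrite /= ues andbT; apply/negP => /ce; rewrite subrr v0 => h.
  by move: r00; rewrite -h ltxx.
- by move=> e; rewrite inE => /orP[/eqP->|/ex].
- move=> e e'; rewrite !inE => /orP[/eqP->|he] /orP[/eqP->|he'] ne.
  + by rewrite eqxx in ne.
  + exact: ce.
  + by rewrite vB_sym; apply: ce.
  + exact: ee.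
move=> a /split_[na|/H h]; last first.
  have := shrink (Num.min L0 (r0 / t)) a; rewrite lt_min L01 q1 ge_min lexx => /(_ isT isT h).
  case=> [h1|h1|[e he h1]]; [exact: Or31|exact: Or32|].
  by apply: Or33; exists e => //; rewrite inE he orbT.
apply: Or33; exists c; rewrite ?mem_head // -[leRHS](divfK (lt0r_neq0 t0)) mulrC.
apply: ler_pM; rewrite ?v_ge0 ?le_min ?ge_min ?lexx ?orbT ?(ltW (lt_trans ltr01 L01)) ?(ltW (lt_trans ltr01 q1)) //.
exact: in_.
Qed.
End TwoConstants.

(** Connectedness of an interval, by a supremum argument. Going down is going up for the negation of
    T, since the local hypothesis is symmetric in r1 and r2. *)
Lemma interval_propagate (T : R -> Prop) (rho : R) :
  (forall r0, 0 < r0 -> r0 <= rho -> exists2 L, 1 < L & forall r1 r2,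
     r0 / L < r1 -> r1 < r0 * L -> r0 / L < r2 -> r2 < r0 * L -> T r1 -> T r2) ->
  forall a b, 0 < a -> a <= rho -> 0 < b -> b <= rho -> T a -> T b.
Proof.
have up (S : R -> Prop) : (forall r0, 0 < r0 -> r0 <= rho -> exists2 L, 1 < L & forall r1 r2,
     r0 / L < r1 -> r1 < r0 * L -> r0 / L < r2 -> r2 < r0 * L -> S r1 -> S r2) ->
    forall a b, 0 < a -> a <= b -> b <= rho -> S a -> S b.
  move=> loc a b a0 ab brho Sa.
  pose E := [set t : R | [/\ a <= t, t <= b & S t]]; set s := sup E.
  have Ea : E a by split.
  have ubE : ubound E b by move=> t [].
  have hs : has_sup E by split; [exists a|exists b].
  have as_ : a <= s by apply: ub_le_sup => //; exists b.
  have sb : s <= b by apply: ge_sup => //; exists a.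
  have s0 := lt_le_trans a0 as_.
  have [L L1 H] := loc s s0 (le_trans sb brho).
  have sL : s / L < s by rewrite ltr_pdivrMr ?(lt_trans ltr01) // ltr_pMr.
  have sL' : s < s * L by rewrite ltr_pMr.
  have spos : 0 < s - s / L by rewrite subr_gt0.
  have [t [at_ tb St] ts] := sup_adherent spos hs.
  rewrite -/s opprB addrC subrK in ts.
  have ts' : t <= s by apply: ub_le_sup; [exists b|split].
  have [->|sneb] := eqVneq b s; first by apply: H St => //; apply: le_lt_trans sL'.
  have sltb : s < b by rewrite lt_neqAle eq_sym sneb.
  pose s' := (s + Num.min b (s * L)) / 2.
  have m0 : s < Num.min b (s * L) by rewrite lt_min sltb.
  have ss' : s < s' by rewrite /s' ltr_pdivlMr // mulr_natr mulr2n ltrD2l.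
  have s'm : s' < Num.min b (s * L) by rewrite /s' ltr_pdivrMr // mulr_natr mulr2n ltrD2r.
  move: s'm; rewrite lt_min => /andP[s'b s'L].
  have : E s'.
    split; [exact: le_trans (ltW ss')|exact: ltW|].
    by apply: H St => //; [exact: le_lt_trans sL'|exact: lt_trans ss'].
  move=> Es'; have : s' <= s by apply: ub_le_sup => //; exists b.
  by rewrite leNgt ss'.
move=> loc a b a0 arho b0 brho Ta; have [ab|ba] := leP a b; first exact: up Ta.
apply: contrapT => nTb; have : (fun t => ~ T t) a; last by apply.
apply: (up (fun t => ~ T t) _ b a) => //; last exact: ltW.
move=> r0 r00 r0rho; have [L L1 H] := loc r0 r00 r0rho; exists L => // r1 r2 h1 h2 h3 h4 n1 T2.
exact/n1/(H r2).
Qed.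

Section Propagation.
Variables (n : nat) (B : 'I_n.+1 -> set P1) (X : set P1).
Hypothesis rX : affinoid_rep B X.
Variable C : R.
Hypothesis C0 : 0 < C.

(** del depends on eps but not on the pair (U, W): one del has to serve all large iterates. *)
Definition transfer e r1 e' r2 := forall eps, 0 < eps -> exists2 del, 0 < del &
  forall U W, admissible X C U W -> nrm U e r1 <= del * nrm W e r1 ->
    nrm U e' r2 <= eps * nrm W e' r2.
Lemma transfer_refl e r : transfer e r e r.
Proof. by move=> eps e0; exists eps. Qed.
Lemma transfer_trans e1 r1 e2 r2 e3 r3 : transfer e1 r1 e2 r2 -> transfer e2 r2 e3 r3 ->
  transfer e1 r1 e3 r3.
Proof.
move=> h1 h2 eps /h2 [d d0 H2]; have [d' d'0 H1] := h1 d d0; exists d' => // U W ad h.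
exact/H2/H1.
Qed.

(** [mean_inequality] for U is divided by [mean_equality] for W, whose roots avoid the region
    between the neighbouring nodes. *)
Lemma mean_ratio x cs r L U W (c0 : R) (c : K -> R) eps : 0 < r -> 1 < L -> uniq cs -> x \in cs ->
  (forall e e', e \in cs -> e' \in cs -> e != e' -> v (e - e') = r) ->
  W != 0 -> (forall a, root W a ->
    r * L <= v (x - a) \/ exists2 e, e \in cs & v (e - a) <= r / L) ->
  nrm U x (r * L) <= c0 * nrm W x (r * L) ->
  (forall e, e \in cs -> nrm U e (r / L) <= c e * nrm W e (r / L)) ->
  0 <= c0 -> (forall e, e \in cs -> 0 <= c e) -> 0 <= eps ->
  c0 * \prod_(e <- cs) c e <= eps ^+ (size cs).+1 ->
  nrm U x r <= eps * nrm W x r.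
Proof.
move=> r0 L1 ucs xcs dcs W0 rW h0 hc c00 cge e0 hce.
have nnU : nrm U x r \is Num.nneg by rewrite nnegrE nrm_ge0.
have nnW : eps * nrm W x r \is Num.nneg by rewrite nnegrE mulr_ge0 // nrm_ge0.
rewrite -(@ler_pXn2r _ (size cs).+1 isT _ _ nnU nnW) [X in _ <= X]exprMn.
rewrite (mean_equality r0 L1 ucs xcs dcs rW W0).
apply: le_trans (mean_inequality r0 L1 ucs xcs dcs U) _.
apply: le_trans (_ : (c0 * nrm W x (r * L)) * \prod_(e <- cs) (c e * nrm W e (r / L)) <= _).
  apply: ler_pM; rewrite ?nrm_ge0 ?prodr_ge0 //; first by move=> e _; apply: nrm_ge0.
  by apply: prodr_le_mem => e ecs; rewrite nrm_ge0 hc.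
rewrite big_split /= mulrACA ler_wpM2r // mulr_ge0 ?nrm_ge0 // prodr_ge0 // => e _.
exact: nrm_ge0.
Qed.

Variables (x y : K).
Hypotheses (Xx : X (Some x)) (Xy : X (Some y)) (xy : x != y).
Let rho := v (x - y).

(** Nearby radii are compared through r0. Towards r0 the mean inequality is applied at r0 with all
    hole directions es: one neighbour is small, the others are bounded by C. From r0 to r2 it is
    applied at r2, where x is the only direction to be considered. *)
Lemma transfer_local r0 : 0 < r0 -> r0 <= rho -> exists2 L, 1 < L & forall r1 r2,
  r0 / L < r1 -> r1 < r0 * L -> r0 / L < r2 -> r2 < r0 * L -> transfer x r1 x r2.
Proof.
move=> r00 r0rho; have [L0 [es [L01 ues ex ee holes]]] := local_holes rX Xx Xy r00 r0rho.
have L00 := lt_trans ltr01 L01.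
have xes : x \notin es.
  by apply/negP => /ex; rewrite subrr v0 => h; move: r00; rewrite -h ltxx.
have inX_out z : r0 < v (z - x) -> v (z - x) < r0 * L0 -> X (Some z).
  move=> h1 h2; apply: contrapT => /holes [h|h|[e he h]].
  - have := le_lt_trans h h1; rewrite gtr_pMr ?(lt_trans r00) // => /(lt_trans L01).
    by rewrite ltxx.
  - by have := le_lt_trans h h2; rewrite ltxx.
  have E : v (e - z) = v (x - z) by apply: vtri_eq; rewrite ex // vB_sym.
  move: h; rewrite vB_sym E vB_sym leNgt (lt_trans h1) // ltr_pMr // (lt_trans r00) //.
have inX_in e z : e \in x :: es -> r0 / L0 < v (z - e) -> v (z - e) < r0 -> X (Some z).
  rewrite ltr_pdivrMr // => he h1 h2; apply: contrapT.
  move: he; rewrite inE => /orP[/eqP E|he].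
    subst e; move=> /holes [h|h|[e' he' h]].
    - by move: h; rewrite leNgt h1.
    - have := le_lt_trans h h2; rewrite gtr_pMr // => /(lt_trans L01); by rewrite ltxx.
    have xe : v (x - e') = r0 by rewrite vB_sym ex.
    have E : v (z - e') = r0 by rewrite (@vtri_eq x) xe.
    by move: h; rewrite E leNgt ltr_pMr // L01.
  have E : v (z - x) = r0 by rewrite (@vtri_eq e) ex.
  move=> /holes [h|h|[e' he' h]].
  - by move: h; rewrite E leNgt ltr_pMr // L01.
  - by move: h; rewrite E leNgt ltr_pMr // L01.
  have [E'|ne] := eqVneq e e'; first by move: h; rewrite -E' leNgt h1.
  have ee' : v (e - e') = r0 by rewrite ee.
  have E'' : v (z - e') = r0 by rewrite (@vtri_eq e) ee'.
  by move: h; rewrite E'' leNgt ltr_pMr // L01.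
have bnd_out U W t : admissible X C U W -> r0 < t -> t < r0 * L0 -> nrm U x t <= C * nrm W x t.
  by move=> ad h1 h2; apply: (admissible_bound C0 ad r00 h1 h2).
have bnd_in U W e t : admissible X C U W -> e \in x :: es -> r0 / L0 < t -> t < r0 ->
    nrm U e t <= C * nrm W e t.
  move=> ad he h1 h2; apply: (admissible_bound C0 ad _ h1 h2); first by rewrite divr_gt0.
  by move=> z; apply: inX_in.
have ucs : uniq (x :: es) by rewrite /= xes.
have dcs e e' : e \in x :: es -> e' \in x :: es -> e != e' -> v (e - e') = r0.
  rewrite !inE => /orP[/eqP->|he] /orP[/eqP->|he'] ne.
  - by rewrite eqxx in ne.
  - by rewrite vB_sym ex.
  - by rewrite ex.
  - exact: ee.
have rootW U W L a : admissible X C U W -> 1 < L -> L <= L0 -> root W a ->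
    r0 * L <= v (x - a) \/ exists2 e, e \in x :: es & v (e - a) <= r0 / L.
  move=> [_ rW _] L1 LL /rW /holes H; have L0' := lt_trans ltr01 L1.
  case: H => [h|h|[e he h]].
  - right; exists x; rewrite ?mem_head // ler_pdivlMr // vB_sym.
    by apply: le_trans h; rewrite ler_wpM2l ?v_ge0.
  - by left; rewrite vB_sym; apply: le_trans h; rewrite ler_wpM2l ?(ltW r00).
  - right; exists e; rewrite ?inE ?he ?orbT // ler_pdivlMr // vB_sym.
    by apply: le_trans h; rewrite ler_wpM2l ?v_ge0.
have to_r0 r1 : r0 / L0 < r1 -> r1 < r0 * L0 -> transfer x r1 x r0.
  move=> h1 h2; have r10 : 0 < r1 by apply: lt_trans h1; rewrite divr_gt0.
  have [lt|gt|->] := ltgtP r1 r0; last exact: transfer_refl.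
    pose L := r0 / r1.
    have L1 : 1 < L by rewrite ltr_pdivlMr // mul1r.
    have LL : L < L0 by rewrite ltr_pdivrMr // mulrC -ltr_pdivrMr.
    have rE : r0 / L = r1 by rewrite /L; field; rewrite !gt_eqF.
    move=> eps e0; set N := size (x :: es).
    (* Of the N + 1 factors in the mean inequality one is del and N are C. *)
    exists (eps ^+ N.+1 / C ^+ N); first by rewrite divr_gt0 ?exprn_gt0.
    move=> U W ad h; have [W0 _ _] := ad; set del := _ / _ in h.
    have del0 : 0 <= del by rewrite divr_ge0 ?exprn_ge0 // ltW.
    apply: (@mean_ratio x (x :: es) r0 L U W C (fun e => if e == x then del else C)) => //;
      rewrite ?mem_head ?(ltW e0) ?(ltW C0) //.
    - by move=> a; apply: (rootW U W) => //; apply: ltW.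
    - by apply: bnd_out => //; rewrite ?ltr_pMr // ltr_pM2l.
    - move=> e he; rewrite rE; case: eqP => [->|_] //; first exact: bnd_in.
    - by move=> e _; case: ifP => // _; apply: ltW.
    rewrite big_cons eqxx (@prod_const_seq es _ C); last first.
      by move=> e he; case: eqP => // E; rewrite -E he in xes.
    rewrite mulrCA -exprS -/N /del divfK // gt_eqF // exprn_gt0 //.
  pose L := r1 / r0.
  have L1 : 1 < L by rewrite ltr_pdivlMr // mul1r.
  have LL : L < L0 by rewrite ltr_pdivrMr // mulrC.
  have rE : r0 * L = r1 by rewrite /L; field; rewrite !gt_eqF.
  have rL : r0 / L0 < r0 / L by rewrite ltr_pM2l // ltf_pV2 ?posrE // (lt_trans ltr01).
  have rL' : r0 / L < r0 by rewrite ltr_pdivrMr ?(lt_trans ltr01) // ltr_pMr.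
  move=> eps e0; set N := size (x :: es).
  exists (eps ^+ N.+1 / C ^+ N); first by rewrite divr_gt0 ?exprn_gt0.
  move=> U W ad h; have [W0 _ _] := ad; set del := _ / _ in h.
  have del0 : 0 <= del by rewrite divr_ge0 ?exprn_ge0 // ltW.
  apply: (@mean_ratio x (x :: es) r0 L U W del (fun=> C)) => //;
    rewrite ?mem_head ?(ltW e0) ?(ltW C0) ?rE //.
  - by move=> a /(rootW U W L a ad L1 (ltW LL)); rewrite rE.
  - by move=> e he; apply: bnd_in.
  by rewrite (@prod_const_seq _ _ C) // /del divfK // gt_eqF // exprn_gt0.
(* The neighbour of r2 on the side away from r0 is at ratio L'^2 from r0, and this must stay below
   L0. *)
have [L L1 LL] := root_gt1 2 L01; have Lp := lt_trans ltr01 L1.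
have LL0 : L < L0 by apply: lt_le_trans LL; rewrite expr2 ltr_pMr.
have two U W r L' eps del : admissible X C U W -> 0 < r -> 1 < L' -> 0 < eps -> 0 <= del ->
    (forall a, root W a -> r * L' <= v (x - a) \/ v (x - a) <= r / L') ->
    ((nrm U x (r * L') <= del * nrm W x (r * L')) /\ (nrm U x (r / L') <= C * nrm W x (r / L')) \/
     (nrm U x (r * L') <= C * nrm W x (r * L')) /\ (nrm U x (r / L') <= del * nrm W x (r / L'))) ->
    del * C <= eps ^+ 2 -> nrm U x r <= eps * nrm W x r.
  move=> ad r0' L1' e0 d0 rW h dC; have [W0 _ _] := ad.
  have rW' a : root W a -> r * L' <= v (x - a) \/ exists2 e, e \in [:: x] & v (e - a) <= r / L'.
    by move=> /rW [|h']; [left|right; exists x; rewrite ?mem_head].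
  have d1 e e' : e \in [:: x] -> e' \in [:: x] -> e != e' -> v (e - e') = r.
    by rewrite !inE => /eqP -> /eqP ->; rewrite eqxx.
  case: h => -[hA hB].
    apply: (@mean_ratio x [:: x] r L' U W del (fun=> C)) => //; rewrite ?mem_head ?(ltW e0) //.
    - by move=> e; rewrite inE => /eqP ->.
    - by move=> *; apply: ltW.
    by rewrite big_seq1.
  apply: (@mean_ratio x [:: x] r L' U W C (fun=> del)) => //; rewrite ?mem_head ?(ltW e0) ?(ltW C0) //.
  - by move=> e; rewrite inE => /eqP ->.
  by rewrite big_seq1 mulrC.
have from_r0 r2 : r0 / L < r2 -> r2 < r0 * L -> transfer x r0 x r2.
  move=> h1 h2; have r20 : 0 < r2 by apply: lt_trans h1; rewrite divr_gt0.
  have [lt|gt|->] := ltgtP r2 r0; last exact: transfer_refl.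
    pose L' := r0 / r2.
    have L1' : 1 < L' by rewrite ltr_pdivlMr // mul1r.
    have LL' : L' < L by rewrite ltr_pdivrMr // mulrC -ltr_pdivrMr.
    have L'0 := lt_trans ltr01 L1'.
    have rE : r2 * L' = r0 by rewrite /L'; field; rewrite !gt_eqF.
    have L2 : L' ^+ 2 < L0 by apply: lt_le_trans LL; rewrite ltrXn2r ?nnegrE ?ltW.
    have rE' : r2 / L' = r0 / L' ^+ 2 by rewrite -rE; field; rewrite !gt_eqF.
    have t1 : r0 / L0 < r2 / L' by rewrite rE' ltr_pM2l // ltf_pV2 ?posrE // exprn_gt0.
    have t2 : r2 / L' < r0 by apply: lt_trans lt; rewrite ltr_pdivrMr // ltr_pMr.
    move=> eps e0; exists (eps ^+ 2 / C); first by rewrite divr_gt0 ?exprn_gt0.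
    move=> U W ad h; apply: (two U W r2 L' eps (eps ^+ 2 / C)) => //.
    - by rewrite divr_ge0 ?exprn_ge0 // ltW.
    - move=> a; case: ad => _ rW _ /rW /holes; rewrite rE vB_sym => -[h'|h'|[e he h']].
      + by right; rewrite (le_trans _ (ltW t1)) // ler_pdivlMr // vB_sym.
      + by left; apply: le_trans h'; rewrite ler_peMr ?(ltW L01) // ltW.
      left; have he'' : v (a - e) < r0.
        by rewrite -ler_pdivlMr // in h'; apply: le_lt_trans h' _; rewrite ltr_pdivrMr // ltr_pMr.
      have E : v (a - x) = r0 by rewrite (@vtri_eq e) ex.
      by rewrite ?(vB_sym x) E.
    - by left; rewrite rE; split=> //; apply: (bnd_in U W) => //; exact: mem_head.
    by rewrite divfK // gt_eqF.
  pose L' := r2 / r0.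
  have L1' : 1 < L' by rewrite ltr_pdivlMr // mul1r.
  have LL' : L' < L by rewrite ltr_pdivrMr // mulrC.
  have L'0 := lt_trans ltr01 L1'.
  have rE : r2 / L' = r0 by rewrite /L'; field; rewrite !gt_eqF.
  have L2 : L' ^+ 2 < L0 by apply: lt_le_trans LL; rewrite ltrXn2r ?nnegrE ?ltW.
  have rE' : r2 * L' = r0 * L' ^+ 2 by rewrite -rE; field; rewrite !gt_eqF.
  have t1 : r2 * L' < r0 * L0 by rewrite rE' ltr_pM2l.
  have t2 : r0 < r2 * L' by apply: lt_trans gt _; rewrite ltr_pMr.
  move=> eps e0; exists (eps ^+ 2 / C); first by rewrite divr_gt0 ?exprn_gt0.
  move=> U W ad h; apply: (two U W r2 L' eps (eps ^+ 2 / C)) => //.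
  - by rewrite divr_ge0 ?exprn_ge0 // ltW.
  - move=> a; case: ad => _ rW _ /rW /holes; rewrite rE vB_sym => -[h'|h'|[e he h']].
    + by right; apply: le_trans h'; rewrite ler_peMr ?v_ge0 // ltW.
    + by left; rewrite (le_trans (ltW t1)).
    right; have he'' : v (a - e) < r0.
      by rewrite -ler_pdivlMr // in h'; apply: le_lt_trans h' _; rewrite ltr_pdivrMr // ltr_pMr.
    have E : v (a - x) = r0 by rewrite (@vtri_eq e) ex.
    by rewrite ?(vB_sym x) E.
  - by right; rewrite rE; split=> //; apply: (bnd_out U W).
  by rewrite divfK // gt_eqF.
exists L => // r1 r2 h1 h2 h3 h4; apply: (@transfer_trans _ _ x r0); last exact: from_r0.
have i : r0 / L0 < r0 / L by rewrite ltr_pM2l // ltf_pV2 ?posrE.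
apply: to_r0; first exact: lt_trans h1.
by apply: lt_trans h2 _; rewrite ltr_pM2l.
Qed.
Lemma transfer_radii r1 r2 : 0 < r1 -> r1 <= rho -> 0 < r2 -> r2 <= rho -> transfer x r1 x r2.
Proof.
move=> h1 h2 h3 h4; apply: (@interval_propagate (fun r => transfer x r1 x r) rho _ r1 r2) => //.
  move=> r0 r00 r0rho; have [L L1 H] := transfer_local r00 r0rho; exists L => // a b *.
  by apply: (@transfer_trans _ _ x a) => //; apply: H.
exact: transfer_refl.
Qed.
End Propagation.

Lemma affinoid_open n (B : 'I_n.+1 -> set P1) (X : set P1) x : affinoid_rep B X ->
  X (Some x) -> exists2 s, 0 < s & forall z, v (z - x) < s -> X (Some z).
Proof.
move=> rX Xx.
have one i : exists s : R, 0 < s /\ forall z, v (z - x) < s -> B i (Some z).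
  have [c [t [[u u0 tE] HB]]] := proj1 rX i; have t0 : 0 < t by rewrite tE v_gt0.
  have : B i (Some x) by case: rX Xx => _ -> ; apply.
  case: HB => ->.
    move=> [x' xt [x'E]]; subst x'; rewrite /= in xt; exists t; split=> // z zx.
    by exists z => //=; apply: (@vtri_lt x).
  move=> nx; have xt : t < v (x - c).
    by rewrite ltNge; apply/negP => h; apply: nx; exists x.
  exists t; split=> // z zx [z' /= h [z'E]]; subst z'.
  have : v (x - c) <= t by apply: (@vtri_le z) => //; rewrite vB_sym ltW.
  by rewrite leNgt xt.
have [s sP] := choice one.
(* A positive lower bound of all the s i, in place of their minimum. *)
exists (\sum_i (s i)^-1)^-1.
  rewrite invr_gt0 (bigD1 ord0) //= ltr_pwDl ?invr_gt0 ?(proj1 (sP _)) //.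
  by rewrite sumr_ge0 // => i _; rewrite invr_ge0 ltW // (proj1 (sP _)).
move=> z zx; case: rX => _ -> i _; apply: (proj2 (sP i)); apply: lt_le_trans zx _.
have si := proj1 (sP i); rewrite -[leRHS]invrK lef_pV2 ?posrE ?invr_gt0 //.
  by rewrite (bigD1 i) //= lerDl sumr_ge0 // => j _; rewrite invr_ge0 ltW // (proj1 (sP _)).
rewrite (bigD1 i) //= ltr_pwDl ?invr_gt0 // sumr_ge0 // => j _.
by rewrite invr_ge0 ltW // (proj1 (sP _)).
Qed.

(** Smallness goes from a small radius around x up to |x - y|, where x and y define the same Gauss
    norm, and down to |c'| around y. s' is chosen before s and eps, so one neighbourhood of y serves
    all precisions. If x = y, an auxiliary point z0 of X provides the outer radius. *)
Lemma two_constants n (B : 'I_n.+1 -> set P1) (X : set P1) (C : R) x y :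
  affinoid_rep B X -> 0 < C -> X (Some x) -> X (Some y) ->
  exists2 s', 0 < s' & forall s eps, 0 < s -> 0 < eps -> exists2 del, 0 < del &
    forall U W, admissible X C U W -> (forall z, v (z - x) < s -> v U.[z] <= del * v W.[z]) ->
      forall z, v (z - y) < s' -> v U.[z] <= eps * v W.[z].
Proof.
move=> rX C0 Xx Xy; have [sy sy0 syX] := affinoid_open rX Xy.
have small_ball (e : R) : 0 < e -> exists2 c, c != 0 & v c < e.
  move=> e0; have [|c c0 /andP[_ ce]] := @value_dense (e / 2) e (divr_gt0 e0 (ltr0n _ 2)).
    by rewrite ltr_pdivrMr // ltr_pMr // ltr1n.
  by exists c.
have [z0 [z0x Xz0 z0y]] : exists z, [/\ x != z, X (Some z) & x != y -> z = y].
  have [xy|xy] := eqVneq x y; last by exists y.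
  have [u u0 usy] := small_ball sy sy0; exists (x + u); split=> //.
    by rewrite eq_sym -subr_eq0 addrAC subrr add0r.
  by rewrite xy; apply: syX; rewrite addrAC subrr add0r.
have r0 : 0 < v (x - z0) by rewrite v_gt0 subr_eq0.
have [|c' c'0 c'lt] := small_ball (Num.min sy (v (x - z0))); first by rewrite lt_min sy0.
move: c'lt; rewrite lt_min => /andP[c'sy c'rho].
exists (v c'); first by rewrite v_gt0.
move=> s eps s0 e0.
have start c del U W : c != 0 -> v c < s ->
    (forall z, v (z - x) < s -> v U.[z] <= del * v W.[z]) ->
    nrm U x (v c) <= del * nrm W x (v c).
  move=> c0 cs H; have [z ze zl] := generic_point x (rts U ++ rts W) c0.
  rewrite -(@v_generic U x _ z) // -1?(@v_generic W x _ z) //.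
  - by apply: H; apply: le_lt_trans ze cs.
  - by move=> a aW; apply: zl; rewrite mem_cat aW orbT.
  - by move=> a aU; apply: zl; rewrite mem_cat aU.
have [|c c0 clt] := small_ball (Num.min s (v (x - z0))); first by rewrite lt_min s0.
move: clt; rewrite lt_min => /andP[cs crho].
suff tr : transfer X C x (v c) y (v c').
  have [del d0 H] := tr eps e0; exists del => // U W ad hU z zy.
  apply: le_trans (v_le_nrm U (ltW zy)) _.
  rewrite (@v_noroot W y (v c')) //; last first.
    move=> a ay; apply/negP => ra; case: ad => _ rW _; apply: (rW a ra); apply: syX.
    exact: lt_trans c'sy.
  by apply: H => //; apply: start hU.
have h1 : transfer X C x (v c) x (v (x - z0)).
  by apply: (transfer_radii rX C0 Xx Xz0) => //; by [rewrite v_gt0|apply: ltW].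
have [xy|xy] := eqVneq x y.
  rewrite -xy; apply: (transfer_trans h1).
  by apply: (transfer_radii rX C0 Xx Xz0) => //; by [rewrite v_gt0|apply: ltW].
have E := z0y xy; subst z0; apply: (transfer_trans h1).
apply: (@transfer_trans X C _ _ y (v (y - x))).
  move=> e e0'; exists e => // U W _.
  by rewrite (nrm_recenter U (e' := y)) // (nrm_recenter W (e' := y)) // vB_sym.
by apply: (transfer_radii rX C0 Xy Xx); rewrite 1?(vB_sym y) //; by [rewrite v_gt0|apply: ltW].
Qed.

Lemma affinoid_bounded n (B : 'I_n.+1 -> set P1) (X : set P1) : affinoid_rep B X -> ~ X None ->
  exists M, forall z, X (Some z) -> v z <= M.
Proof.
move=> [bB ->] nX; have [i Bi] : exists i, ~ B i None.
  by apply: contrapT => h; apply: nX => i _; apply: contrapT => h'; apply: h; exists i.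
have [c [t [tg HB]]] := bB i; exists (Num.max t (v c)) => z /(_ i I).
case: HB Bi => -> Bi; last by case: Bi => -[? _].
case=> z' z't [<-]; rewrite -[z'](subrK c); apply: vD_le; last by rewrite le_max lexx orbT.
by rewrite le_max ltW.
Qed.

(** For large j the gap lemma gives i with |G_j - a_i| >= c on X. Then (G_j - Phi) / (G_j - a_i) is
    bounded by C on X and small near x, hence small near y by the two-constants inequality; as |Phi
    - a_i| <= M1, G_j - Phi is small itself. The division makes up for the absence of a uniform
    bound on the G_j. *)
Lemma vitali_affine n (B : 'I_n.+1 -> set P1) (X : set P1) (a : 'I_n.+3 -> K)
    (G : nat -> P1 -> P1) phi (Phi : {poly K}) x y :
  affinoid_rep B X -> ~ X None -> X (Some x) -> X (Some y) -> injective a ->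
  (forall j, ratmap (G j)) ->
  (forall j z, X z -> G j z <> None /\ forall i, G j z <> Some (a i)) ->
  (forall z, phi (Some z) = Some Phi.[z]) -> (forall i, Phi.[x] != a i) ->
  (exists M, forall z, X (Some z) -> v Phi.[z] <= M) ->
  unif G phi (Some x) -> unif G phi (Some y).
Proof.
move=> rX XN Xx Xy a_inj rG omit phiE w0a [M HM] [d d0 Hd].
have sum_ge (f : 'I_n.+3 -> R) i : (forall i, 0 <= f i) -> f i <= \sum_i f i.
  by move=> f0; rewrite (bigD1 i) //= lerDl sumr_ge0.
pose w0 := Phi.[x]; pose S := \sum_i (v (w0 - a i))^-1.
have w0a0 i : 0 < v (w0 - a i) by rewrite v_gt0 subr_eq0.
have S0 : 0 < S.
  apply: lt_le_trans (sum_ge (fun i => (v (w0 - a i))^-1) ord0 _); first by rewrite invr_gt0.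
  by move=> i; rewrite invr_ge0 v_ge0.
have rho0 : 0 < S^-1 by rewrite invr_gt0.
have rho_le i : S^-1 <= v (w0 - a i).
  rewrite -[leRHS]invrK lef_pV2 ?posrE ?invr_gt0 //.
  by apply: (sum_ge (fun i => (v (w0 - a i))^-1)) => k; rewrite invr_ge0 v_ge0.
pose M0 := \sum_i v (w0 - a i).
have M0_ge i : v (w0 - a i) <= M0 by apply: (sum_ge (fun i => v (w0 - a i))) => k; exact: v_ge0.
have [c c0 Hgap] := omitted_value_gap rX M0 Xx a_inj rho0.
pose M1 := `|M| + \sum_i v (a i) + 1.
have sa0 : 0 <= \sum_i v (a i) by apply: sumr_ge0 => i _; exact: v_ge0.
have M10 : 0 < M1 by rewrite ltr_wpDl // addr_ge0.
have HM1 z i : X (Some z) -> v (Phi.[z] - a i) <= M1.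
  move=> Xz; apply: vD_le.
    apply: le_trans (HM z Xz) _; apply: le_trans (ler_norm _) _.
    by rewrite /M1 -addrA lerDl addr_ge0.
  rewrite vN; apply: le_trans (sum_ge (fun i => v (a i)) i (fun i => v_ge0 _)) _.
  by rewrite /M1 addrAC lerDr addr_ge0.
(* From G_j - Phi = (G_j - a_i) - (Phi - a_i) and |G_j - a_i| >= c. *)
pose C := Num.max 1 (M1 / c).
have C0 : 0 < C by rewrite lt_max ltr01.
have [s' s'0 HTC] := two_constants rX C0 Xx Xy.
have [sx sx0 Hsx] := affinoid_open rX Xx; have [sy sy0 Hsy] := affinoid_open rX Xy.
have [d' d'0 Hd'] : exists2 d', 0 < d' & forall w, chordal v w (Some y) < d' ->
    exists2 b, w = Some b & v (b - y) < Num.min s' sy.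
  by apply: chordal_small; rewrite lt_min s'0.
exists d' => // e e0.
(* Being below 1, eps excludes |G_j - Phi| > M1 at the end; the other bound gives the precision
   e. *)
pose eps := Num.min (1 / 2) (e / 2 / M1).
have e20 : 0 < e / 2 by rewrite divr_gt0.
have eps0 : 0 < eps by rewrite lt_min !divr_gt0.
have eps1 : eps < 1 by rewrite gt_min ltr_pdivrMr // mul1r ltr1n.
have epsM : eps * M1 < e.
  rewrite (@le_lt_trans _ _ (e / 2)) ?ltr_pdivrMr ?ltr_pMr ?ltr1n //.
  by rewrite -ler_pdivlMr // ge_min lexx orbT.
have smin0 : 0 < Num.min d sx by rewrite lt_min d0.
have [del del0 Hdel] := HTC _ _ smin0 eps0.
have rmin0 : 0 < Num.min (del * c) S^-1 by rewrite lt_min mulr_gt0.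
have [d1 d10 Hd1] := chordal_small_bounded M rmin0.
have [J HJ] := Hd d1 d10; exists J => j Jj w wy.
have [b wE] := Hd' w wy; rewrite lt_min => /andP[bs' bsy]; subst w; rewrite phiE.
have Xb := Hsy _ bsy.
have fin z : X (Some z) -> exists w', G j (Some z) = Some w'.
  by move=> Xz; have [h _] := omit j _ Xz; case E: (G j (Some z)) h => [w'|] // _; exists w'.
have near z : v (z - x) < Num.min d sx -> exists w', [/\ X (Some z), G j (Some z) = Some w' &
    v (w' - Phi.[z]) < Num.min (del * c) S^-1].
  rewrite lt_min => /andP[zd zsx]; have Xz := Hsx _ zsx; have [w' E] := fin z Xz.
  have := HJ j Jj (Some z) (le_lt_trans (chordal_le _ _) zd); rewrite phiE E.
  by move/(Hd1 _ (HM z Xz)) => [w'' [<-] hw]; exists w'.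
have [dg [P [Q rF]]] := rG j.
have [i Hi] : exists i, forall z w', X (Some z) -> G j (Some z) = Some w' -> c <= v (w' - a i).
  have [|w [_ E]] := near x; first by rewrite subrr v0.
  rewrite lt_min => /andP[_ ww0]; apply: (Hgap _ _ _ _ w rF) => //.
    by move=> z i /(omit j) [_]; apply.
  by move=> i; rewrite (@vtri_eq w0) ?rho_le ?M0_ge //; apply: lt_le_trans ww0 _.
pose U := P - Phi * Q; pose W := P - a i *: Q.
have PQ z w' : G j (Some z) = Some w' -> P.[z] = w' * Q.[z] /\ Q.[z] != 0.
  by rewrite (ratE rF); case: eqP => // /eqP q0 [<-]; rewrite divfK.
have UE z w' : G j (Some z) = Some w' -> v U.[z] = v (w' - Phi.[z]) * v Q.[z].
  by move=> /PQ [E _]; rewrite -vM /U hornerD hornerN hornerM E mulrBl.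
have WE z w' : G j (Some z) = Some w' -> v W.[z] = v (w' - a i) * v Q.[z].
  by move=> /PQ [E _]; rewrite -vM /W hornerD hornerN hornerZ E mulrBl.
have [wb Eb] := fin b Xb.
have ad : admissible X C U W.
  have Wr a0 : root W a0 -> ~ X (Some a0) by move/(rat_fiber rF) => E /(omit j) [_ /(_ i)].
  split=> //; first by apply/eqP => W0; apply: (Wr x); rewrite // W0 root0.
  move=> z Xz; have [w' E] := fin z Xz; rewrite (UE _ _ E) (WE _ _ E) mulrA.
  apply: ler_wpM2r; rewrite ?v_ge0 //; have cw := Hi z w' Xz E.
  apply: (@vtri_le (a i)).
    by rewrite ler_peMl ?v_ge0 // le_max lexx.
  rewrite vB_sym; apply: le_trans (HM1 z i Xz) _.
  rewrite -(divfK (lt0r_neq0 c0) M1); apply: ler_pM => //; last by rewrite /C le_max lexx orbT.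
    exact: divr_ge0 (ltW M10) (ltW c0).
  exact: ltW.
have small z : v (z - x) < Num.min d sx -> v U.[z] <= del * v W.[z].
  move=> /near [w' [Xz E]]; rewrite lt_min => /andP[hw _].
  rewrite (UE _ _ E) (WE _ _ E) mulrA; apply: ler_wpM2r; rewrite ?v_ge0 //.
  by apply: le_trans (ltW hw) _; rewrite ler_pM2l // (Hi z).
have := Hdel U W ad small b bs'.
have [_ Qb0] := PQ _ _ Eb; rewrite (UE _ _ Eb) (WE _ _ Eb) mulrA ler_pM2r ?v_gt0 // => hb.
rewrite Eb; apply: le_lt_trans (chordal_le _ _) _.
have [h|h] := leP (v (wb - Phi.[b])) M1.
  apply: le_lt_trans hb (le_lt_trans _ epsM); rewrite ler_pM2l //.
  by apply: (@vtri_le Phi.[b]) => //; apply: HM1.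
have t0 : 0 < v (wb - Phi.[b]) := lt_trans M10 h.
exfalso; have : v (wb - Phi.[b]) <= eps * v (wb - Phi.[b]).
  apply: le_trans hb _; rewrite ler_pM2l //; apply: (@vtri_le Phi.[b]) => //.
  by apply: le_trans (HM1 _ _ Xb) (ltW h).
by rewrite leNgt gtr_pMl // eps1.
Qed.

(** * Conjugation by inversions *)

(** The inversion z -> 1 / (z - o), with inverse [imob]. Taken at an omitted value o, it moves the
    situation into the affine line. *)
Definition mob (o : K) (z : P1) : P1 :=
  if z is Some a then (if a == o then None else Some (a - o)^-1) else Some 0.
Definition imob (o : K) (w : P1) : P1 :=
  if w is Some a then (if a == 0 then None else Some (o + a^-1)) else Some o.
Lemma mobK o : cancel (mob o) (imob o).
Proof.
case=> [a|] /=; last by rewrite eqxx.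
have [->|ao] //= := eqVneq a o; rewrite invr_eq0 subr_eq0 (negbTE ao) invrK.
by rewrite addrC subrK.
Qed.
Lemma imobK o : cancel (imob o) (mob o).
Proof.
case=> [a|] /=; last by rewrite eqxx.
have [->|a0] //= := eqVneq a 0; rewrite -subr_eq0 addrAC subrr add0r invr_eq0 (negbTE a0).
by rewrite invrK.
Qed.
Lemma mob0E : mob 0 = @P1_inv K.
Proof. by apply: funext => -[a|] //=; rewrite subr0. Qed.

Lemma mob_rep o : rat_rep 1 1 ('X - o%:P) (mob o).
Proof.
have E w : hmap 1 1 ('X - o%:P) w = (w.2, w.1 - o * w.2).
  rewrite /hmap /heval !big_ord_recl !big_ord0 /= !coefB !coefX !coefC ?coef1 /=.
  by congr pair; ring.
split; rewrite ?size_poly1 ?size_XsubC //.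
- move=> [x y]; rewrite E /nz /=; case: (eqVneq y 0) => //= ->; rewrite orbF => ?.
  by rewrite mulr0 subr0.
- case=> [a|]; rewrite E /pr /=; last by rewrite mulr0 subr0 oner_eq0 mul0r.
  by rewrite mulr1 subr_eq0 div1r.
Qed.
Lemma imob_rep o : rat_rep 1 (o *: 'X + 1) 'X (imob o).
Proof.
have E w : hmap 1 (o *: 'X + 1) 'X w = (o * w.1 + w.2, w.1).
  rewrite /hmap /heval !big_ord_recl !big_ord0 /= !coefD !coefZ !coefX !coef1 /=.
  by congr pair; ring.
split; rewrite ?size_polyX //.
- apply: leq_trans (size_polyD _ _) _; rewrite geq_max size_poly1 andbT.
  by apply: leq_trans (size_scale_leq _ _) _; rewrite size_polyX.
- move=> [x y]; rewrite E /nz /=; case: (eqVneq x 0) => [->|] //=; last by rewrite orbT.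
  by rewrite mulr0 add0r orbF.
- case=> [a|]; rewrite E /pr /=; last by rewrite oner_eq0 mulr1 addr0 divr1.
  by have [//|a0] := eqVneq a 0; congr Some; field.
Qed.

(** The numerator of the chordal distance is preserved, and each of the two norms in the denominator
    shrinks by at most the factor m. *)
Lemma deg1_lipschitz (m : R) P Q F : 0 < m -> rat_rep 1 P Q F ->
  (forall w, nm w <= m * nm (hmap 1 P Q w)) ->
  (forall w w', v (wedge (hmap 1 P Q w) (hmap 1 P Q w')) = v (wedge w w')) ->
  forall z w, chordal v (F z) (F w) <= m ^+ 2 * chordal v z w.
Proof.
move=> m0 [_ _ hnz FE] Hm Hw z w; have nh := nz_hcoord.
rewrite !FE chordal_pr ?hnz // Hw chordalE mulrCA.
apply: ler_wpM2l; first exact: v_ge0.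
have n1 := nm_gt0 (nh z); have n2 := nm_gt0 (nh w).
have n3 := nm_gt0 (hnz _ (nh z)); have n4 := nm_gt0 (hnz _ (nh w)).
rewrite -[leLHS]mul1r ler_pdivrMr ?mulr_gt0 // mulrAC ler_pdivlMr ?mulr_gt0 // mul1r.
by rewrite expr2 -mulrACA; apply: ler_pM; rewrite ?(ltW n1) ?(ltW n2).
Qed.
Definition mob_lip (o : K) : R := Num.max 1 (v o) ^+ 2.
Lemma mob_lip_gt0 o : 0 < mob_lip o. Proof. by rewrite exprn_gt0 // lt_max ltr01. Qed.
Lemma mob_lipschitz o z w : chordal v (mob o z) (mob o w) <= mob_lip o * chordal v z w.
Proof.
have m0 : 0 < Num.max 1 (v o) by rewrite lt_max ltr01.
have E w0 : hmap 1 1 ('X - o%:P) w0 = (w0.2, w0.1 - o * w0.2).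
  rewrite /hmap /heval !big_ord_recl !big_ord0 /= !coefB !coefX !coefC ?coef1 /=.
  by congr pair; ring.
apply: (deg1_lipschitz m0 (mob_rep o)) => [[x y]|[x y] [x' y']]; rewrite !E /nm /wedge /=.
  set t := Num.max (v y) _; have t0 : 0 <= t by rewrite le_max v_ge0.
  have y_t : v y <= t by rewrite le_max lexx.
  rewrite ge_max; apply/andP; split.
    rewrite -[x](subrK (o * y)); apply: vD_le.
      apply: (@le_trans _ _ t); first by rewrite le_max lexx orbT.
      by rewrite ler_peMl // le_max lexx.
    by rewrite vM ler_pM ?v_ge0 // le_max lexx orbT.
  by apply: le_trans y_t _; rewrite ler_peMl // le_max lexx.
by rewrite -vN; congr v; ring.
Qed.
Lemma imob_lipschitz o z w : chordal v (imob o z) (imob o w) <= mob_lip o * chordal v z w.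
Proof.
have m0 : 0 < Num.max 1 (v o) by rewrite lt_max ltr01.
have E w0 : hmap 1 (o *: 'X + 1) 'X w0 = (o * w0.1 + w0.2, w0.1).
  rewrite /hmap /heval !big_ord_recl !big_ord0 /= !coefD !coefZ !coefX !coef1 /=.
  by congr pair; ring.
apply: (deg1_lipschitz m0 (imob_rep o)) => [[x y]|[x y] [x' y']]; rewrite !E /nm /wedge /=.
  set t := Num.max _ (v x); have t0 : 0 <= t by rewrite le_max !v_ge0 ?orbT.
  have x_t : v x <= t by rewrite le_max lexx orbT.
  rewrite ge_max; apply/andP; split.
    by apply: le_trans x_t _; rewrite ler_peMl // le_max lexx.
  have -> : y = o * x + y - o * x by ring.
  apply: vD_le; last by rewrite vN vM ler_pM ?v_ge0 // le_max lexx orbT.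
  apply: (@le_trans _ _ t); first by rewrite le_max lexx.
  by rewrite ler_peMl // le_max lexx.
by rewrite -vN; congr v; ring.
Qed.

Lemma unif_conj (M N : P1 -> P1) (L : R) F phi z : cancel M N -> 0 < L ->
  (forall z w, chordal v (M z) (M w) <= L * chordal v z w) ->
  (forall z w, chordal v (N z) (N w) <= L * chordal v z w) ->
  unif F phi z -> unif (fun j => M \o F j \o N) (M \o phi \o N) (M z).
Proof.
move=> MK L0 lM lN [d d0 H]; exists (d / L); first by rewrite divr_gt0.
move=> e e0; have [|J HJ] := H (e / L); first by rewrite divr_gt0.
exists J => j Jj w; rewrite ltr_pdivlMr // => wz /=.
apply: le_lt_trans (lM _ _) _; rewrite mulrC -ltr_pdivlMr //; apply: HJ => //.
by rewrite -(MK z); apply: le_lt_trans (lN _ _) _; rewrite mulrC.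
Qed.
Definition conj_mob o (F : P1 -> P1) : P1 -> P1 := mob o \o F \o imob o.
Lemma iter_conj_mob o F n : iter n (conj_mob o F) = conj_mob o (iter n F).
Proof.
apply: funext => z; elim: n => [|n IH] /=; first by rewrite /conj_mob /= imobK.
by rewrite IH /conj_mob /= mobK.
Qed.
Lemma ratmap_conj_mob o F : ratmap F -> ratmap (conj_mob o F).
Proof.
move=> rF; apply: ratmap_comp; last by exists 1%N, (o *: 'X + 1), 'X; exact: imob_rep.
by apply: ratmap_comp rF; exists 1%N, 1, ('X - o%:P); exact: mob_rep.
Qed.
Lemma unif_mob o F phi z : unif (fun j => conj_mob o (F j)) (conj_mob o phi) (mob o z) <->
  unif F phi z.
Proof.
split=> h; last exact: (unif_conj (mobK o) (mob_lip_gt0 o) (mob_lipschitz o) (imob_lipschitz o) h).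
have := unif_conj (imobK o) (mob_lip_gt0 o) (imob_lipschitz o) (mob_lipschitz o) h.
have E G : imob o \o conj_mob o G \o mob o = G by apply: funext => w; rewrite /conj_mob /= !mobK.
rewrite E mobK; congr unif; apply: funext => j; exact: E.
Qed.
Lemma good_mob o g z : good (conj_mob o g) (mob o z) -> good g z.
Proof.
have E (s : nat -> nat) : (fun j => iter (s j) (conj_mob o g)) = (fun j => conj_mob o (iter (s j) g)).
  by apply: funext => j; rewrite iter_conj_mob.
case=> [[z0 [n [n0 h1 h2]]]|[s sj h]]; [left|right].
  exists (imob o z0), n; rewrite -[z0](imobK o) in h1 h2.
  have Ec : (fun=> mob o (imob o z0)) = conj_mob o (fun=> imob o z0) by [].
  by move: h1 h2; rewrite Ec (E (fun j => n * j)%N) => /unif_mob h1 /unif_mob h2.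
exists s => //; apply/(unif_mob o); rewrite -E; move: h; congr unif.
by apply: funext => w; rewrite /conj_mob /= imobK.
Qed.

(** Four cases: B is a disc or the complement of one, and o lies inside or outside the disc. A disc
    around a not containing o goes to the disc of radius r / |a - o|^2 around 1 / (a - o); one
    containing o goes to the complement of a disc of radius 1 / r around 0. *)
Lemma P1_open_ball_mob o B : P1_open_ball v B -> P1_open_ball v (mob o @` B).
Proof.
move=> [a [r [[c c0 rE] HB]]]; have r0 : 0 < r by rewrite rE v_gt0.
have bij (S T : set P1) : (forall z, T (mob o z) <-> S z) -> mob o @` S = T.
  move=> h; apply/seteqP; split=> [_ [z Sz <-]|w Tw]; first exact/h.
  by exists (imob o w); rewrite ?imobK //; apply/h; rewrite imobK.
have compl (S T : set P1) : (forall z, T (mob o z) <-> S z) -> mob o @` (~` S) = ~` T.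
  by move=> h; apply: bij => z; split=> nT /h.
have oS b t z : K_open_ball v b t (Some z) <-> v (z - b) < t.
  by split=> [[_ ? [<-]]|h] //; exists z.
have oN b t : ~ K_open_ball v b t None by case=> ? _.
have cS b t z : K_closed_ball v b t (Some z) <-> v (z - b) <= t.
  by split=> [[_ ? [<-]]|h] //; exists z.
have cN b t : ~ K_closed_ball v b t None by case=> ? _.
pose a' := a - o.
have vgV : value_group v r^-1 by exists c^-1; rewrite ?invr_eq0 // rE vV.
have vgD : a' != 0 -> value_group v (r / v a' ^+ 2).
  by move=> a'0; exists (c / a' ^+ 2); rewrite ?mulf_neq0 ?invr_eq0 ?expf_neq0 // rE vM vV vX.
have recip z : z - o != 0 -> a' != 0 ->
    v ((z - o)^-1 - a'^-1) * (v (z - o) * v a' ^+ 2) = v (z - a) * v a'.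
  move=> h1 h2; rewrite expr2 -!vM -[RHS]vN; congr v.
  have -> : z - a = (z - o) - a' by rewrite /a'; ring.
  by clearbody a'; move: (z - o) h1 => s h1; field; rewrite h1 h2.
have dist z : v (z - a) <= Num.max (v (z - o)) (v a').
  have -> : z - a = (z - o) - a' by rewrite /a'; ring.
  by rewrite -(vN a') vD.
have zo_eq z : v (z - a) < v a' -> v (z - o) = v a'.
  by move=> h; apply: vtri_eq.
have za_eq z : v a' < v (z - o) -> v (z - a) = v (z - o).
  by rewrite (vB_sym z a) (vB_sym z o) => h; apply: (@vtri_eq o).
have zo_lt z : v (z - a) < r -> v a' < r -> v (z - o) < r.
  by move=> h1 h2; apply: (vtri_lt h1 h2).
have v00 : v (0 - a'^-1) = (v a')^-1 by rewrite sub0r vN vV.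
case: HB => ->.
  have [ar|ra] := ltP (v a') r.
    exists 0, r^-1; split=> //; right; apply: bij => -[z|] /=; last first.
      by split=> [[]|/oN //]; apply/cS; rewrite subr0 v0 invr_ge0 ltW.
    have [->|zo] := eqVneq z o.
      by split=> _; [apply/oS; rewrite vB_sym|move/cN].
    have z'0 : 0 < v (z - o) by rewrite v_gt0 subr_eq0.
    split=> [h|/oS h].
      apply/oS; apply: le_lt_trans (dist z) _; rewrite gt_max ar andbT ltNge.
      apply/negP => rz; apply: h; apply/cS; rewrite subr0 vV lef_pV2 ?posrE //.
    by move/cS; rewrite subr0 vV lef_pV2 ?posrE // leNgt zo_lt.
  have a'0 : a' != 0 by rewrite -v_gt0; apply: lt_le_trans ra.
  have va0 : 0 < v a' by rewrite v_gt0.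
  exists a'^-1, (r / v a' ^+ 2); split; first exact: vgD.
  left; apply: bij => -[z|] /=; last first.
    split=> [/oS|/oN //]; rewrite v00 ltr_pdivlMr ?exprn_gt0 // expr2 mulKf ?gt_eqF //.
    by rewrite ltNge ra.
  have [->|zo] := eqVneq z o.
    by split=> [/oN //|/oS]; rewrite vB_sym ltNge ra.
  have z'0 : 0 < v (z - o) by rewrite v_gt0 subr_eq0.
  have zo' : z - o != 0 by rewrite subr_eq0.
  have Hrec := recip z zo' a'0.
  have step : (v ((z - o)^-1 - a'^-1) < r / v a' ^+ 2) = (v (z - a) * v a' < r * v (z - o)).
    by rewrite ltr_pdivlMr ?exprn_gt0 // -(ltr_pM2r z'0) -mulrA (mulrC (_ ^+ 2)) Hrec.
  split=> [/oS|/oS h]; last first.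
    by apply/oS; rewrite step (zo_eq z) ?ltr_pM2r // (lt_le_trans h).
  rewrite step => h; apply/oS; have [h1|h1] := leP (v (z - o)) (v a').
    by rewrite -(ltr_pM2r va0); apply: lt_le_trans h _; rewrite ler_pM2l.
  by move: h; rewrite za_eq // mulrC ltr_pM2r // ltNge ra.
have [ar|ra] := leP (v a') r.
  exists 0, r^-1; split=> //; left; rewrite -[K_open_ball v 0 _]setCK; apply: compl => -[z|] /=.
    have [->|zo] := eqVneq z o.
      by split=> _; [apply/cS; rewrite vB_sym|move/oN].
    have z'0 : 0 < v (z - o) by rewrite v_gt0 subr_eq0.
    split=> [h|/cS h].
      apply/cS; apply: le_trans (dist z) _; rewrite ge_max ar andbT leNgt.
      apply/negP => rz; apply: h; apply/oS; rewrite subr0 vV ltf_pV2 ?posrE //.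
    by move/oS; rewrite subr0 vV ltf_pV2 ?posrE // ltNge (vtri_le h ar).
  by split=> [[]|/cN //]; apply/oS; rewrite subr0 v0 invr_gt0.
have va0 : 0 < v a' := lt_trans r0 ra.
have a'0 : a' != 0 by rewrite -v_gt0.
exists a'^-1, (r / v a' ^+ 2); split; first exact: vgD.
right; apply: compl => -[z|] /=; last first.
  split=> [/cS|/cN //]; rewrite v00 ler_pdivlMr ?exprn_gt0 // expr2 mulKf ?gt_eqF //.
  by rewrite leNgt ra.
have [->|zo] := eqVneq z o.
  by split=> [/cN //|/cS]; rewrite vB_sym leNgt ra.
have z'0 : 0 < v (z - o) by rewrite v_gt0 subr_eq0.
have zo' : z - o != 0 by rewrite subr_eq0.
have Hrec := recip z zo' a'0.
have step : (v ((z - o)^-1 - a'^-1) <= r / v a' ^+ 2) = (v (z - a) * v a' <= r * v (z - o)).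
  by rewrite ler_pdivlMr ?exprn_gt0 // -(ler_pM2r z'0) -mulrA (mulrC (_ ^+ 2)) Hrec.
split=> [/cS|/cS h]; last first.
  by apply/cS; rewrite step (zo_eq z) ?ler_pM2r // (le_lt_trans h).
rewrite step => h; apply/cS; have [h1|h1] := leP (v (z - o)) (v a').
  by rewrite -(ler_pM2r va0); apply: le_trans h _; rewrite ler_pM2l.
by move: h; rewrite za_eq // mulrC ler_pM2r // leNgt ra.
Qed.

Lemma affinoid_rep_mob o n (B : 'I_n.+1 -> set P1) (X : set P1) : affinoid_rep B X ->
  affinoid_rep (fun i => mob o @` B i) (mob o @` X).
Proof.
move=> [bB ->]; split=> [i|]; first exact: P1_open_ball_mob.
apply/seteqP; split=> [_ [z Xz <-] i _|w Xw]; first by exists z => //; apply: Xz.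
exists (imob o w); rewrite ?imobK // => i _; have [z Bz <-] := Xw i I.
by rewrite mobK.
Qed.

(** Infinitude of A, in the form in which new members are drawn from it. *)
Definition unlisted (A : set P1) := forall l : seq P1, exists2 a, A a & a \notin l.
Lemma unlisted_seq A m (l : seq P1) : unlisted A -> exists s : seq P1,
  [/\ size s = m, uniq s & forall a, a \in s -> A a /\ a \notin l].
Proof.
move=> uA; elim: m => [|m [s [sm us sA]]]; first by exists [::].
have [a Aa] := uA (s ++ l); rewrite mem_cat negb_or => /andP[as_ al].
exists (a :: s); split=> /=; rewrite ?sm ?as_ // => b; rewrite inE => /orP[/eqP ->|/sA] //.
Qed.

(** One omitted value o is sent to infinity, which makes all G_j finite on X; n + 3 further ones
    become the a_i of [vitali_affine]. *)
Lemma vitali n (B : 'I_n.+1 -> set P1) (X A : set P1) (G : nat -> P1 -> P1) phi x y :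
  affinoid_rep B X -> X x -> X y -> unlisted A -> (forall j, ratmap (G j)) ->
  (forall a, A a -> ~ X a /\ forall j z, X z -> G j z <> a) ->
  (phi = id \/ exists z0, phi = fun=> z0) ->
  unif G phi x -> unif G phi y.
Proof.
move=> rX Xx Xy uA rG omit phiE hx.
(* The value of phi if it is constant; the omitted values are chosen different from it, so that its
   image is finite and not among the a_i. *)
pose z0 := phi None.
have [ o Ao] := uA [:: None; z0].
rewrite !inE negb_or => /andP[].
case: o Ao => [ o|] // Ao _ oz0.
have [s [sn us sA]] := unlisted_seq n.+3 [:: Some o; z0] uA.
have s_fin (b : P1) : b \in s -> exists c, mob o b = Some c.
  move=> /sA [_]; rewrite !inE negb_or => /andP[+ _]; case: b => [b|] /=; last by exists 0.
  have [->|bo _] := eqVneq b o; first by rewrite eqxx.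
  by exists (b - o)^-1.
pose a (i : 'I_n.+3) := odflt 0 (mob o (nth None s i)).
have si (i : 'I_n.+3) : nth None s i \in s by rewrite mem_nth // sn.
have aE (i : 'I_n.+3) : mob o (nth None s i) = Some (a i).
  by rewrite /a; have [c ->] := s_fin _ (si i).
have a_inj : injective a.
  move=> i j aij; apply/val_inj/eqP; have /eqP : mob o (nth None s i) = mob o (nth None s j).
    by rewrite !aE aij.
  by rewrite (can_eq (mobK o)) nth_uniq ?sn.
have Xfin z : X z -> exists c, mob o z = Some c.
  move=> Xz; case: z Xz => [z|] Xz /=; last by exists 0.
  have [zo|_] := eqVneq z o; last by exists (z - o)^-1.
  by case: (omit _ Ao); rewrite -zo.
have [x' Ex] := Xfin x Xx; have [y' Ey] := Xfin y Xy.
apply/(unif_mob o); rewrite Ey; move/(unif_mob o): hx; rewrite Ex.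
have rX' := affinoid_rep_mob o rX.
have X'N : ~ (mob o @` X) None by move=> [z /Xfin [c ->]].
have X'x : (mob o @` X) (Some x') by exists x.
have X'y : (mob o @` X) (Some y') by exists y.
have omit' j z : (mob o @` X) z -> conj_mob o (G j) z <> None /\
    forall i, conj_mob o (G j) z <> Some (a i).
  move=> [w Xw <-]; rewrite /conj_mob /= mobK.
  split=> [E|i]; last first.
    rewrite -aE => /(can_inj (mobK o)) h.
    by have [_ /(_ j w Xw)] := omit _ (proj1 (sA _ (si i))); rewrite h.
  have [_ /(_ j w Xw)] := omit _ Ao; apply; apply: (can_inj (mobK o)).
  by rewrite E /= eqxx.
have rG' j : ratmap (conj_mob o (G j)) := ratmap_conj_mob o (rG j).
case: phiE => [E|[w E]].
  have Ec : conj_mob o phi = id by apply: funext => z; rewrite E /conj_mob /= imobK.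
  rewrite Ec.
  apply: (@vitali_affine _ _ _ _ _ id 'X x' y' rX' X'N X'x X'y a_inj rG' omit').
  - by move=> z; rewrite hornerX.
  - move=> i; rewrite hornerX; apply/eqP => xa; have : (mob o @` X) (Some (a i)) by rewrite -xa.
    move=> [z Xz]; rewrite -aE => /(can_inj (mobK o)) zs.
    by have [+ _] := omit _ (proj1 (sA _ (si i))); rewrite -zs.
  - by have [M HM] := affinoid_bounded rX' X'N; exists M => z; rewrite hornerX; apply: HM.
have zw : z0 = w by rewrite /z0 E.
have [c Ew] : exists c, mob o w = Some c.
  case: (w) oz0 zw => [w'|] oz0 zw /=; last by exists 0.
  have [wo|_] := eqVneq w' o; last by exists (w' - o)^-1.
  by move: oz0; rewrite zw wo eqxx.
have Ec : conj_mob o phi = fun=> Some c by apply: funext => z; rewrite E /conj_mob /= Ew.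
rewrite Ec.
apply: (@vitali_affine _ _ _ _ _ (fun=> Some c) c%:P x' y' rX' X'N X'x X'y a_inj rG' omit').
- by move=> z; rewrite hornerC.
- move=> i; rewrite hornerC; apply/eqP => ca.
  have /(can_inj (mobK o)) ws : mob o w = mob o (nth None s i) by rewrite aE Ew ca.
  by have [_] := sA _ (si i); rewrite -ws !inE zw eqxx orbT.
- by exists (v c) => z _; rewrite hornerC.
Qed.

(** * Residue classes over finite fields *)

Lemma coef_prod_le (s : seq K) i :
  v (\prod_(a <- s) ('X - a%:P))`_i <= \prod_(a <- s) Num.max 1 (v a).
Proof.
elim: s i => [|a s IH] i; first by rewrite !big_nil coef1; case: (i == 0)%N; rewrite ?v1 ?v0 ?ler01.
rewrite !big_cons mulrBl coefB mul_polyC coefZ coefXM.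
have M0 : 0 <= \prod_(j <- s) Num.max 1 (v j) by apply: prodr_ge0 => j _; rewrite le_max ler01.
apply: vD_le.
  case: ifP => _; first by rewrite v0 mulr_ge0 // le_max ler01.
  by apply: le_trans (IH _) _; rewrite ler_peMl // le_max lexx.
by rewrite vN vM ler_pM ?v_ge0 // le_max lexx orbT.
Qed.
(** Cauchy's estimate, read off at a generic point of the unit disc, where |S| is the Gauss norm. *)
Lemma coef_le_disc (S : {poly K}) M : (forall z, v z <= 1 -> v S.[z] <= M) ->
  forall i, v S`_i <= M.
Proof.
move=> H i; have [z z1 zl] := @generic_point 0 1 (rts S) (oner_neq0 _).
rewrite v1 subr0 in z1 zl; apply: le_trans (H z z1).
rewrite (@v_generic S 0 1) ?subr0 // /nrm [in leLHS](rtsE S) coefZ vM.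
rewrite ler_wpM2l ?v_ge0 //; apply: le_trans (coef_prod_le _ _) _.
by rewrite le_eqVlt; apply/orP; left; apply/eqP/eq_bigr => a _; rewrite sub0r vN.
Qed.

Lemma v_sum_lt (I : Type) (s : seq I) (F : I -> K) e : 0 < e -> (forall i, v (F i) < e) ->
  v (\sum_(i <- s) F i) < e.
Proof.
move=> e0 H; elim: s => [|i s IH]; first by rewrite big_nil v0.
by rewrite big_cons; apply: vD_lt.
Qed.

(** The inner binomial coefficients are divisible by p, so Frobenius is additive modulo the maximal
    ideal. *)
Lemma frobenius_add (x y : K) k : v x <= 1 -> v y <= 1 ->
  v ((x + y) ^+ (p ^ k) - (x ^+ (p ^ k) + y ^+ (p ^ k))) < 1.
Proof.
have base u w : v u <= 1 -> v w <= 1 -> v ((u + w) ^+ p - (u ^+ p + w ^+ p)) < 1.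
  move=> u1 w1; rewrite exprDn -(prednK (prime_gt0 p_prime)); set m := p.-1.
  rewrite big_ord_recl big_ord_recr /= bin0 subn0 expr0 mulr1 mulr1n.
  rewrite /bump /= add1n subnn expr0 mul1r binn mulr1n.
  rewrite [X in v X](_ : _ = \sum_(i < m) u ^+ (m.+1 - (1 + i)) * w ^+ (1 + i) *+ 'C(m.+1, 1 + i)); last by ring.
  apply: v_sum_lt => // i; rewrite add1n -mulr_natr.
  have /dvdnP[q ->] : (p %| 'C(m.+1, i.+1))%N.
    have pE : m.+1 = p := prednK (prime_gt0 p_prime).
    by rewrite {1}pE prime_dvd_bin // ?p_prime // /= -pE ltnS ltn_ord.
  rewrite natrM mulrA vM; apply: le_lt_trans v_p; rewrite ler_piMl ?v_ge0 // !vM !vX.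
  by rewrite !mulr_ile1 ?mulr_ge0 ?exprn_ge0 ?exprn_ile1 ?v_ge0 ?v_nat_le1.
move=> x1 y1; elim: k => [|k IH]; first by rewrite expn0 !expr1 subrr v0.
have le1 u n : v u <= 1 -> v (u ^+ n) <= 1 by move=> u1; rewrite vX exprn_ile1 ?v_ge0.
rewrite expnSr !exprM; set X := (x + y) ^+ _ in IH *; set Y := x ^+ _ + _ in IH *.
have Y1 : v Y <= 1 by apply: vD_le; apply: le1.
have X1 : v X <= 1 by apply: le1; apply: vD_le.
apply: (@vtri_lt (Y ^+ p)); last by apply: base; apply: le1.
have D1 : v (X - Y) <= 1 by apply: vD_le; rewrite ?vN.
have := base _ _ D1 Y1; rewrite subrK => h.
have -> : X ^+ p - Y ^+ p = (X ^+ p - ((X - Y) ^+ p + Y ^+ p)) + (X - Y) ^+ p by ring.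
apply: vD_lt => //; rewrite vX -(prednK (prime_gt0 p_prime)) exprS.
by apply: le_lt_trans IH; rewrite ler_piMr ?v_ge0 // exprn_ile1 ?v_ge0.
Qed.

(** z is integral and its reduction lies in the field of q elements, where q is a power of p. *)
Definition fixed_residue q (z : K) := v z <= 1 /\ v (z ^+ q - z) < 1.
Section Residue.
Variable k : nat.
Local Notation q := (p ^ k)%N.
Lemma fixed_residueD x y : fixed_residue q x -> fixed_residue q y -> fixed_residue q (x + y).
Proof.
move=> [x1 hx] [y1 hy]; split; first exact: vD_le.
apply: (@vtri_lt (x ^+ q + y ^+ q)); first exact: frobenius_add.
by rewrite opprD addrACA; apply: vD_lt.
Qed.
Lemma fixed_residueM x y : fixed_residue q x -> fixed_residue q y -> fixed_residue q (x * y).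
Proof.
move=> [x1 hx] [y1 hy]; split; first by rewrite vM mulr_ile1 ?v_ge0.
have -> : (x * y) ^+ q - x * y = x ^+ q * (y ^+ q - y) + (x ^+ q - x) * y.
  by rewrite exprMn; ring.
by apply: vD_lt; rewrite vM ?vX; [apply: le_lt_trans hy|apply: le_lt_trans hx];
  rewrite ?ler_piMl ?ler_piMr ?v_ge0 ?exprn_ile1 ?v_ge0.
Qed.
Lemma fixed_residue0 : fixed_residue q 0.
Proof.
split; first by rewrite v0.
by rewrite subr0 expr0n expn_eq0 eqn0Ngt (prime_gt0 p_prime) /= v0.
Qed.
Lemma fixed_residueV x : v x = 1 -> fixed_residue q x -> fixed_residue q x^-1.
Proof.
move=> x1 [_ hx]; have x0 : x != 0 by rewrite -v_gt0 x1.
split; first by rewrite vV x1 invr1.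
have -> : x^-1 ^+ q - x^-1 = - (x ^+ q - x) / (x ^+ q * x).
  by rewrite exprVn; have xq := expf_neq0 q x0; field; rewrite x0.
by rewrite vM vN vV vM vX x1 expr1n mulr1 invr1 mulr1.
Qed.
Lemma fixed_residue_horner (S : {poly K}) z : (forall i, fixed_residue q S`_i) ->
  fixed_residue q z -> fixed_residue q S.[z].
Proof.
move=> hS hz; rewrite horner_coef.
have hX i : fixed_residue q (z ^+ i.+1).
  by elim: i => [|i IH]; rewrite ?expr1 // exprS; apply: fixed_residueM.
have h1 : fixed_residue q 1 by split; rewrite ?v1 // expr1n subrr v0.
elim/big_ind: _ => [|x y|[i ?] _ /=]; [exact: fixed_residue0|exact: fixed_residueD|].
by apply: fixed_residueM => //; case: (i) => [|i'].
Qed.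
End Residue.
Lemma fixed_residue_pow k m z : fixed_residue (p ^ k) z -> fixed_residue (p ^ (k * m)) z.
Proof.
move=> [z1 hz]; split=> //; elim: m => [|m IH]; first by rewrite muln0 expn0 expr1 subrr v0.
rewrite mulnS addnC expnD exprM; set w := z ^+ (p ^ (k * m)) in IH *.
have w1 : v w <= 1 by rewrite vX exprn_ile1 ?v_ge0.
apply: (@vtri_lt (z ^+ (p ^ k))) => //.
have D1 : v (w - z) <= 1 by exact: ltW.
have := frobenius_add k D1 z1; rewrite subrK => h.
have -> : w ^+ (p ^ k) - z ^+ (p ^ k) =
  (w ^+ (p ^ k) - ((w - z) ^+ (p ^ k) + z ^+ (p ^ k))) + (w - z) ^+ (p ^ k) by ring.
apply: vD_lt => //; rewrite vX; have pk : (0 < p ^ k)%N by rewrite expn_gt0 (prime_gt0 p_prime).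
rewrite -(prednK pk) exprS; apply: le_lt_trans IH; rewrite ler_piMr ?v_ge0 //.
by rewrite exprn_ile1 ?v_ge0.
Qed.
Lemma common_residue (s : seq K) : (forall z, z \in s -> v z <= 1) ->
  exists2 k, (0 < k)%N & forall z, z \in s -> fixed_residue (p ^ k) z.
Proof.
elim: s => [|a s IH] H; first by exists 1%N.
have [z zs|k k0 hk] := IH; first by apply: H; rewrite inE zs orbT.
have a1 : v a <= 1 by apply: H; rewrite inE eqxx.
have [k' k'0 hk'] := v_res a1; exists (k * k')%N; first by rewrite muln_gt0 k0.
move=> z; rewrite inE => /orP[/eqP ->|zs]; last exact/fixed_residue_pow/hk.
by rewrite mulnC; apply: fixed_residue_pow.
Qed.
(** |u^q - u| is the product of the distances from u to the finitely many roots of X^q - X, so each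
    u i is at distance below 1 from one of them. *)
Lemma fixed_residue_pigeonhole k (u : nat -> K) : (0 < k)%N ->
  (forall i, fixed_residue (p ^ k) (u i)) -> exists i j, (i < j)%N /\ v (u i - u j) < 1.
Proof.
move=> k0 H; pose q := (p ^ k)%N; have q1 : (1 < q)%N.
  by rewrite /q -{1}(expn0 p) ltn_exp2l ?(prime_gt1 p_prime).
pose S : {poly K} := 'X^q - 'X; have SE z : S.[z] = z ^+ q - z by rewrite /S hornerD hornerN hornerXn hornerX.
have sS : size S = q.+1 by rewrite size_polyDl ?size_polyXn // size_polyN size_polyX ltnS.
have lS : v (lead_coef S) = 1.
  by rewrite lead_coefDl ?lead_coefXn ?v1 // size_polyN size_polyX size_polyXn ltnS.
have near i : exists a, a \in rts S /\ v (u i - a) < 1.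
  apply: contrapT => h; have [u1] := H i; rewrite -SE v_horner lS mul1r ltNge => /negP; apply.
  elim: (rts S) h => [|a s IH] h; first by rewrite big_nil.
  rewrite big_cons -[leLHS]mulr1; apply: ler_pM => //.
    by rewrite leNgt; apply/negP => ha; apply: h; exists a; rewrite inE eqxx.
  by apply: IH => -[b [bs hb]]; apply: h; exists b; rewrite inE bs orbT.
pose a i := xget 0 [set a | a \in rts S /\ v (u i - a) < 1].
have aP i : a i \in rts S /\ v (u i - a i) < 1 by exact: (xgetPex 0 (near i)).
pose m := size (rts S); pose l := [seq a i | i <- iota 0 m.+1].
have : ~~ uniq l.
  apply/negP => ul; have := uniq_leq_size ul (s2 := rts S); rewrite size_map size_iota ltnn.
  by move=> h; apply/notF/h => z /mapP[i _ ->]; case: (aP i).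
have sl : size l = m.+1 by rewrite size_map size_iota.
move=> /(uniqPn 0) [i [j [ij jm]]]; rewrite sl in jm.
rewrite !(nth_map 0%N) ?size_iota ?(ltn_trans ij) // !nth_iota ?(ltn_trans ij) // !add0n => E.
exists i, j; split=> //; apply: (@vtri_lt (a i)); first by case: (aP i).
by rewrite vB_sym E; case: (aP j).
Qed.

(** * Existence of an attracted or recurrent point *)

(** The Gauss norm is piecewise monomial in the radius (Newton polygon); the exponent counts the
    roots at distance at most t0 from e. *)
Lemma nrm_right (S : {poly K}) e (t0 : R) : S != 0 -> 0 < t0 -> exists k q t1,
  [/\ q != 0, t0 < t1 & forall t, t0 <= t -> t < t1 -> nrm S e t = v q * t ^+ k].
Proof.
move=> S0 t00; rewrite /nrm.
suff [k [q [t1 [q0 t01 H]]]] : exists k q t1, [/\ q != 0, t0 < t1 & forall t, t0 <= t -> t < t1 ->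
    \prod_(a <- rts S) Num.max t (v (e - a)) = v q * t ^+ k].
  exists k, (lead_coef S * q), t1; split=> //; first by rewrite mulf_neq0 ?lead_coef_eq0.
  by move=> t h1 h2; rewrite H // vM mulrA.
elim: (rts S) => [|a s [k [q [t1 [q0 t01 H]]]]].
  by exists 0%N, 1, (t0 + 1); rewrite oner_neq0 ltrDl ltr01; split=> // t _ _; rewrite big_nil v1 mul1r.
have [h|h] := leP (v (e - a)) t0.
  exists k.+1, q, t1; split=> // t h1 h2; rewrite big_cons H // max_l ?exprS ?(le_trans h) //.
  by rewrite mulrCA.
exists k, ((e - a) * q), (Num.min t1 (v (e - a))); split.
- by rewrite mulf_neq0 // -v_gt0 (lt_trans t00).
- by rewrite lt_min t01.
move=> t h1; rewrite lt_min => /andP[h2 h3]; rewrite big_cons H // max_r ?(ltW h3) //.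
by rewrite vM mulrA.
Qed.

Lemma good_iter g m z : (0 < m)%N -> good (iter m g) z -> good g z.
Proof.
move=> m0; have itM n : iter n (iter m g) = iter (m * n) g.
  by apply: funext => w; elim: n => [|n IH]; rewrite ?muln0 // mulnS iterD -IH.
case=> [[z0 [n [n0 h1 h2]]]|[s sj h]]; [left|right].
  exists z0, (m * n)%N; rewrite muln_gt0 m0 n0.
  have E : (fun j => iter (n * j) (iter m g)) = (fun j => iter (m * n * j) g).
    by apply: funext => j; rewrite itM mulnA.
  by rewrite -E.
exists (fun j => m * s j)%N => [j|]; first by rewrite (leq_trans (sj j)) // leq_pmull.
by move: h; congr unif; apply: funext => j; rewrite itM.
Qed.

Lemma count_ltn (p1 p2 : pred K) s x : (forall a, p1 a -> p2 a) -> x \in s -> p2 x -> ~~ p1 x ->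
  (count p1 s < count p2 s)%N.
Proof.
move=> sub + p2x np1; elim: s => [|a s IH] //=; rewrite inE => /orP[/eqP <-|/IH lt].
  by rewrite p2x (negbTE np1) add0n add1n ltnS; apply: sub_count.
by rewrite -addnS leq_add //; case: (p1 a) (sub a) => // ->.
Qed.

Section GoodPoint.
Variables (d : nat) (P Q : {poly K}) (g : P1 -> P1) (V : set P1).
Hypothesis rF : rat_rep d P Q g.
Hypothesis VN : ~ V None.
Hypothesis Vg : forall z, V z -> V (g z).
(* V contains almost all residue classes of the disc |z - e| <= |c|. *)
Definition generic_in e c := exists l : seq K, forall z, v (z - e) <= v c ->
  (forall b, b \in l -> v c <= v (z - b)) -> V (Some z).
(** Provided later by [orbits_generic]; this is how the structure of V as a union of images of an
    affinoid enters. *)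
Hypothesis Vsep : forall e c w1 w2, c != 0 -> V (Some w1) -> V (Some w2) ->
  v (w1 - e) <= v c -> v c <= v (w1 - w2) -> generic_in e c.
Definition has_good := exists2 z, V z & good g z.
Let h z := P.[z] / Q.[z].
(** Divided by [nrm Q e (v c)] it is |g - a| at the Gauss point of the disc. *)
Let N a e c := nrm (P - a *: Q) e (v c).

Let V_fin z : V (Some z) -> [/\ Q.[z] != 0, g (Some z) = Some (h z) & V (Some (h z))].
Proof.
move=> Vz; have := Vg Vz; rewrite (ratE rF); case: eqP => [_ /VN //|/eqP q0].
by split.
Qed.
Let vh z a : Q.[z] != 0 -> v (h z - a) * v Q.[z] = v (P - a *: Q).[z].
Proof.
by move=> q0; rewrite -vM mulrBl /h divfK // hornerD hornerN hornerZ.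
Qed.
Let generic_pt e c (l : seq K) : c != 0 -> generic_in e c -> exists z,
  [/\ v (z - e) <= v c, forall a, a \in l -> v c <= v (z - a) & V (Some z)].
Proof.
move=> c0 [l' H]; have [z ze zl] := generic_point e (l ++ l') c0; exists z; split=> //.
  by move=> a al; apply: zl; rewrite mem_cat al.
by apply: H => // b bl; apply: zl; rewrite mem_cat bl orbT.
Qed.
Let generic_image e c a (l : seq K) : c != 0 -> generic_in e c -> exists z,
  [/\ V (Some z), forall b, b \in l -> v c <= v (z - b) &
      v (h z - a) * nrm Q e (v c) = N a e c].
Proof.
move=> c0 H; have [z [ze zl Vz]] := generic_pt (l ++ rts Q ++ rts (P - a *: Q)) c0 H.
have [q0 _ _] := V_fin Vz; exists z; split=> //.
  by move=> b bl; apply: zl; rewrite mem_cat bl.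
rewrite -(v_generic (z := z) ze) ?vh //; last first.
  by move=> b bl; apply: zl; rewrite !mem_cat bl orbT.
by apply: v_generic => // b bl; apply: zl; rewrite !mem_cat bl !orbT.
Qed.
Let generic_recenter e e' c : v (e - e') <= v c -> generic_in e c -> generic_in e' c.
Proof.
move=> ee [l H]; exists l => z ze; apply: H; apply: (@vtri_le e') => //.
by rewrite vB_sym.
Qed.
Let N_shift a b e c : c != 0 -> N a e c <= Num.max (N b e c) (v (a - b) * nrm Q e (v c)).
Proof.
move=> c0; rewrite /N -(vN (a - b)) -(nrmZ _ _ _ c0).
have -> : P - a *: Q = (P - b *: Q) + (- (a - b)) *: Q.
  by rewrite scaleNr scalerBl opprB addrA subrK.
exact: nrmD.
Qed.
Let N_recenter a e e' c : v (e - e') <= v c -> N a e c = N a e' c.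
Proof. exact: nrm_recenter. Qed.

(* At the Gauss point of the disc |z - e| <= |c| one has |g - e| < |c|,
   respectively |g - e| <= |c|. *)
Definition shrinking e c :=
  [/\ c != 0, generic_in e c & nrm (P - e *: Q) e (v c) < v c * nrm Q e (v c)].
Definition stable e c :=
  [/\ c != 0, generic_in e c & nrm (P - e *: Q) e (v c) <= v c * nrm Q e (v c)].

(** Without poles |Q| is constant on the open disc, so |g - e| is bounded there by its value at the
    Gauss point, which is below |c|. The image of a generic point is a point of V in this invariant
    disc. *)
Let shrinking_nopole e c : shrinking e c -> (forall a, v (a - e) < v c -> ~~ root Q a) -> has_good.
Proof.
move=> [c0 He Hn] np; have [z [Vz _ Hz]] := generic_image e [::] c0 He.
have Q0 : 0 < nrm Q e (v c).
  by rewrite -(pmulr_rgt0 _ (_ : 0 < v c)) ?v_gt0 //; apply: le_lt_trans Hn; apply: nrm_ge0.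
have [_ _ Vh] := V_fin Vz; exists (Some (h z)) => //.
apply: (ball_good rF np); last by rewrite -(ltr_pM2r Q0) Hz.
move=> w we; have qw : Q.[w] != 0 by exact: np.
have vq : v Q.[w] = nrm Q e (v c) by apply: v_noroot.
rewrite -(ltr_pM2r Q0) -{1}vq -/(h w) vh //; apply: le_lt_trans Hn; exact/v_le_nrm/ltW.
Qed.

(** z represents a residue class contained in V; it has no pole, as V is invariant and omits
    infinity. *)
Let dir e c z := v (z - e) <= v c /\ forall z', v (z' - z) < v c -> V (Some z').
Let dirP e c z : stable e c -> dir e c z -> [/\ Q.[z] != 0, v Q.[z] = nrm Q e (v c),
  v (h z - e) <= v c & forall z', v (z' - z) < v c -> ~~ root Q z'].
Proof.
move=> [c0 _ Hn] [ze Hz]; have vc : 0 < v c by rewrite v_gt0.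
have np z' : v (z' - z) < v c -> ~~ root Q z'.
  by move=> /Hz Vz'; apply/negP => /(rat_pole rF) E; have := Vg Vz'; rewrite E.
have zz : v (z - z) < v c by rewrite subrr v0.
have q0 : Q.[z] != 0 by exact: np.
have vq : v Q.[z] = nrm Q e (v c).
  by rewrite (@v_noroot Q z (v c) z) // (nrm_recenter Q ze).
split=> //; have Q0 : 0 < nrm Q e (v c) by rewrite -vq v_gt0.
by rewrite -(ler_pM2r Q0) -{1}vq vh //; apply: le_trans Hn; apply: v_le_nrm.
Qed.
(** A point u of the target class outside V would be omitted on the class of z, so |g - u| would be
    |h z - u| < |c| at the Gauss point; then |g - h z| would be below |c| too, against the
    assumption. *)
Let dir_map e c z : stable e c -> dir e c z ->
  v c * nrm Q e (v c) <= N (h z) e c -> dir e c (h z).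
Proof.
move=> st dz hN; have [q0 vq he np] := dirP st dz; split=> // u uw.
have [c0 _ _] := st; have vc : 0 < v c by rewrite v_gt0.
have Q0 : 0 < nrm Q e (v c) by rewrite -vq v_gt0.
apply: contrapT => nVu; have [ze Vz] := dz.
have zz : v (z - z) < v c by rewrite subrr v0.
have nr a : v (a - z) < v c -> ~~ root (P - u *: Q) a.
  by move=> /Vz Va; apply/negP => /(rat_fiber rF) E; apply: nVu; rewrite -E; apply: Vg.
have := v_noroot nr zz; rewrite -vh // vq (nrm_recenter _ ze) -/(N _ _ _) => E.
have := N_shift (h z) u e c0; rewrite -E vB_sym maxxx leNgt => /negP; apply.
by apply: lt_le_trans hN; rewrite ltr_pM2r.
Qed.
(** Schwarz' lemma on the class of z, where |g - h z| <= |c|. *)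
Let dir_disc e c z : stable e c -> dir e c z -> forall z', v (z' - z) < v c -> v (h z' - h z) < v c.
Proof.
move=> st dz z' z'z; have [q0 vq he np] := dirP st dz.
have [c0 _ Hn] := st; have vc : 0 < v c by rewrite v_gt0.
have q0' : Q.[z'] != 0 by exact: np.
have : root (P - h z *: Q) z.
  by rewrite rootE hornerD hornerN hornerZ /h divfK // subrr.
move=> /factor_theorem[T TE].
have Q0 : 0 < nrm Q e (v c) by rewrite -vq v_gt0.
have zz : v (z - z) < v c by rewrite subrr v0.
have [ze _] := dz.
have vq' a : v (a - z) < v c -> v Q.[a] = nrm Q e (v c).
  by move=> az; rewrite (@v_noroot Q z (v c) a) // (nrm_recenter Q ze).
have M : forall a, v (a - z) < v c -> v (P - h z *: Q).[a] <= v c * v Q.[a].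
  move=> a az; rewrite vq' //; apply: (@le_trans _ _ (N (h z) e c)).
    by apply: v_le_nrm; apply: (@vtri_le z) => //; apply: ltW.
  apply: le_trans (N_shift _ e e c0) _; rewrite ge_max Hn /=.
  by rewrite ler_pM2r.
have := schwarz vc zz np M TE z'z; rewrite mulrC ler_pM2l // => hT.
have vq0 : 0 < v Q.[z'] by rewrite v_gt0.
rewrite -(ltr_pM2r vq0) vh // TE hornerM vM hornerXsubC mulrC.
by apply: (@le_lt_trans _ _ (v (z' - z) * v Q.[z'])); rewrite ?ler_wpM2l ?v_ge0 // ltr_pM2r.
Qed.

(* Either some residue class contained in V is contracted, or g permutes these
   classes through a rational map over the residue field; all its
   coefficients and one starting direction lie in a finite field, whence a
   periodic direction. *)
Let stable_step e c : stable e c -> has_good \/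
  exists w, [/\ shrinking w c, v (w - e) <= v c & N w e c < v c * nrm Q e (v c)].
Proof.
move=> st; have [c0 He Hn] := st; have vc : 0 < v c by rewrite v_gt0.
have [[z [dz hz]]|nA] := pselect (exists z, dir e c z /\ N (h z) e c < v c * nrm Q e (v c)).
  right; exists (h z); have [_ _ he _] := dirP st dz; split=> //; split=> //.
    by apply: generic_recenter He; rewrite vB_sym.
  by rewrite -/(N _ _ _) -(N_recenter (h z) (e := e)) 1?vB_sym // -(nrm_recenter Q (e := e)) 1?vB_sym.
left; have step z : dir e c z -> dir e c (h z).
  move=> dz; apply: (dir_map st dz); rewrite leNgt; apply/negP => hz; apply: nA.
  by exists z.
have [z0 dz0] : exists z, dir e c z.
  have [l Hl] := He; have [z ze zl] := generic_point e l c0; exists z; split=> // z' z'z.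
  apply: Hl => [|b bl]; first by apply: (@vtri_le z) => //; apply: ltW.
  by rewrite (@vtri_eq z) ?zl // (lt_le_trans z'z) ?zl.
pose u i := iter i h z0; have du i : dir e c (u i) by elim: i => //= i; apply: step.
(* In the coordinate y with z = c y + e the map becomes Pt / Qt; the factor 1 / kap makes both
   polynomials integral and gives |Qt| = 1 along the orbit. *)
pose kap := c * Q.[z0]; have [q00 vq0 _ _] := dirP st dz0.
have kap0 : kap != 0 by rewrite mulf_neq0.
have vkap : v kap = v c * nrm Q e (v c) by rewrite vM vq0.
pose A : {poly K} := c *: 'X + e%:P.
have AE y : A.[y] = c * y + e by rewrite /A hornerD hornerZ hornerX hornerC.
pose Pt := kap^-1 *: ((P - e *: Q) \Po A); pose Qt := (kap^-1 * c) *: (Q \Po A).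
have A_disc y : v y <= 1 -> v (A.[y] - e) <= v c.
  by move=> y1; rewrite AE addrK vM ler_piMr ?v_ge0.
have Pt1 i : v Pt`_i <= 1.
  move: i; apply: coef_le_disc => y /A_disc ye; rewrite /Pt hornerZ horner_comp vM vV.
  rewrite mulrC ler_pdivrMr ?v_gt0 // mul1r vkap; apply: le_trans Hn; exact: v_le_nrm.
have Qt1 i : v Qt`_i <= 1.
  move: i; apply: coef_le_disc => y /A_disc ye; rewrite /Qt hornerZ horner_comp !vM vV.
  rewrite -mulrA mulrC ler_pdivrMr ?v_gt0 // mul1r vkap ler_pM2l //; exact: v_le_nrm.
pose ze i := (u i - e) / c.
have zE i : A.[ze i] = u i by rewrite AE /ze mulrC divfK // subrK.
have ze1 i : v (ze i) <= 1.
  by rewrite vM vV ler_pdivrMr // mul1r; case: (du i).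
have [|k k0 Hk] := @common_residue (ze 0%N :: (Pt : seq K) ++ (Qt : seq K)).
  move=> z; rewrite inE mem_cat => /orP[/eqP -> //|/orP[] /(nthP 0) [i _ <-]] //.
have hPt i : fixed_residue (p ^ k) Pt`_i.
  have [lt|ge] := ltnP i (size Pt); last by rewrite nth_default //; apply: fixed_residue0.
  by apply: Hk; rewrite inE mem_cat mem_nth ?orbT.
have hQt i : fixed_residue (p ^ k) Qt`_i.
  have [lt|ge] := ltnP i (size Qt); last by rewrite nth_default //; apply: fixed_residue0.
  by apply: Hk; rewrite inE mem_cat mem_nth ?orbT.
have hze i : fixed_residue (p ^ k) (ze i).
  elim: i => [|i IH]; first by apply: Hk; rewrite inE eqxx.
  have [qi vqi _ _] := dirP st (du i).
  have QtE : Qt.[ze i] = kap^-1 * c * Q.[u i] by rewrite /Qt hornerZ horner_comp zE.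
  have -> : ze i.+1 = Pt.[ze i] * (Qt.[ze i])^-1.
    rewrite QtE /Pt hornerZ horner_comp zE hornerD hornerN hornerZ /ze /u iterS -/(u i) /h.
    by field; rewrite c0 kap0 qi.
  apply: fixed_residueM; first exact: fixed_residue_horner.
  apply: fixed_residueV; last exact: fixed_residue_horner.
  by rewrite QtE !vM vV vqi vkap -mulrA mulVf // mulf_neq0 ?gt_eqF // -vqi v_gt0.
have [i [j [ij hij]]] := fixed_residue_pigeonhole k0 hze.
have uij : v (u j - u i) < v c.
  have E : ze i - ze j = (u i - u j) / c by rewrite /ze -mulrBl; congr (_ / c); ring.
  by rewrite vB_sym; move: hij; rewrite E vM vV ltr_pdivrMr // mul1r.
pose m := (j - i)%N; have m0 : (0 < m)%N by rewrite subn_gt0.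
have itm n z : v (z - u i) < v c -> [/\ iter n g (Some z) = Some (iter n h z),
    v (iter n h z - u (i + n)%N) < v c & V (Some (iter n h z))].
  move=> zi; elim: n => [|n [E1 E2 E3]].
    by rewrite addn0; split=> //; case: (du i) => _; apply.
  have [qn gn Vn] := V_fin E3; rewrite !iterS E1 gn addnS /u iterS -/(u _); split=> //.
  exact: (dir_disc st (du _)).
(* g^m maps the class of u i into itself, so [ball_good] applies to this iterate. *)
have [d' [P' [Q' rF']]] := ratmap_iter m (ex_intro _ d (ex_intro _ P (ex_intro _ Q rF))).
have uii : v (u i - u i) < v c by rewrite subrr v0.
exists (Some (u i)); first by case: (du i) => _; apply.
apply: (good_iter m0); apply: (ball_good rF' (c := u i) (rho := v c)) => // z zi;
  have [E1 E2 _] := itm m z zi.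
  by apply/negP => /(rat_pole rF'); rewrite E1.
move: E1; rewrite (ratE rF'); case: eqP => // _ [->]; apply: (vtri_lt E2).
by rewrite /m subnKC // ltnW.
Qed.

(** On small discs around the pole e' the map is large, whereas |g - e'| < |c| at radius |c|. Let tS
    be the largest radius t with |g - e'| >= t at the Gauss point. Equality holds there, and tS is
    in the value group because both sides are monomials with different exponents just above it. V
    meets this disc: if the infimum of |w - e'| over V exceeded tS, generic points of slightly
    larger discs would be mapped closer to e' than the infimum. *)
Let pole_step e c e' : shrinking e c -> root Q e' -> v (e' - e) < v c -> exists c',
  [/\ v c' < v c, stable e' c' & N e' e' c' = v c' * nrm Q e' (v c')].
Proof.
move=> [c0 He Hn] rQ e'e; have vc : 0 < v c by rewrite v_gt0.
have ee' : v (e - e') <= v c by rewrite vB_sym ltW.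
pose p_ t := nrm (P - e' *: Q) e' t; pose q_ t := nrm Q e' t.
have q0r : 0 < q_ (v c).
  rewrite /q_ -(nrm_recenter Q ee') -(pmulr_rgt0 _ vc).
  by apply: le_lt_trans Hn; apply: nrm_ge0.
have Q0 : Q != 0 by move: q0r; rewrite /q_ nrm_gt0.
have q0 t : 0 < t -> 0 < q_ t by move=> t0; rewrite nrm_gt0.
have hr : p_ (v c) < v c * q_ (v c).
  rewrite /p_ /q_ -!(nrm_recenter _ ee') -/(N _ _ _); apply: le_lt_trans (N_shift _ e e c0) _.
  by rewrite gt_max Hn /= ltr_pM2r // (nrm_recenter Q ee').
have Pe' : (P - e' *: Q).[e'] != 0.
  have := rat_coprime rF e'; rewrite hornerD hornerN hornerZ (rootP rQ) mulr0 subr0 eqxx orbF.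
  by [].
have P0 : P - e' *: Q != 0 by apply: contra_neq Pe' => ->; rewrite horner0.
have p0 t : 0 < t -> 0 < p_ t by move=> t0; rewrite nrm_gt0.
pose Z := [set t | [/\ 0 < t, t <= v c & t * q_ t <= p_ t]].
have Z0 : exists t, Z t.
  exists (Num.min (v c) (v (P - e' *: Q).[e'] / q_ (v c))); rewrite /Z /=.
  set t := Num.min _ _; have t0 : 0 < t by rewrite lt_min vc divr_gt0 ?v_gt0.
  have tc : t <= v c by rewrite ge_min lexx.
  split=> //; apply: (@le_trans _ _ (t * q_ (v c))); first by rewrite ler_pM2l // nrm_mono.
  apply: (@le_trans _ _ (v (P - e' *: Q).[e'])); last by apply: v_le_nrm; rewrite subrr v0 ltW.
  by rewrite -ler_pdivlMr // ge_min lexx orbT.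
have supZ : has_sup Z by split=> //; exists (v c) => t [].
pose tS := sup Z; have tS_ge t : Z t -> t <= tS by apply/ub_le_sup; case: supZ.
have tS0 : 0 < tS by case: Z0 => t Zt; case: (Zt) => t0 _ _; apply: lt_le_trans t0 (tS_ge t Zt).
have tSc : tS <= v c by apply: ge_sup => // t [].
have above t : tS < t -> t <= v c -> p_ t < t * q_ t.
  move=> h1 h2; rewrite ltNge; apply/negP => h3; have := tS_ge t; rewrite leNgt h1.
  by move=> h4; suff: false by []; apply: h4; split=> //; apply: lt_trans h1.
(* The supremum is attained: q grows at most like a power of the radius, so a strict inequality at
   tS would persist slightly below. *)
have at_ge : tS * q_ tS <= p_ tS.
  rewrite leNgt; apply/negP => hlt; pose y := tS * q_ tS / p_ tS.
  have y1 : 1 < y by rewrite ltr_pdivlMr ?p0 // mul1r.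
  have [i i1 iy] := root_gt1 (size (rts Q)).+2 y1; have i0 := lt_trans ltr01 i1.
  have [|t Zt tlt] := @sup_adherent _ Z (tS - tS / i) _ supZ.
    by rewrite subr_gt0 ltr_pdivrMr // ltr_pMr.
  rewrite -/tS opprB addrC subrK in tlt; case: (Zt) => t0 _ Hp.
  have tts : tS < t * i by rewrite -ltr_pdivrMr.
  have h1 := nrm_growth Q e' t0 (tS_ge t Zt); rewrite -/(q_ _) -/(q_ _) in h1.
  have h2 : p_ t <= p_ tS by apply: nrm_mono; apply: tS_ge.
  have ti : tS / t < i by rewrite ltr_pdivrMr // mulrC.
  have T0 : 0 < tS / t by rewrite divr_gt0.
  suff : y < i ^+ (size (rts Q)).+2 by rewrite ltNge iy.
  apply: (@le_lt_trans _ _ ((tS / t) ^+ (size (rts Q)).+1)); last first.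
    apply: (@le_lt_trans _ _ (i ^+ (size (rts Q)).+1)).
      by apply: lerXn2r; rewrite ?nnegrE ?ltW.
    by rewrite [ltRHS]exprS ltr_pMl ?exprn_gt0.
  rewrite /y ler_pdivrMr ?p0 // exprS -mulrA.
  apply: (@le_trans _ _ (tS * ((tS / t) ^+ size (rts Q) * q_ t))); first by rewrite ler_pM2l.
  have -> : tS * (t^-1 * (tS / t) ^+ size (rts Q)) * p_ tS =
            tS * ((tS / t) ^+ size (rts Q) * (p_ tS / t)) by ring.
  rewrite ler_pM2l // ler_wpM2l ?exprn_ge0 ?(ltW T0) //.
  by rewrite ler_pdivlMr // mulrC; apply: le_trans h2.
have tSlt : tS < v c.
  by rewrite lt_neqAle tSc andbT; apply: contraTneq at_ge => ->; rewrite -ltNge.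
have [A [qp [tp [qp0 tp1 Hp]]]] := nrm_right e' P0 tS0.
have [B [qq [tq [qq0 tq1 Hq]]]] := nrm_right e' Q0 tS0.
rewrite -/p_ in Hp; rewrite -/q_ in Hq.
pose t1 := Num.min (v c) (Num.min tp tq).
have t1S : tS < t1 by rewrite !lt_min tSlt tp1.
have form t : tS <= t -> t < t1 -> p_ t = v qp * t ^+ A /\ q_ t = v qq * t ^+ B.
  by rewrite !lt_min => h1 /and3P[_ h2 h3]; split; [apply: Hp|apply: Hq].
have vqq : 0 < v qq by rewrite v_gt0.
have vqp : 0 < v qp by rewrite v_gt0.
have above' t : tS < t -> t < t1 -> v qp * t ^+ A < v qq * t ^+ B.+1.
  move=> h1 h2; have [E1 E2] := form t (ltW h1) h2.
  rewrite -E1 exprSr mulrA -E2 mulrC; apply: above => //.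
  by move: h2; rewrite !lt_min => /andP[/ltW].
have [pS qS] := form tS (lexx _) t1S.
have at_eq : v qp * tS ^+ A = v qq * tS ^+ B.+1.
  apply/eqP; rewrite eq_le; apply/andP; split; last first.
    by move: at_ge; rewrite pS qS mulrCA exprS.
  rewrite leNgt; apply/negP => hlt; pose y := v qp * tS ^+ A / (v qq * tS ^+ B.+1).
  have D0 : 0 < v qq * tS ^+ B.+1 by rewrite mulr_gt0 ?exprn_gt0.
  have y1 : 1 < y by rewrite ltr_pdivlMr // mul1r.
  have [i i1 iy] := root_gt1 B.+1 y1.
  have : tS < Num.min t1 (i * tS) by rewrite lt_min t1S ltr_pMl.
  move=> /(value_dense tS0) [x _ /andP[xS]]; rewrite lt_min => /andP[xt1 xi].
  have := above' _ xS xt1; apply/negP; rewrite -leNgt.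
  apply: (@le_trans _ _ (v qq * (i * tS) ^+ B.+1)).
    by rewrite ler_pM2l // lerXn2r ?nnegrE ?v_ge0 // ?(ltW xi) // mulr_ge0 // ltW // (lt_trans ltr01).
  apply: (@le_trans _ _ (v qp * tS ^+ A)).
    by rewrite exprMn mulrCA -ler_pdivlMr.
  by rewrite ler_pM2l // lerXn2r ?nnegrE ?v_ge0 // ltW.
(* With A > B, equality at tS would contradict the strict inequality above it. So B + 1 - A is
   positive, and tS to this power is |qp / qq|. *)
have AB : (A <= B)%N.
  rewrite leqNgt; apply/negP => BA; have [x _ /andP[xS x1]] := value_dense tS0 t1S.
  have := above' _ xS x1; rewrite -(subnKC BA) exprD in at_eq *.
  have x0 : 0 < v x := lt_trans tS0 xS.
  rewrite exprD !mulrA [X in X * _]mulrC -mulrA mulrC ltr_pM2r ?exprn_gt0 //.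
  move: at_eq; rewrite mulrCA mulrC => /mulIf; rewrite expf_neq0 ?gt_eqF // => /(_ isT) <-.
  by rewrite ltr_pM2l // ltNge lerXn2r ?nnegrE ?v_ge0 ?ltW.
have [c' tE] : exists c', tS = v c'.
  apply: (@v_root_exp tS (qp / qq) (B.+1 - A)); rewrite ?subn_gt0 ?ltnS ?(ltW tS0) //.
  have tA : tS ^+ A != 0 by rewrite expf_neq0 ?gt_eqF.
  apply: (mulIf tA); rewrite -exprD subnK ?(leqW AB) // vM vV.
  by rewrite mulrAC at_eq mulrAC mulfV ?gt_eqF // mul1r.
have slope t : tS <= t -> t < t1 -> p_ t <= tS * q_ t.
  move=> h1 h2; have t0 := lt_le_trans tS0 h1; have [-> ->] := form t h1 h2.
  have tA : 0 < tS ^+ A by rewrite exprn_gt0.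
  rewrite -(ler_pM2r tA) mulrAC at_eq -(subnKC AB) -addnS !exprD exprS.
  have -> : v qq * (tS ^+ A * (tS * tS ^+ (B - A))) * t ^+ A =
            (v qq * tS * tS ^+ A * t ^+ A) * tS ^+ (B - A) by ring.
  have -> : tS * (v qq * (t ^+ A * t ^+ (B - A))) * tS ^+ A =
            (v qq * tS * tS ^+ A * t ^+ A) * t ^+ (B - A) by ring.
  by rewrite ler_pM2l ?mulr_gt0 ?exprn_gt0 // lerXn2r ?nnegrE ?(ltW tS0) ?(ltW t0).
have c'0 : c' != 0 by rewrite -v_gt0 -tE.
have NE : N e' e' c' = v c' * nrm Q e' (v c').
  by rewrite /N -tE -/(p_ _) -/(q_ _) pS at_eq exprS qS mulrCA.
exists c'; split; [by rewrite -tE| |exact: NE]; split=> //; last by rewrite -NE.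
have [w2 [_ w2e Vw2]] := generic_pt [:: e'] c0 He.
have {}w2e : v c <= v (w2 - e') by apply: w2e; rewrite inE.
have gen x w1 : x != 0 -> v x < v c -> V (Some w1) -> v (w1 - e') <= v x -> generic_in e' x.
  move=> x0 xc Vw1 w1e; apply: (Vsep x0 Vw1 Vw2 w1e); apply: ltW.
  rewrite vB_sym (lt_le_trans xc) // (le_trans w2e) // vB_sym.
  rewrite (vB_sym w2) (@vtri_eq w1) 1?(vB_sym e') //.
  rewrite (vB_sym w1 w2); case: leP => // hle; exfalso; move: w2e; rewrite leNgt => /negP; apply.
  apply: le_lt_trans xc; apply: (@vtri_le w1) => //; exact: le_trans w1e.
suff [w1 [Vw1 w1e]] : exists w1, V (Some w1) /\ v (w1 - e') <= tS.
  by apply: (gen c' w1) => //; rewrite -tE.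
pose D := [set t | exists2 w, V (Some w) & t = v (w - e')].
have infD : has_inf D by split; [exists (v (w2 - e')), w2|exists 0 => t [w _ ->]; apply: v_ge0].
have inf_le w : V (Some w) -> inf D <= v (w - e').
  by move=> Vw; apply: ge_inf; [case: infD|exists w].
have inf_near x : inf D < x -> exists2 w, V (Some w) & v (w - e') < x.
  move=> hx; have [|t [w Vw ->] hw] := @inf_adherent _ D (x - inf D) _ infD; first by rewrite subr_gt0.
  by exists w => //; move: hw; rewrite addrCA subrr addr0.
have image x : x != 0 -> generic_in e' x -> exists w, V (Some w) /\ v (w - e') * q_ (v x) = p_ (v x).
  move=> x0 /(generic_image e' [::] x0) [z [Vz _ hz]]; have [_ _ Vhz] := V_fin Vz.
  by exists (h z).
have [inf_S|inf_S] := leP (inf D) tS.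
  have [x x0 /andP[xS x1]] := value_dense tS0 t1S.
  have [w1 Vw1 w1x] := inf_near _ (le_lt_trans inf_S xS).
  have xc : v x < v c by move: x1; rewrite !lt_min => /andP[].
  have [w [Vw Hw]] := image _ x0 (gen x w1 x0 xc Vw1 (ltW w1x)).
  exists w; split=> //; rewrite -(ler_pM2r (q0 (v x) _)) ?v_gt0 // Hw.
  by apply: slope => //; apply: ltW.
have inf0 := lt_trans tS0 inf_S.
have inf_c : inf D < v c.
  have [w [Vw Hw]] := image _ c0 (generic_recenter ee' He).
  by apply: le_lt_trans (inf_le w Vw) _; rewrite -(ltr_pM2r q0r) Hw.
have := above _ inf_S (ltW inf_c); set i0 := inf D in inf_S inf0 inf_c inf_near inf_le * => hi.
pose y := i0 * q_ i0 / p_ i0; have y1 : 1 < y by rewrite ltr_pdivlMr ?p0 // mul1r.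
have [i i1 iy] := root_gt1 (size (rts (P - e' *: Q))).+1 y1; have i00 := lt_trans ltr01 i1.
have : i0 < Num.min (v c) (i * i0) by rewrite lt_min inf_c ltr_pMl.
move=> /(value_dense inf0) [x x0 /andP[xi0]]; rewrite lt_min => /andP[xc xi].
have [w1 Vw1 w1x] := inf_near _ xi0.
have [w [Vw Hw]] := image _ x0 (gen x w1 x0 xc Vw1 (ltW w1x)).
exfalso; have := inf_le w Vw; apply/negP; rewrite -ltNge.
have vx : 0 < v x by rewrite v_gt0.
rewrite -(ltr_pM2r (q0 _ vx)) Hw.
apply: (@lt_le_trans _ _ (i0 * q_ i0)); last by rewrite ler_pM2l // nrm_mono // ltW.
apply: le_lt_trans (nrm_growth _ _ inf0 (ltW xi0)) _.
rewrite -/(p_ _) -ltr_pdivlMr ?p0 // -/y; apply: lt_le_trans iy.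
have T0 : 0 <= v x / i0 by rewrite divr_ge0 ?v_ge0 ?ltW.
apply: (@le_lt_trans _ _ (i ^+ size (rts (P - e' *: Q)))).
  by rewrite lerXn2r ?nnegrE ?(ltW i00) // ler_pdivrMr // ltW.
by rewrite exprS ltr_pMl ?exprn_gt0.
Qed.

Let poles e c := count (fun a => v (a - e) < v c) (rts Q).
(** Induction on the number of poles in the open disc. A pole e' yields a smaller stable disc around
    it; if this gives no good point, a shrinking disc around some w remains. It excludes the pole
    e', since at the Gauss point |g - w| is below |c'| while |g - e'| is not. *)
Lemma shrinking_good e c : shrinking e c -> has_good.
Proof.
move: {2}(poles e c) (leqnn (poles e c)) => m; elim: m e c => [|m IH] e c pm st;
  have [c0 _ hn] := st; have vc : 0 < v c by rewrite v_gt0.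
all: have Q0 : Q != 0
  by rewrite -(nrm_gt0 _ e vc) -(pmulr_rgt0 _ vc); apply: le_lt_trans hn; apply: nrm_ge0.
  apply: (shrinking_nopole st) => a ae; apply/negP => ra.
  move: pm; rewrite leqn0 => /eqP/eqP; rewrite -leqn0 leqNgt -has_count => /hasPn /(_ a).
  by rewrite mem_rts // ae => /(_ ra).
have [[e' [rQ e'e]]|np] := pselect (exists a, root Q a /\ v (a - e) < v c); last first.
  by apply: (shrinking_nopole st) => a ae; apply/negP => ra; apply: np; exists a.
have [c' [c'c st' NE]] := pole_step st rQ e'e.
have [//|[w [stw we hw]]] := stable_step st'; apply: (IH w c') => //.
have [c'0 _ _] := st'.
have e'w : v c' <= v (e' - w).
  rewrite leNgt; apply/negP => hlt; have := N_shift e' w e' c'0; rewrite NE leNgt => /negP; apply.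
  by rewrite gt_max hw /= ltr_pM2r // nrm_gt0 ?v_gt0.
rewrite -ltnS; apply: leq_trans pm; apply: (@count_ltn _ _ _ e').
- move=> a aw; apply: (@vtri_lt e') => //; apply: le_lt_trans c'c.
  by apply: (@vtri_le w) => //; apply: ltW.
- by rewrite mem_rts.
- by [].
- by rewrite -leNgt.
Qed.
Lemma stable_good e c : stable e c -> has_good.
Proof. by move=> /stable_step [//|[w [/shrinking_good]]]. Qed.
End GoodPoint.

(** * Good points in the orbit of an affinoid *)

Definition orbits (g : P1 -> P1) (X : set P1) : set P1 :=
  [set w | exists m, exists2 z, X z & iter m g z = w].
Lemma sub_orbits g X z : X z -> orbits g X z.
Proof. by move=> Xz; exists 0%N, z. Qed.
Lemma orbits_map g X z : orbits g X z -> orbits g X (g z).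
Proof. by move=> [m [w Xw <-]]; exists m.+1, w. Qed.
Lemma orbits_mob o g X : orbits (conj_mob o g) (mob o @` X) = mob o @` orbits g X.
Proof.
apply/seteqP; split=> [w [m [_ [z Xz <-] <-]]|_ [_ [m [z Xz <-]] <-]].
  by exists (iter m g z); [exists m, z|rewrite iter_conj_mob /conj_mob /= mobK].
by exists m, (mob o z); [exists z|rewrite iter_conj_mob /conj_mob /= mobK].
Qed.

(* Consecutive sets g^k(X), g^(k+1)(X) share the point g^(k+1) x, so some
   g^k(X) contains two points that are separated at the scale |c|. *)
Lemma orbits_generic n (B : 'I_n.+1 -> set P1) X g x e c w1 w2 : affinoid_rep B X -> ratmap g ->
  X x -> X (g x) -> ~ orbits g X None -> c != 0 -> orbits g X (Some w1) -> orbits g X (Some w2) ->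
  v (w1 - e) <= v c -> v c <= v (w1 - w2) -> generic_in (orbits g X) e c.
Proof.
move=> rX rg Xx Xgx VN c0 [m1 [z1 Xz1 E1]] [m2 [z2 Xz2 E2]] w1e w12.
pose T u := exists2 w, u = Some w & v (w - w1) < v c.
have vc : 0 < v c by rewrite v_gt0.
have [k [a1 [a2 [Xa1 Xa2 T1 T2]]]] : exists k a1 a2, [/\ X a1, X a2, T (iter k g a1) & ~ T (iter k g a2)].
  apply: contrapT => nT.
  have same k a1 a2 : X a1 -> X a2 -> T (iter k g a1) -> T (iter k g a2).
    by move=> Xa1 Xa2 Ta1; apply: contrapT => Ta2; apply: nT; exists k, a1, a2.
  have base k : T (iter k g x) <-> T x.
    elim: k => // k IH; rewrite -IH iterSr.
    by split; apply: same.
  have : T (Some w2).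
    by rewrite -E2; apply: (same _ x) => //; apply/base/(base m1)/(same _ z1) => //;
      exists w1; rewrite ?subrr ?v0.
  by move=> [w [<-]]; rewrite vB_sym ltNge w12.
have fin u : orbits g X u -> exists a, u = Some a by case: u => [a|/VN //] _; exists a.
have [b1 Eb1] := fin _ (sub_orbits g Xa1); have [b2 Eb2] := fin _ (sub_orbits g Xa2).
have [u2 Eu2] : exists a, iter k g a2 = Some a by apply: fin; exists k, a2.
case: T1 => u1 Eu1 u1w; subst a1 a2.
have u2w : v c <= v (u2 - w1).
  by rewrite leNgt; apply/negP => h; apply: T2; exists u2.
have [d [P [Q rF]]] := ratmap_iter k rg.
have [||l Hl] := separated_values_cofinite rX rF (e := e) c0 Xa1 Xa2 Eu1 Eu2.
- by apply: (@vtri_le w1) => //; apply: ltW.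
- by rewrite (@vtri_eq w1) 1?(vB_sym w1) // (lt_le_trans u1w).
by exists l => a ae al; have [z Xz E] := Hl a ae al; exists k, z.
Qed.

(** Let s be the distance from x0 to the complement of V and c = x0 - g x0. If |c| < s, the ball of
    radius s is mapped into itself. Otherwise V contains almost all classes of the disc of radius
    |c| around x0; if this disc is not stable, g expands it at the Gauss point, and inversion at an
    omitted value o1 of the disc turns the expansion into shrinking around 0. *)
Lemma good_exists_affine n (B : 'I_n.+1 -> set P1) X g x a0 : affinoid_rep B X -> ratmap g ->
  X x -> X (g x) -> ~ orbits g X None -> ~ orbits g X (Some a0) -> has_good g (orbits g X).
Proof.
move=> rX rg Xx Xgx VN Va0; have [d [P [Q rF]]] := rg.
have Vsep e c w1 w2 := @orbits_generic n B X g x e c w1 w2 rX rg Xx Xgx VN.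
set V := orbits g X in VN Va0 Vsep *.
have Vg z : V z -> V (g z) := @orbits_map g X z.
have [x0 Ex] : exists x0, x = Some x0.
  by case: x Xx {Xgx Vsep} => [x0|/(sub_orbits g)/VN //] _; exists x0.
have [y0 Ey] : exists y0, g x = Some y0.
  by case: (g x) Xgx => [y0|/(sub_orbits g)/VN //] _; exists y0.
rewrite Ey in Xgx; subst x.
have Vx : V (Some x0) := sub_orbits g Xx; have Vy : V (Some y0) := sub_orbits g Xgx.
pose h z := P.[z] / Q.[z].
have V_fin z : V (Some z) -> Q.[z] != 0 /\ V (Some (h z)).
  by move=> /Vg; rewrite (ratE rF); case: eqP => [_ /VN //|/eqP].
have [Q0 _] := V_fin _ Vx.
have yE : y0 = h x0 by move: Ey; rewrite (ratE rF) (negbTE Q0) => -[].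
have vh z a : Q.[z] != 0 -> v (h z - a) * v Q.[z] = v (P - a *: Q).[z].
  by move=> q0; rewrite -vM mulrBl /h divfK // hornerD hornerN hornerZ.
have rootV z a : V (Some z) -> ~ V (Some a) -> ~~ root (P - a *: Q) z.
  by move=> /Vg Vz nVa; apply/negP => /(rat_fiber rF) E; apply: nVa; rewrite -E.
pose D := [set t | exists2 a, ~ V (Some a) & t = v (x0 - a)].
have infD : has_inf D.
  by split; [exists (v (x0 - a0)), a0|exists 0 => t [a _ ->]; apply: v_ge0].
set s := inf D.
have s_le a : ~ V (Some a) -> s <= v (x0 - a) by move=> Va; apply: ge_inf; [case: infD|exists a].
have s_glb M : (forall a, ~ V (Some a) -> M <= v (x0 - a)) -> M <= s.
  by move=> HM; apply: lb_le_inf; [case: infD|move=> t [a Va ->]; apply: HM].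
have s0 : 0 < s.
  have [e e0 He] := affinoid_open rX Xx; apply: lt_le_trans e0 _; apply: s_glb => a Va.
  by rewrite leNgt; apply/negP => h1; apply: Va; apply/sub_orbits/He; rewrite vB_sym.
pose c := x0 - y0.
(* In the first case |h z - a| = |x0 - a| on the ball for each omitted a, so |h z - y0| <= s by the
   choice of s; Schwarz' lemma makes this strict. *)
have [cs|sc] := ltP (v c) s.
  have DV z : v (z - x0) < s -> V (Some z).
    by move=> zx; apply: contrapT => /s_le; rewrite vB_sym leNgt zx.
  have np z : v (z - x0) < s -> ~~ root Q z by move=> /DV /V_fin [].
  have xx : v (x0 - x0) < s by rewrite subrr v0.
  have vQ z : v (z - x0) < s -> v Q.[z] = v Q.[x0].
    by move=> zx; rewrite (v_noroot np zx) (v_noroot np xx).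
  have vQ0 : 0 < v Q.[x0] by rewrite v_gt0.
  have ha z a : v (z - x0) < s -> ~ V (Some a) -> v (h z - a) = v (x0 - a).
    move=> zx Va; have nr b : v (b - x0) < s -> ~~ root (P - a *: Q) b by move=> /DV Vb; apply: rootV.
    transitivity (v (h x0 - a)).
      apply: (mulIf (lt0r_neq0 vQ0)); rewrite vh // -{1}(vQ z zx) vh; last by have [] := V_fin _ (DV _ zx).
      by rewrite (v_noroot nr zx) (v_noroot nr xx).
    by rewrite -yE; apply: (@vtri_eq x0); rewrite vB_sym; apply: lt_le_trans cs (s_le a Va).
  have hy z : v (z - x0) < s -> v (h z - y0) <= s.
    move=> zx; apply: s_glb => a Va; apply: (@vtri_le a); rewrite ?ha //.
    by rewrite vB_sym yE ha.
  exists (Some x0) => //; apply: (ball_good rF np) xx => z zx; rewrite -/(h z).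
  have : root (P - y0 *: Q) x0 by rewrite rootE hornerD hornerN hornerZ yE /h divfK // subrr.
  move=> /factor_theorem[T TE]; have q0 : Q.[z] != 0 by exact: np.
  have M w : v (w - x0) < s -> v (P - y0 *: Q).[w] <= s * v Q.[w].
    move=> wx; rewrite -vh; last exact: np.
    by apply: ler_wpM2r; rewrite ?v_ge0 // hy.
  have xx : v (x0 - x0) < s by rewrite subrr v0.
  have := schwarz s0 xx np M TE zx; rewrite mulrC ler_pM2l // => hT.
  apply: (@vtri_lt y0); last by rewrite vB_sym.
  apply: le_lt_trans zx; have vq0 : 0 < v Q.[z] by rewrite v_gt0.
  rewrite -(ler_pM2r vq0) vh // TE hornerM vM hornerXsubC mulrC.
  by rewrite ler_wpM2l ?v_ge0.
have vc : 0 < v c := lt_le_trans s0 sc.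
have c0 : c != 0 by rewrite -v_gt0.
have xx : v (x0 - x0) <= v c by rewrite subrr v0 ltW.
have gen : generic_in V x0 c by apply: (Vsep x0 c x0 y0).
have [hn|hn] := leP (nrm (P - x0 *: Q) x0 (v c)) (v c * nrm Q x0 (v c)).
  exact: (stable_good rF VN Vg Vsep (e := x0) (c := c)).
have Q00 : Q != 0 by apply: contra_neq Q0 => ->; rewrite horner0.
have nQ0 : 0 < nrm Q x0 (v c) by rewrite nrm_gt0.
have expand z : v (z - x0) <= v c -> (forall a, a \in rts (P - x0 *: Q) ++ rts Q -> v c <= v (z - a)) ->
    Q.[z] != 0 /\ v c < v (h z - x0).
  move=> zx zl; have vq : v Q.[z] = nrm Q x0 (v c).
    by apply: v_generic => // a al; apply: zl; rewrite mem_cat al orbT.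
  have q0 : Q.[z] != 0 by rewrite -v_gt0 vq.
  split=> //; rewrite -(ltr_pM2r nQ0) -{2}vq vh // (v_generic (e := x0) (r := v c)) //.
  by move=> a al; apply: zl; rewrite mem_cat al.
(* If V contained the closed disc, |g - a| would be constant on it for every omitted a; this bounds
   |h z - x0| by s and contradicts the expansion. *)
have [[ o1 [Vo xo]]|no] := pselect (exists a, ~ V (Some a) /\ v (x0 - a) <= v c); last first.
  have far a : ~ V (Some a) -> v c < v (x0 - a).
    by move=> Va; rewrite ltNge; apply/negP => h1; apply: no; exists a.
  have DV z : v (z - x0) <= v c -> V (Some z).
    by move=> zx; apply: contrapT => /far; rewrite (vB_sym x0 z) ltNge zx.
  have np z : v (z - x0) <= v c -> ~~ root Q z by move=> /DV /V_fin [].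
  have [z zx zl] := generic_point x0 (rts (P - x0 *: Q) ++ rts Q) c0.
  have [q0] := expand z zx zl; rewrite ltNge => /negP[]; apply: le_trans sc.
  apply: s_glb => a Va; apply: (@vtri_le a); last by rewrite vB_sym.
  rewrite le_eqVlt; apply/orP; left; apply/eqP; transitivity (v (h x0 - a)).
    have nr b : v (b - x0) <= v c -> ~~ root (P - a *: Q) b by move=> /DV Vb; apply: rootV.
    have vQ0 : 0 < v Q.[x0] by rewrite v_gt0.
    apply: (mulIf (lt0r_neq0 vQ0)); rewrite vh // -{1}(v_noroot_closed np zx) vh //.
    exact: (v_noroot_closed nr zx).
  by rewrite -yE; apply: (@vtri_eq x0); rewrite vB_sym; apply: far.
have rX' := affinoid_rep_mob o1 rX.
have rg' := ratmap_conj_mob o1 rg; have [d' [P' [Q' rF']]] := rg'.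
have VE := orbits_mob o1 g X; rewrite -/V in VE.
have VN' : ~ orbits (conj_mob o1 g) (mob o1 @` X) None.
  rewrite VE => -[z Vz /= E]; apply: Vo; move: Vz; rewrite -(mobK o1 z) E.
  by [].
have Xx' : (mob o1 @` X) (mob o1 (Some x0)) by exists (Some x0).
have Xgx' : (mob o1 @` X) (conj_mob o1 g (mob o1 (Some x0))).
  by exists (Some y0) => //; rewrite /conj_mob /= -/(mob o1 (Some x0)) mobK Ey.
have Vsep' e k w1 w2 := @orbits_generic n _ _ _ _ e k w1 w2 rX' rg' Xx' Xgx' VN'.
set V' := orbits _ _ in VE VN' Vsep'.
have Vg' z : V' z -> V' (conj_mob o1 g z) := @orbits_map _ _ z.
suff sh : shrinking P' Q' V' 0 c^-1.
  have [z' Vz' gz'] := shrinking_good rF' VN' Vg' Vsep' sh.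
  exists (imob o1 z'); first by move: Vz'; rewrite VE => -[z Vz <-]; rewrite mobK.
  by apply: (@good_mob o1); rewrite imobK.
have yo : v (y0 - o1) <= v c by apply: (@vtri_le x0) => //; rewrite vB_sym.
have mobE u : V (Some u) -> u - o1 != 0 /\ V' (Some (u - o1)^-1).
  move=> Vu; have uo : u != o1 by apply: contra_not_neq Vo => <-.
  by rewrite subr_eq0; split=> //; rewrite VE; exists (Some u); rewrite //= (negbTE uo).
have [xo0 Vx'] := mobE _ Vx; have [yo0 Vy'] := mobE _ Vy.
have gen' u u' : V (Some u) -> V (Some u') -> v (u - o1) = v c -> v (u' - o1) <= v c ->
    v (u - u') = v c -> generic_in V' 0 c^-1.
  move=> Vu Vu' h1 h2 h3; have [u0 Wu] := mobE u Vu; have [u0' Wu'] := mobE u' Vu'.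
  apply: (Vsep' 0 c^-1 _ _ _ Wu Wu'); rewrite ?invr_eq0 // ?subr0 ?vV ?h1 //.
  have -> : (u - o1)^-1 - (u' - o1)^-1 = (u' - u) / ((u - o1) * (u' - o1)).
    have -> : u' - u = (u' - o1) - (u - o1) by ring.
    by field; rewrite u0 u0'.
  rewrite !vM vV vM h1 (vB_sym u') h3 invfM mulVKf ?gt_eqF //.
  by rewrite lef_pV2 // posrE ?v_gt0.
split; rewrite ?invr_eq0 //.
  (* Since |x0 - y0| = |c|, one of x0 and y0 is at distance exactly |c| from o1. *)
  have [h1|h1] := eqVneq (v (x0 - o1)) (v c); first exact: (gen' x0 y0).
  apply: (gen' y0 x0) => //; last by rewrite vB_sym.
  by rewrite vB_sym; apply: (@vtri_eq x0); rewrite vB_sym lt_neqAle h1.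
have ci0 : c^-1 != 0 by rewrite invr_eq0.
(* w is generic for the inverted map and avoids the images of the old roots, so that z = o1 + 1 / w
   is generic in the old disc and [expand] applies. *)
have [w w0c wl] := generic_point 0 (0 :: rts P' ++ rts Q' ++
  [seq (a - o1)^-1 | a <- rts (P - x0 *: Q) ++ rts Q]) ci0.
have vw : v w = (v c)^-1.
  apply/eqP; rewrite eq_le -vV -{1}[w]subr0 w0c /= -[w in leRHS]subr0.
  by apply: wl; rewrite inE eqxx.
have w0 : w != 0 by rewrite -v_gt0 vw invr_gt0.
pose z := o1 + w^-1; have zo : z - o1 = w^-1 by rewrite /z addrAC subrr add0r.
have vzo : v (z - o1) = v c by rewrite zo vV vw invrK.
have zx : v (z - x0) <= v c by apply: (@vtri_le o1); rewrite ?vzo // vB_sym.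
have [|q0 hz] := expand z zx.
  move=> a al; have {}al : (v c)^-1 <= v (w - (a - o1)^-1).
    rewrite -vV; apply: wl; rewrite inE !mem_cat; apply/orP; right; apply/orP; right.
    by apply/orP; right; apply/mapP; exists a.
  have [->|ao] := eqVneq a o1; first by rewrite vzo.
  have b0 : a - o1 != 0 by rewrite subr_eq0.
  have zaE : z - a = w^-1 - (a - o1) by rewrite -zo; ring.
  have [bc|bc] := ltP (v (a - o1)) (v c).
    by rewrite (vB_sym z a) (@vtri_eq o1 a z) (vB_sym o1 z) vzo.
  have -> : z - a = w^-1 * (a - o1) * - (w - (a - o1)^-1).
    by rewrite zaE; move: (a - o1) b0 => b b0; field; rewrite w0 b0.
  rewrite !vM vN vV vw invrK; apply: le_trans bc _.
  rewrite mulrAC ler_peMl ?v_ge0 //; move: al.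
  by rewrite -[X in X <= _]mul1r ler_pdivrMr // mulrC.
have hzo : v (h z - o1) = v (h z - x0).
  rewrite (vB_sym (h z) o1) (vB_sym (h z) x0); apply: (@vtri_eq x0).
  by rewrite (vB_sym o1 x0) (vB_sym x0 (h z)); apply: le_lt_trans hz.
have hz0 : h z != o1.
  by rewrite -subr_eq0 -v_gt0 hzo; apply: le_lt_trans hz; apply: v_ge0.
have E : conj_mob o1 g (Some w) = Some (h z - o1)^-1.
  by rewrite /conj_mob /= (negbTE w0) -/z (ratE rF) (negbTE q0) -/(h z) /= (negbTE hz0).
have w1 : v (w - 0) <= v c^-1 by rewrite subr0 vw vV.
rewrite scale0r subr0 -(v_generic w1); last first.
  by move=> a al; apply: wl; rewrite inE !mem_cat al !orbT.
rewrite -(v_generic w1); last by move=> a al; apply: wl; rewrite inE !mem_cat al !orbT.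
move: E; rewrite (ratE rF'); case: eqP => // /eqP q0' [E].
rewrite -ltr_pdivrMr ?v_gt0 // -vV -vM E !vV hzo ltf_pV2 ?posrE //.
exact: lt_trans hz.
Qed.

Lemma good_exists n (B : 'I_n.+1 -> set P1) X g x a b : affinoid_rep B X -> ratmap g ->
  X x -> X (g x) -> a <> b -> ~ orbits g X a -> ~ orbits g X b -> has_good g (orbits g X).
Proof.
move=> rX rg Xx Xgx.
wlog [c ->] : a b / exists c, b = Some c => [hw|].
  case: b a => [b|] [a|] ab Va Vb //; first by apply: (hw (Some a) (Some b)) => //; exists b.
  - by apply: (hw None (Some b)) => //; exists b.
  - by apply: (hw None (Some a)) => //; exists a.
case: a => [a|] ab Va Vb; last exact: (good_exists_affine rX rg Xx Xgx Va Vb).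
have rX' := affinoid_rep_mob a rX; have rg' := ratmap_conj_mob a rg.
have VE := orbits_mob a g X.
have nV w : ~ orbits g X w -> ~ orbits (conj_mob a g) (mob a @` X) (mob a w).
  by rewrite VE => Vw [z Vz /(can_inj (mobK a)) E]; apply: Vw; rewrite -E.
have := nV _ Va; have := nV _ Vb; rewrite /= eqxx.
have [E|ca] := eqVneq c a; first by case: ab; rewrite E.
move=> Vb' Va'; have Xx' : (mob a @` X) (mob a x) by exists x.
have Xgx' : (mob a @` X) (conj_mob a g (mob a x)).
  by exists (g x) => //; rewrite /conj_mob /= mobK.
have [z' Vz' gz'] := good_exists_affine rX' rg' Xx' Xgx' Va' Vb'.
exists (imob a z'); first by move: Vz'; rewrite VE => -[z Vz <-]; rewrite mobK.
by apply: (@good_mob a); rewrite imobK.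
Qed.

(** * Fibres and fixed points *)

Definition rat_deg d F := exists P Q, rat_rep d P Q F.
Lemma rat_deg_conj d o F : rat_deg d F -> rat_deg d (conj_mob o F).
Proof.
move=> [P [Q rF]]; have h := rat_rep_comp (rat_rep_comp (mob_rep o) rF) (imob_rep o).
by rewrite mul1n muln1 in h; do 2 eexists; exact: h.
Qed.
Lemma rat_deg_ratmap d F : rat_deg d F -> ratmap F. Proof. by exists d. Qed.

Lemma noroot_radius (Q : {poly K}) a : Q.[a] != 0 -> exists2 r, 0 < r &
  forall w, v (w - a) < r -> ~~ root Q w /\ v Q.[w] = v Q.[a].
Proof.
move=> Qa; have Q0 : Q != 0 by apply: contra_neq Qa => ->; rewrite horner0.
suff [r r0 H] : exists2 r, 0 < r & forall w, v (w - a) < r -> ~~ root Q w.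
  exists r => // w wa; split; first exact: H.
  by rewrite (v_noroot H wa) (v_noroot H) // subrr v0.
have : forall b, b \in rts Q -> b != a.
  by move=> b; rewrite mem_rts // => rb; apply: contra_neq Qa => <-; apply/rootP.
suff gen : forall s : seq K, (forall b, b \in s -> b != a) -> exists2 r, 0 < r &
    forall w, v (w - a) < r -> w \notin s.
  by move=> /gen [r r0 H]; exists r => // w /H; rewrite mem_rts.
elim=> [|b s IH] H; first by exists 1.
have [c cs|r r0 Hr] := IH; first by apply: H; rewrite inE cs orbT.
have b0 : 0 < v (b - a) by rewrite v_gt0 subr_eq0 H // inE eqxx.
exists (Num.min r (v (b - a))); first by rewrite lt_min r0.
move=> w; rewrite lt_min => /andP[h1 h2]; rewrite inE negb_or Hr // andbT.
by apply: contraTneq h2 => ->; rewrite ltxx.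
Qed.

Lemma quotient_local (S Q : {poly K}) a b : Q.[a] != 0 -> S.[a] / Q.[a] = b ->
  exists r M, [/\ 0 < r, 0 < M & forall w, v (w - a) < r ->
    Q.[w] != 0 /\ v (S.[w] / Q.[w] - b) <= M * v (w - a)].
Proof.
move=> Qa Ea; have : root (S - b *: Q) a.
  by rewrite rootE hornerD hornerN hornerZ -Ea divfK // subrr.
move=> /factor_theorem[T TE]; have [r r0 Hr] := noroot_radius Qa.
have vQ0 : 0 < v Q.[a] by rewrite v_gt0.
exists (Num.min r 1), (nrm T a 1 / v Q.[a] + 1); split; first by rewrite lt_min r0 ltr01.
  by rewrite ltr_wpDl // divr_ge0 ?nrm_ge0 ?v_ge0.
move=> w; rewrite lt_min => /andP[wr w1]; have [q0 vq] := Hr w wr; split=> //.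
apply: (@le_trans _ _ (nrm T a 1 / v Q.[a] * v (w - a))); last first.
  by rewrite ler_wpM2r ?v_ge0 // lerDl.
rewrite -(ler_pM2r vQ0) -{1}vq -vM mulrBl divfK //.
have -> : S.[w] - b * Q.[w] = (S - b *: Q).[w] by rewrite hornerD hornerN hornerZ.
rewrite TE hornerM vM hornerXsubC mulrAC divfK ?gt_eqF // mulrC [leRHS]mulrC.
by apply: ler_wpM2l; rewrite ?v_ge0 //; apply/v_le_nrm/ltW.
Qed.
Lemma rat_local d P Q F a b : rat_rep d P Q F -> F (Some a) = Some b ->
  exists r M, [/\ 0 < r, 0 < M & forall w, v (w - a) < r -> exists2 w', F (Some w) = Some w' &
    v (w' - b) <= M * v (w - a)].
Proof.
move=> rF; rewrite (ratE rF); case: eqP => // /eqP Qa [Ea].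
have [r [M [r0 M0 H]]] := quotient_local Qa Ea; exists r, M; split=> // w /H [q0 h].
by exists (P.[w] / Q.[w]); rewrite // (ratE rF) (negbTE q0).
Qed.

Lemma mob_chordal o z w : chordal v z w <= mob_lip o * chordal v (mob o z) (mob o w).
Proof. by rewrite -{1}(mobK o z) -{1}(mobK o w) imob_lipschitz. Qed.

Lemma ratmap_continuous F z e : ratmap F -> 0 < e -> exists2 d, 0 < d &
  forall w, chordal v w z < d -> chordal v (F w) (F z) < e.
Proof.
move=> rF e0.
have fin G a b eps : ratmap G -> G (Some a) = Some b -> 0 < eps -> exists2 d, 0 < d &
    forall w, chordal v w (Some a) < d -> chordal v (G w) (G (Some a)) < eps.
  move=> [d [P [Q rG]]] E eps0; have [r [M [r0 M0 H]]] := rat_local rG E.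
  have [|t t0 Ht] := @chordal_small a (Num.min r (eps / M)); first by rewrite lt_min r0 divr_gt0.
  exists t => // w /Ht [c ->]; rewrite lt_min => /andP[cr ce].
  have [w' -> hw'] := H c cr; rewrite E; apply: le_lt_trans (chordal_le _ _) _.
  by apply: le_lt_trans hw' _; rewrite mulrC -ltr_pdivlMr.
have any G a eps : ratmap G -> 0 < eps -> exists2 d, 0 < d &
    forall w, chordal v w (Some a) < d -> chordal v (G w) (G (Some a)) < eps.
  move=> rG eps0; case E: (G (Some a)) => [b|]; first by rewrite -E; apply: fin E eps0.
  have rMG : ratmap (mob 0 \o G) by apply: ratmap_comp rG; exists 1%N, 1, ('X - 0%:P); exact: mob_rep.
  have EM : (mob 0 \o G) (Some a) = Some 0 by rewrite /= E.
  have [|t t0 Ht] := fin _ _ _ (eps / mob_lip 0) rMG EM; first by rewrite divr_gt0 ?mob_lip_gt0.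
  exists t => // w /Ht; rewrite /= E ltr_pdivlMr ?mob_lip_gt0 // mulrC.
  by apply: le_lt_trans; apply: mob_chordal.
case: z => [a|]; first exact: any.
have rFN : ratmap (F \o imob 0) by apply: ratmap_comp => //; exists 1%N, (0 *: 'X + 1), 'X; exact: imob_rep.
have [t t0 Ht] := any _ 0 e rFN e0.
exists (t / mob_lip 0) => [|w wN]; first by rewrite divr_gt0 ?mob_lip_gt0.
have := Ht (mob 0 w); rewrite /= mobK eqxx; apply.
have -> : Some 0 = mob 0 None by [].
by apply: le_lt_trans (mob_lipschitz 0 w None) _; rewrite mulrC -ltr_pdivlMr ?mob_lip_gt0.
Qed.

Lemma coef_lt_size (S : {poly K}) d : S`_d != 0 -> (d < size S)%N.
Proof. by move=> Sd; rewrite ltnNge; apply: contra Sd => h; rewrite nth_default. Qed.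
Lemma single_root (S : {poly K}) b : S != 0 -> (forall r, root S r -> r = b) ->
  S = lead_coef S *: ('X - b%:P) ^+ (size S).-1.
Proof.
move=> S0 H; have all_b r : r \in rts S -> r = b by rewrite mem_rts // => /H.
have E : \prod_(r <- rts S) ('X - r%:P) = ('X - b%:P) ^+ size (rts S).
  elim: (rts S) all_b => [|r s IH] h; first by rewrite big_nil.
  rewrite big_cons /= exprS IH; first by rewrite (h r) // inE eqxx.
  by move=> x xs; apply: h; rewrite inE xs orbT.
have sE : size S = (size (rts S)).+1.
  by rewrite {1}(rtsE S) size_scale ?lead_coef_eq0 // E size_exp_XsubC.
by rewrite sE /= {1}(rtsE S) E.
Qed.
(** Infinity is not in the fibre, so P - a Q has degree exactly d; its only root b then has full
    multiplicity. *)
Lemma unique_fiber d P Q F a b : rat_rep d P Q F ->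
  (forall z, F z = Some a -> z = Some b) -> exists2 c, c != 0 & P - a *: Q = c *: ('X - b%:P) ^+ d.
Proof.
move=> rF uF; have [sP sQ _ _] := rF; set S := P - a *: Q.
have Sd : S`_d != 0.
  rewrite coefB coefZ; apply/eqP => /subr0_eq E; have := uF None; rewrite (ratE_inf rF).
  have [Q0|Q0] := eqVneq Q`_d 0.
    by have := rat_inf_ne0 rF; rewrite E Q0 mulr0 eqxx.
  by rewrite E mulfK // => /(_ erefl).
have sS : size S = d.+1.
  apply/eqP; rewrite eqn_leq; apply/andP; split; last exact: coef_lt_size.
  by apply: (leq_trans (size_polyD _ _)); rewrite geq_max sP size_polyN (leq_trans (size_scale_leq _ _)).
have S0 : S != 0 by rewrite -size_poly_gt0 sS.
exists (lead_coef S); first by rewrite lead_coef_eq0.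
by rewrite {1}(@single_root S b) ?sS // => r /(rat_fiber rF) /uF [].
Qed.

Lemma unlisted_line : unlisted [set: P1].
Proof.
suff H m : exists s : seq K, uniq s /\ size s = m.
  move=> l; have [s [us sm]] := H (size l).+1; apply: contrapT => nl.
  have := uniq_leq_size (s1 := [seq Some a | a <- s]) (s2 := l).
  rewrite map_inj_uniq ?us; last by move=> ? ? [].
  move=> /(_ isT); rewrite size_map sm ltnn => h; apply/notF/h => a _.
  by apply: contrapT => /negP al; apply: nl; exists a.
exists [seq i%:R | i <- iota 0 m]; rewrite size_map size_iota; split=> //.
have ne i j : (i < j)%N -> i%:R <> j%:R :> K.
  move=> ij E; have := K_char0 (n := (j - i)%N); rewrite subn_gt0 ij => /(_ isT).
  by rewrite natrB ?(ltnW ij) // E subrr eqxx.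
rewrite map_inj_uniq ?iota_uniq // => i j E.
by case: (ltngtP i j) => // h; case: (ne _ _ h).
Qed.

(* Three fully ramified fibres would give a relation
   g1 (X-b1)^d + g2 (X-b2)^d + g3 (X-b3)^d = 0, whose value and derivative at b1
   contradict b2 <> b3. *)
Lemma backward_invariant_infinite d F (A : set P1) a1 a2 a3 : (1 < d)%N -> rat_deg d F ->
  (forall z, A (F z) -> A z) -> A a1 -> A a2 -> A a3 -> uniq [:: a1; a2; a3] -> unlisted A.
Proof.
move=> d1 rF Ainv A1 A2 A3 ua; apply: contrapT => nu.
have [l Al] : exists l : seq P1, forall a, A a -> a \in l.
  apply: contrapT => h; apply: nu => l; apply: contrapT => h'; apply: h; exists l => a Aa.
  by apply: contrapT => /negP al; apply: h'; exists a.
pose s := [seq a <- undup l | `[< A a >]].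
have sA a : a \in s <-> A a.
  rewrite mem_filter mem_undup; split=> [/andP[/asboolP]|Aa] //.
  by rewrite Al // andbT; apply/asboolP.
have us : uniq s by rewrite filter_uniq // undup_uniq.
have [P0 [Q0 rF0]] := rF.
have surj a : exists z, F z = a by apply: (rat_surj rF0); apply: ltnW.
pose u a := xget None [set z | F z = a].
have uP a : F (u a) = a by exact: (xgetPex None (surj a)).
have us_inj : {in s &, injective u} by move=> a b _ _ E; rewrite -(uP a) E uP.
have u_s a : a \in s -> u a \in s by move=> /sA Aa; apply/sA/Ainv; rewrite uP.
(* The section u of F maps the finite set s injectively into itself, hence onto. So every preimage
   of a point of A is some u b, and the fibres over A are single points. *)
have uniq_fib a z : A a -> F z = a -> z = u a.
  move=> Aa Fz; have Az : A z by apply: Ainv; rewrite Fz.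
  have : z \in [seq u b | b <- s].
    have u1 : uniq [seq u b | b <- s] by rewrite map_inj_in_uniq.
    have sub : {subset [seq u b | b <- s] <= s} by move=> b /mapP[c cs ->]; apply: u_s.
    have [|_ ->] := uniq_min_size u1 sub; first by rewrite size_map.
    exact/sA.
  by move=> /mapP[b bs E]; move: Fz; rewrite E uP => ->.
have [ o1 _] := unlisted_line (None :: l); rewrite inE negb_or => /andP[].
case: o1 => [ o1|] // _ ol.
have [P [Q rG]] := rat_deg_conj o1 rF.
pose al (a : P1) : K := odflt 0 (mob o1 a).
have alE a : A a -> mob o1 a = Some (al a).
  move=> Aa; rewrite /al; case E : (mob o1 a) => [b|] //.
  by case/negP: ol; rewrite -[Some o1](_ : a = _) ?Al // -(mobK o1 a) E.
have fib a : A a -> exists2 c, c != 0 & P - al a *: Q = c *: ('X - (al (u a))%:P) ^+ d.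
  move=> Aa; apply: (unique_fiber rG) => z; rewrite -alE // => /(can_inj (mobK o1)) E.
  rewrite -alE; last by apply: Ainv; rewrite uP.
  by rewrite -(uniq_fib a _ Aa E) imobK.
have al_inj a b : A a -> A b -> al a = al b -> a = b.
  by move=> Aa Ab E; apply: (can_inj (mobK o1)); rewrite !alE // E.
have Au a : A a -> A (u a) by move=> Aa; apply: Ainv; rewrite uP.
have [c1 c10 E1] := fib _ A1; have [c2 c20 E2] := fib _ A2; have [c3 c30 E3] := fib _ A3.
move: ua; rewrite /= !inE !andbT negb_or => /andP[/andP[a12 a13] a23].
have ne a b : A a -> A b -> a != b -> al a - al b != 0.
  by move=> Aa Ab; rewrite subr_eq0; apply: contra_neq; apply: al_inj.
have neu a b : A a -> A b -> a != b -> al (u a) - al (u b) != 0.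
  by move=> Aa Ab ab; apply: ne; [exact: Au|exact: Au|]; apply: contra_neq ab => E; rewrite -(uP a) E uP.
(* Three members of the pencil spanned by P and Q are linearly dependent. *)
have rel : (al a2 - al a3) *: (P - al a1 *: Q) + (al a3 - al a1) *: (P - al a2 *: Q) +
    (al a1 - al a2) *: (P - al a3 *: Q) = 0.
  by rewrite -!mul_polyC !polyCB; ring.
rewrite E1 E2 E3 !scalerA in rel.
set b1 := al (u a1) in rel *; set b2 := al (u a2) in rel *; set b3 := al (u a3) in rel *.
set g1 := _ * c1 in rel; set g2 := _ * c2 in rel; set g3 := _ * c3 in rel.
have g20 : g2 != 0 by rewrite mulf_neq0 // ne // eq_sym.
have d0 : (0 < d)%N := ltnW d1.
have h1 : g2 * (b1 - b2) ^+ d + g3 * (b1 - b3) ^+ d = 0.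
  have := congr1 (fun p0 : {poly K} => p0.[b1]) rel; rewrite horner0 !hornerD !hornerZ !horner_exp !hornerXsubC.
  by rewrite subrr expr0n eqn0Ngt d0 mulr0 add0r.
(* The derivative at b1: the first term vanishes because d > 1, and the factor d is divided out in
   characteristic 0. *)
have h2 : g2 * (b1 - b2) ^+ d.-1 + g3 * (b1 - b3) ^+ d.-1 = 0.
  have := congr1 (fun p0 : {poly K} => (p0^`()).[b1]) rel.
  rewrite deriv0 horner0 !derivD !derivZ !hornerD !hornerZ !deriv_exp !derivXsubC !mul1r.
  rewrite !hornerMn !horner_exp !hornerXsubC subrr expr0n -subn1 subn_eq0 leqNgt d1 mul0rn mulr0 add0r.
  rewrite !mulrnAr -mulrnDl; move/eqP; rewrite -mulr_natr mulf_eq0 (negbTE (K_char0 d0)) orbF.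
  by move/eqP.
have n12 : b1 - b2 != 0 by apply: neu.
have : g2 * (b1 - b2) ^+ d.-1 * (b3 - b2) = 0.
  have dE : d = d.-1.+1 by rewrite prednK.
  have -> : b3 - b2 = (b1 - b2) - (b1 - b3) by ring.
  rewrite mulrBr -mulrA -exprSr -dE.
  have -> : g2 * (b1 - b2) ^+ d = - (g3 * (b1 - b3) ^+ d) by apply/eqP; rewrite -addr_eq0 h1.
  have -> : g2 * (b1 - b2) ^+ d.-1 = - (g3 * (b1 - b3) ^+ d.-1) by apply/eqP; rewrite -addr_eq0 h2.
  by rewrite mulNr opprK -(mulrA g3) -exprSr -dE addNr.
have n32 : b3 - b2 != 0 by apply: neu; rewrite // eq_sym.
apply/eqP; apply: mulf_neq0 n32; apply: mulf_neq0 => //; exact: expf_neq0.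
Qed.

(** Unless infinity is fixed, Q has degree d, so P - X Q has degree d + 1 and a root. *)
Lemma fixed_point_exists d F : rat_deg d F -> exists z, F z = z.
Proof.
move=> [P [Q rF]]; have [sP sQ _ _] := rF.
have [Qd|Qd] := eqVneq Q`_d 0; first by exists None; rewrite (ratE_inf rF) Qd eqxx.
have sQ' : size Q = d.+1 by apply/eqP; rewrite eqn_leq sQ coef_lt_size.
have [|a ra] := @K_closed (P - 'X * Q).
  rewrite -opprB size_polyN size_polyDl; rewrite mulrC size_mulX -?size_poly_gt0 ?sQ' //.
  by rewrite size_polyN ltnS.
have : P.[a] = a * Q.[a].
  by move/rootP: ra; rewrite hornerD hornerN hornerM hornerX => /subr0_eq.
move=> E; exists (Some a); rewrite (ratE rF); case: eqP => [q0|/eqP q0].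
  by have := rat_coprime rF a; rewrite E q0 mulr0 eqxx.
by rewrite E mulfK.
Qed.

Definition attracts F z1 := exists2 d : R, 0 < d & forall w, chordal v w z1 < d ->
  forall e : R, 0 < e -> exists J, forall n, (J <= n)%N -> chordal v (iter n F w) z1 < e.
Lemma attracts_mob o F z : attracts (conj_mob o F) (mob o z) -> attracts F z.
Proof.
move=> [d d0 H]; have L0 := mob_lip_gt0 o; exists (d / mob_lip o); first by rewrite divr_gt0.
move=> w wz e e0; have [||J HJ] := H (mob o w) _ (e / mob_lip o).
- by apply: le_lt_trans (mob_lipschitz _ _ _) _; rewrite mulrC -ltr_pdivlMr.
- by rewrite divr_gt0.
exists J => n Jn; apply: le_lt_trans (mob_chordal o _ _) _; rewrite mulrC -ltr_pdivlMr //.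
by have := HJ n Jn; rewrite iter_conj_mob /conj_mob /= mobK.
Qed.

(** Without another preimage z1 is totally ramified: in an affine coordinate F(w) - z1 = c (w -
    z1)^d / Q(w) with d >= 2, so near z1 distances to it are at least halved. *)
Lemma preimage_or_attracts d F z1 : (1 < d)%N -> rat_deg d F -> F z1 = z1 ->
  (exists2 u, u <> z1 & F u = z1) \/ attracts F z1.
Proof.
move=> d1 rF Fz; have [|nu] := pselect (exists2 u, u <> z1 & F u = z1); first by left.
right; have uF z : F z = z1 -> z = z1.
  by move=> E; apply: contrapT => zz; apply: nu; exists z.
have fin G a : rat_deg d G -> G (Some a) = Some a -> (forall z, G z = Some a -> z = Some a) ->
    attracts G (Some a).
  move=> [P [Q rG]] Ga uG; have [c c0 SE] := unique_fiber rG uG.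
  have Qa : Q.[a] != 0 by move: Ga; rewrite (ratE rG); case: eqP.
  have [r r0 Hr] := noroot_radius Qa; have vQ0 : 0 < v Q.[a] by rewrite v_gt0.
  pose M := v c / v Q.[a]; have M0 : 0 < M by rewrite divr_gt0 ?v_gt0.
  pose t := Num.min r (Num.min 1 (2 * M)^-1).
  have t0 : 0 < t by rewrite !lt_min r0 ltr01 invr_gt0 mulr_gt0.
  have step w : v (w - a) < t -> exists2 w', G (Some w) = Some w' & v (w' - a) <= v (w - a) / 2.
    rewrite !lt_min => /and3P[wr w1 wM]; have [q0 vq] := Hr w wr.
    exists (P.[w] / Q.[w]); first by rewrite (ratE rG); case: eqP q0 => // E; rewrite rootE E eqxx.
    rewrite -(ler_pM2r vQ0) -{1}vq -vM mulrBl divfK //.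
    have -> : P.[w] - a * Q.[w] = (P - a *: Q).[w] by rewrite hornerD hornerN hornerZ.
    rewrite SE hornerZ horner_exp hornerXsubC vM vX -(subnKC d1) exprD.
    have x0 := v_ge0 (w - a); move: (v (w - a)) x0 w1 wM => x x0 x1 xM.
    have h1 : x ^+ (d - 2) <= 1 by rewrite exprn_ile1 // ltW.
    have h2 : v c * x <= v Q.[a] / 2.
      move: xM; rewrite -(ltr_pM2l M0) invfM mulrCA mulfV ?gt_eqF // mulr1 /M => h.
      by have := ltW h; rewrite mulrAC ler_pdivrMr // => h'; rewrite [leRHS]mulrC.
    have : v c * (x ^+ 2 * x ^+ (d - 2)) <= v c * (x ^+ 2 * 1).
      by rewrite ler_pM2l ?v_gt0 // ler_wpM2l ?exprn_ge0.
    move=> h3; apply: le_trans h3 _; rewrite mulr1 expr2 mulrA.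
    have : v c * x * x <= v Q.[a] / 2 * x by rewrite ler_wpM2r.
    by move=> h4; apply: le_trans h4 _; rewrite (mulrC (x / 2)) mulrA mulrAC.
  have itG n w : v (w - a) < t -> exists2 w', iter n G (Some w) = Some w' &
      v (w' - a) <= v (w - a) * (1 / 2) ^+ n.
    move=> wt; elim: n => [|n [w' E h]]; first by exists w; rewrite // expr0 mulr1.
    have w't : v (w' - a) < t.
      apply: le_lt_trans wt; apply: le_trans h _; rewrite ler_piMr ?v_ge0 //.
      by rewrite exprn_ile1 // ?divr_ge0 // ler_pdivrMr // mul1r ler1n.
    have [w'' E' h'] := step w' w't; exists w''; rewrite ?iterS ?E //.
    have -> : v (w - a) * (1 / 2) ^+ n.+1 = v (w - a) * (1 / 2) ^+ n / 2 by rewrite exprSr; ring.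
    by apply: le_trans h' _; rewrite ler_pM2r ?invr_gt0.
  have [s s0 Hs] := chordal_small a t0; exists s => // w /Hs [w0 -> w0t] e e0.
  have [|||J HJ] := @expr_lt_eps (1 / 2) (e / t).
  - by rewrite divr_ge0.
  - by rewrite ltr_pdivrMr // mul1r ltr1n.
  - by rewrite divr_gt0.
  exists J => n Jn; have [w' -> h] := itG n w0 w0t.
  apply: le_lt_trans (chordal_le _ _) _; apply: le_lt_trans h _.
  apply: (@le_lt_trans _ _ (t * (1 / 2) ^+ J)); last by rewrite mulrC -ltr_pdivlMr.
  apply: ler_pM; [exact: v_ge0|by rewrite exprn_ge0 ?divr_ge0|exact: ltW|].
  by apply: expr_anti; rewrite ?divr_ge0 ?ltr_pdivrMr ?mul1r ?ltr1n.
case: z1 Fz {nu} uF => [a|] Fz uF; first exact: fin.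
apply: (@attracts_mob 0); apply: fin; first exact: rat_deg_conj.
  by rewrite /conj_mob /= eqxx Fz.
move=> z E; have : F (imob 0 z) = None.
  by apply: (can_inj (mobK 0)); exact: E.
by move=> /uF E'; apply: (can_inj (imobK 0)); rewrite E' /= eqxx.
Qed.

(** * Topology of affinoids *)

Lemma small_value (e : R) : 0 < e -> exists2 c : K, c != 0 & v c < e.
Proof.
move=> e0; have h : e / 2 < e by rewrite ltr_pdivrMr // ltr_pMr // ltr1n.
by have [c c0 /andP[_ ce]] := value_dense (divr_gt0 e0 (ltr0n _ 2)) h; exists c.
Qed.
Lemma chordal_tri z u w : chordal v z w <= Num.max (chordal v z u) (chordal v u w).
Proof.
rewrite !chordalE; have nh := nz_hcoord.
move: (hcoord z) (hcoord u) (hcoord w) (nh z) (nh u) (nh w) => [x1 y1] [x2 y2] [x3 y3] h1 h2 h3.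
have n1 := nm_gt0 h1; have n2 := nm_gt0 h2; have n3 := nm_gt0 h3.
set w1 := (x1, y1) in n1 *; set w2 := (x2, y2) in n2 *; set w3 := (x3, y3) in n3 *.
set M := Num.max _ _.
have A1 : v (wedge w1 w2) <= M * (nm w1 * nm w2).
  by rewrite -ler_pdivrMr ?mulr_gt0 // le_max lexx.
have A2 : v (wedge w2 w3) <= M * (nm w2 * nm w3).
  by rewrite -ler_pdivrMr ?mulr_gt0 // le_max lexx orbT.
have bound t s1 s3 : wedge w1 w3 * t = wedge w1 w2 * s3 + wedge w2 w3 * s1 ->
    v s1 <= nm w1 -> v s3 <= nm w3 -> v (wedge w1 w3) * v t <= M * (nm w1 * nm w3) * nm w2.
  move=> E s1n s3n; rewrite -vM E; apply: vD_le; rewrite vM.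
    have -> : M * (nm w1 * nm w3) * nm w2 = M * (nm w1 * nm w2) * nm w3 by ring.
    by apply: ler_pM; rewrite ?v_ge0.
  have -> : M * (nm w1 * nm w3) * nm w2 = M * (nm w2 * nm w3) * nm w1 by ring.
  by apply: ler_pM; rewrite ?v_ge0.
rewrite ler_pdivrMr ?mulr_gt0 // -(ler_pM2r n2).
have [h|h] := leP (v x2) (v y2).
  rewrite [in leLHS]/nm max_r //; apply: (bound y2 y1 y3); rewrite ?le_max ?lexx ?orbT //.
  by rewrite /wedge /=; ring.
rewrite [in leLHS]/nm max_l ?(ltW h) //; apply: (bound x2 x1 x3); rewrite ?le_max ?lexx //.
by rewrite /wedge /=; ring.
Qed.
Lemma chordal_tri_lt z u w e : chordal v z u < e -> chordal v u w < e -> chordal v z w < e.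
Proof. by move=> h1 h2; apply: le_lt_trans (chordal_tri z u w) _; rewrite gt_max h1. Qed.
Lemma chordal_gt0 z w : (0 < chordal v z w) = (z != w).
Proof. by rewrite lt_neqAle chordal_ge0 andbT eq_sym chordal_eq0. Qed.

Lemma ball_rep (B : set P1) : P1_open_ball v B -> affinoid_rep (fun _ : 'I_1 => B) B.
Proof. by move=> bB; split=> //; apply/seteqP; split=> [w Bw i|w /(_ ord0 I)]. Qed.
Lemma affinoid_nbhs n (B : 'I_n.+1 -> set P1) X z : affinoid_rep B X -> X z ->
  exists2 e, 0 < e & forall w, chordal v w z < e -> X w.
Proof.
have fin m (C : 'I_m.+1 -> set P1) Y a : affinoid_rep C Y -> Y (Some a) ->
    exists2 e, 0 < e & forall w, chordal v w (Some a) < e -> Y w.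
  move=> rY Ya; have [s s0 Hs] := affinoid_open rY Ya; have [e e0 He] := chordal_small a s0.
  by exists e => // w /He [b ->]; apply: Hs.
move=> rX; case: z => [a|] Xz; first exact: fin rX Xz.
have [|e e0 He] := fin _ _ _ 0 (affinoid_rep_mob 0 rX); first by exists None.
exists (e / mob_lip 0) => [|w wN]; first by rewrite divr_gt0 ?mob_lip_gt0.
have [|z Xz' /(can_inj (mobK 0)) <- //] := He (mob 0 w).
by apply: le_lt_trans (mob_lipschitz 0 w None) _; rewrite mulrC -ltr_pdivlMr ?mob_lip_gt0.
Qed.

Lemma small_ball z e : 0 < e -> exists B, [/\ P1_open_ball v B, B z & forall w, B w -> chordal v w z < e].
Proof.
move=> e0; case: z => [a|].
  have [c c0 ce] := small_value e0.
  exists (K_open_ball v a (v c)); split.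
  - by exists a, (v c); split; [exists c|left].
  - by exists a; rewrite //= subrr v0 v_gt0.
  - by move=> _ [w wa <-]; apply: le_lt_trans (chordal_le _ _) (lt_trans wa ce).
have i0 : 0 < e^-1 by rewrite invr_gt0.
have h2 : e^-1 < e^-1 * 2 by rewrite ltr_pMr // ltr1n.
have [c c0 /andP[ce _]] := value_dense i0 h2.
exists (~` K_closed_ball v 0 (v c)); split.
- by exists 0, (v c); split; [exists c|right].
- by case.
- move=> [w|] nB; last by rewrite chordal_xx.
  have {}nB : v c < v w.
    by rewrite ltNge; apply/negP => h; apply: nB; exists w; rewrite //= subr0.
  rewrite chordal_SN -[e]invrK ltf_pV2 ?posrE ?max1_gt0 // lt_max.
  by rewrite (lt_trans ce).
Qed.

Lemma ball_fin (B : set P1) : P1_open_ball v B -> ~ B None -> exists a r, B = K_open_ball v a r.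
Proof.
move=> [a [r [_ [->|->]]]] nB; first by exists a, r.
by exfalso; apply: nB => -[].
Qed.
(** With the common missing point at infinity both are discs of K, and two discs with a common point
    are nested. *)
Lemma ball_nested (B C : set P1) z w : P1_open_ball v B -> P1_open_ball v C -> B z -> C z ->
  ~ B w -> ~ C w -> B `<=` C \/ C `<=` B.
Proof.
have fin (B' C' : set P1) u : P1_open_ball v B' -> P1_open_ball v C' -> B' u -> C' u ->
    ~ B' None -> ~ C' None -> B' `<=` C' \/ C' `<=` B'.
  move=> bB bC + + nB nC; have [a [r ->]] := ball_fin bB nB; have [b [s ->]] := ball_fin bC nC.
  move=> [c ca <-] [c' cb [E]]; rewrite {}E in cb; rewrite /= in ca cb.
  have rc x t d : v (c - x) < t -> v (d - x) < t -> v (d - c) < t.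
    by move=> h1 h2; apply: (vtri_lt h2); rewrite vB_sym.
  have [rs|sr] := leP r s; [left|right] => _ [d /= da <-]; exists d => //=.
    by apply: (vtri_lt _ cb); apply: lt_le_trans rs; apply: rc ca da.
  by apply: (vtri_lt _ ca); apply: lt_trans sr; apply: rc cb da.
move=> bB bC Bz Cz nB nC; case: w nB nC => [ o1|] nB nC; last exact: (fin _ _ z).
have mob_in (Y : set P1) u : (mob o1 @` Y) (mob o1 u) <-> Y u.
  by split=> [[x Yx /(can_inj (mobK o1)) <-]|Yu] //; exists u.
have pull (Y Z : set P1) : mob o1 @` Y `<=` mob o1 @` Z -> Y `<=` Z.
  by move=> h u Yu; apply/mob_in/h/mob_in.
have EN : mob o1 (Some o1) = None by rewrite /= eqxx.
have [||||h|h] := fin _ _ (mob o1 z) (P1_open_ball_mob o1 bB) (P1_open_ball_mob o1 bC).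
- exact/mob_in.
- exact/mob_in.
- by rewrite -EN => /mob_in.
- by rewrite -EN => /mob_in.
- by left; apply: pull.
- by right; apply: pull.
Qed.
Lemma ball_union (B C : set P1) z : P1_open_ball v B -> P1_open_ball v C -> B z -> C z ->
  B `|` C = setT \/ P1_open_ball v (B `|` C).
Proof.
move=> bB bC Bz Cz; have [[w nw]|all] := pselect (exists w, ~ (B `|` C) w); last first.
  by left; apply/seteqP; split=> // w _; apply: contrapT => nw; apply: all; exists w.
right; have [nB nC] : ~ B w /\ ~ C w by split=> h; apply: nw; [left|right].
have [h|h] := ball_nested bB bC Bz Cz nB nC.
  by rewrite (_ : B `|` C = C) //; apply/seteqP; split=> u; [case=> // /h|right].
by rewrite (_ : B `|` C = B) //; apply/seteqP; split=> u; [case=> // /h|left].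
Qed.

(** By distributivity the union is the intersection of all unions of a B_i with a C_j, each a ball
    or the whole line by [ball_union]. The whole line is replaced by the union of B_i0 and C_j0, a
    ball because it misses w, which does not change the intersection. *)
Lemma affinoid_union X Y z w : open_affinoid v X -> open_affinoid v Y -> X z -> Y z ->
  ~ X w -> ~ Y w -> open_affinoid v (X `|` Y).
Proof.
move=> [n [B [bB XE _]]] [m [C [bC YE _]]] Xz Yz nX nY.
have [i0 Bi0] : exists i, ~ B i w.
  by apply: contrapT => h; apply: nX; rewrite XE => i _; apply: contrapT => h'; apply: h; exists i.
have [j0 Cj0] : exists i, ~ C i w.
  by apply: contrapT => h; apply: nY; rewrite YE => i _; apply: contrapT => h'; apply: h; exists i.
have Bz i : B i z by move: Xz; rewrite XE; apply.
have Cz i : C i z by move: Yz; rewrite YE; apply.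
pose D (ij : 'I_n.+1 * 'I_m.+1) :=
  if `[< B ij.1 `|` C ij.2 = setT >] then B i0 `|` C j0 else B ij.1 `|` C ij.2.
have bD ij : P1_open_ball v (D ij).
  rewrite /D; case: asboolP => h.
    have [E|//] := ball_union (bB i0) (bC j0) (Bz i0) (Cz j0).
    by have : [set: P1] w by []; rewrite -E => -[].
  by have [//|] := ball_union (bB ij.1) (bC ij.2) (Bz _) (Cz _).
have cE : #|{: 'I_n.+1 * 'I_m.+1}|.-1.+1 = #|{: 'I_n.+1 * 'I_m.+1}|.
  by rewrite prednK // card_prod !card_ord.
exists #|{: 'I_n.+1 * 'I_m.+1}|.-1, (fun k => D (enum_val (cast_ord cE k))); split=> //; last first.
  by exists z; left.
apply/seteqP; split=> [u Xu k _|u Du].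
  have sub i j : (B i `|` C j) u by case: Xu => [|]; rewrite ?XE ?YE => h; [left|right]; apply: h.
  by rewrite /D; case: asboolP.
have {}Du ij : D ij u.
  by have := Du (cast_ord (esym cE) (enum_rank ij)) I; rewrite cast_ordKV enum_rankK.
have all i j : (B i `|` C j) u.
  have := Du (i, j); rewrite /D; case: asboolP => [E _|//]; have : [set: P1] u by [].
  by rewrite -E.
apply: contrapT => nu; have [h1 h2] : ~ X u /\ ~ Y u by split=> h; apply: nu; [left|right].
have [i Bi] : exists i, ~ B i u.
  by apply: contrapT => h; apply: h1; rewrite XE => i _; apply: contrapT => h'; apply: h; exists i.
have [j Cj] : exists i, ~ C i u.
  by apply: contrapT => h; apply: h2; rewrite YE => k _; apply: contrapT => h'; apply: h; exists k.
by case: (all i j).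
Qed.

Lemma unlisted_near z e : 0 < e -> unlisted [set w | chordal v w z < e /\ w <> z].
Proof.
have fin a t : 0 < t -> unlisted [set w | chordal v w (Some a) < t /\ w <> Some a].
  move=> t0 l.
  have gen : exists2 r, 0 < r & forall w, v (w - a) < r -> w != a -> Some w \notin l.
    elim: l => [|b l [r r0 H]]; first by exists 1.
    case: b => [b|]; last by exists r => // w h1 h2; rewrite inE /= H.
    have [->|ba] := eqVneq b a.
      by exists r => // w h1 h2; rewrite inE negb_or H // andbT; apply: contra_neq h2 => -[].
    exists (Num.min r (v (b - a))); first by rewrite lt_min r0 v_gt0 subr_eq0.
    move=> w; rewrite lt_min => /andP[h1 h2] h3; rewrite inE negb_or H // andbT.
    by apply: contraTneq h2 => -[->]; rewrite ltxx.
  have [r r0 Hr] := gen; have m0 : 0 < Num.min r t by rewrite lt_min r0.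
  have [c c0] := small_value m0.
  rewrite lt_min => /andP[cr ct]; have ac : a + c - a = c by rewrite addrAC subrr add0r.
  have aca : a + c != a by rewrite -subr_eq0 ac.
  exists (Some (a + c)); last by apply: Hr; rewrite ?ac.
  split; last by move=> [E]; move: aca; rewrite E eqxx.
  by apply: le_lt_trans (chordal_le _ _) _; rewrite ac.
case: z => [a|] e0; first exact: fin.
move=> l; have [|w [h1 h2] h3] := fin 0 (e / mob_lip 0) _ [seq mob 0 b | b <- l].
  by rewrite divr_gt0 ?mob_lip_gt0.
exists (imob 0 w); last by apply: contra h3 => h; apply/mapP; exists (imob 0 w); rewrite ?imobK.
split=> [|E]; last by apply: h2; rewrite -(imobK 0 w) E.
apply: le_lt_trans (mob_chordal 0 _ _) _; rewrite imobK mulrC -ltr_pdivlMr ?mob_lip_gt0 //.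
Qed.

Lemma equicontinuous_upto F z m e : ratmap F -> 0 < e -> exists2 d, 0 < d &
  forall i, (i < m)%N -> forall w, chordal v w z < d -> chordal v (iter i F w) (iter i F z) < e.
Proof.
move=> rF e0; elim: m => [|m [d d0 H]]; first by exists 1.
have [d' d'0 H'] := ratmap_continuous z (ratmap_iter m rF) e0.
exists (Num.min d d'); first by rewrite lt_min d0.
move=> i; rewrite ltnS leq_eqVlt => /orP[/eqP ->|im] w; rewrite lt_min => /andP[h1 h2].
  exact: H'.
exact: H.
Qed.
Lemma iter_fix (F : P1 -> P1) N j z : iter N F z = z -> iter (N * j) F z = z.
Proof. by move=> Nz; elim: j => [|j IH]; rewrite ?muln0 // mulnS iterD IH. Qed.
(** Two consecutive terms of the orbit are close to z0 and differ by one application of the N-th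
    iterate, which is continuous. *)
Lemma unif_fixed F N z0 : ratmap F -> unif (fun j => iter (N * j) F) (fun=> z0) z0 ->
  iter N F z0 = z0.
Proof.
move=> rF [d d0 H]; apply/eqP; apply: contraT => ne.
have e0 : 0 < chordal v (iter N F z0) z0 by rewrite chordal_gt0.
have [t t0 Ht] := ratmap_continuous z0 (ratmap_iter N rF) e0.
have m0 : 0 < Num.min t (chordal v (iter N F z0) z0) by rewrite lt_min t0.
have [J HJ] := H _ m0; have zz : chordal v z0 z0 < d by rewrite chordal_xx.
have := HJ J (leqnn _) z0 zz; rewrite lt_min => /andP[/Ht h1 _].
have := HJ J.+1 (leqnSn _) z0 zz; rewrite mulnS iterD lt_min => /andP[_ h2].
rewrite chordal_sym in h1; have := chordal_tri_lt h1 h2; by rewrite ltxx.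
Qed.
(** Remainders modulo N are absorbed by the equicontinuity of the first N iterates at z0. *)
Lemma unif_all F N z0 y : ratmap F -> (0 < N)%N -> iter N F z0 = z0 ->
  unif (fun j => iter (N * j) F) (fun=> z0) y -> exists2 d, 0 < d & forall e, 0 < e ->
  exists J, forall n, (J <= n)%N -> forall w, chordal v w y < d ->
    chordal v (iter n F w) (iter n F z0) < e.
Proof.
move=> rF N0 Nz [d d0 H]; exists d => // e e0.
have [t t0 Ht] := equicontinuous_upto z0 N rF e0; have [J HJ] := H t t0.
exists (N * J)%N => n Jn w wy; rewrite (divn_eq n N) addnC mulnC !iterD (iter_fix _ Nz).
apply: Ht; first by rewrite ltn_mod.
by apply: HJ => //; rewrite leq_divRL // mulnC.
Qed.

Definition converges F z0 x := forall e, 0 < e -> exists J, forall n, (J <= n)%N ->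
  chordal v (iter n F x) (iter n F z0) < e.
(** The shift i makes this the basin of the whole cycle, which is forward invariant; the basin of z0
    alone need not be. *)
Definition attracted F z0 x := exists i, converges F (iter i F z0) x.
Definition recurs F x := forall e J, 0 < e -> exists2 n, (J <= n)%N & chordal v (iter n F x) x < e.

(** If a were the only fixed point, P - X Q would be a multiple of (X - a)^(d+1). Then |F w - w| <
    |w - a| for w near a and different from it, so F preserves distances to a, against the
    convergence to a. *)
Lemma second_fixed_point d F N z0 : (0 < d)%N -> rat_deg d F -> F z0 = z0 ->
  unif (fun j => iter (N * j) F) (fun=> z0) z0 -> exists2 z1, z1 <> z0 & F z1 = z1.
Proof.
have fin G a : (0 < d)%N -> rat_deg d G -> G (Some a) = Some a ->
    unif (fun j => iter (N * j) G) (fun=> Some a) (Some a) -> exists2 z1, z1 <> Some a & G z1 = z1.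
  move=> d0 [P [Q rG]] Ga [t t0 H]; apply: contrapT => nz.
  have fixa z : G z = z -> z = Some a.
    by move=> E; apply: contrapT => h; apply: nz; exists z.
  have [sP sQ _ _] := rG.
  have Qd : Q`_d != 0.
    by apply/eqP => Qd; have := fixa None; rewrite (ratE_inf rG) Qd eqxx => /(_ erefl).
  have sQ' : size Q = d.+1 by apply/eqP; rewrite eqn_leq sQ coef_lt_size.
  pose S := P - 'X * Q; have sS : size S = d.+2.
    rewrite /S -opprB size_polyN size_polyDl; rewrite mulrC size_mulX -?size_poly_gt0 ?sQ' //.
    by rewrite size_polyN ltnS.
  have S0 : S != 0 by rewrite -size_poly_gt0 sS.
  have Pa r : root S r -> P.[r] = r * Q.[r].
    by move/rootP; rewrite hornerD hornerN hornerM hornerX => /subr0_eq.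
  have SE := single_root S0 (_ : forall r, root S r -> r = a); rewrite sS /= in SE.
  have {}SE : S = lead_coef S *: ('X - a%:P) ^+ d.+1.
    apply: SE => r rr; have := fixa (Some r); rewrite (ratE rG); case: eqP => [q0|/eqP q0].
      by have := rat_coprime rG r; rewrite Pa // q0 mulr0 eqxx.
    by rewrite Pa // mulfK // => /(_ erefl) [].
  have Qa : Q.[a] != 0 by move: Ga; rewrite (ratE rG); case: eqP.
  have [r r0 Hr] := noroot_radius Qa; have vQ0 : 0 < v Q.[a] by rewrite v_gt0.
  pose M := v (lead_coef S) / v Q.[a]; have M0 : 0 < M by rewrite divr_gt0 ?v_gt0 ?lead_coef_eq0.
  pose s := Num.min r (Num.min 1 M^-1); have s0 : 0 < s by rewrite !lt_min r0 ltr01 invr_gt0.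
  have step w : v (w - a) < s -> exists2 w', G (Some w) = Some w' & v (w' - a) = v (w - a).
    rewrite !lt_min => /and3P[wr w1 wM]; have [q0 vq] := Hr w wr.
    exists (P.[w] / Q.[w]); first by rewrite (ratE rG); case: eqP q0 => // E; rewrite rootE E eqxx.
    have [->|wa] := eqVneq w a.
      by move: Ga; rewrite (ratE rG) (negbTE Qa) => -[->].
    have wa0 : 0 < v (w - a) by rewrite v_gt0 subr_eq0.
    apply: (@vtri_eq w); rewrite -(ltr_pM2r vQ0) -{1}vq -vM mulrBl divfK //.
    have -> : P.[w] - w * Q.[w] = S.[w] by rewrite /S hornerD hornerN hornerM hornerX.
    rewrite SE hornerZ horner_exp hornerXsubC vM vX exprS mulrCA ltr_pM2l //.
    rewrite (_ : v (lead_coef S) = M * v Q.[a]); last by rewrite /M divfK ?gt_eqF.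
    rewrite mulrAC -[ltRHS]mul1r ltr_pM2r // -(prednK d0) exprS.
    move: (v (w - a)) wa0 w1 wM => x x0 x1 xM.
    have h1 : x ^+ d.-1 <= 1 by rewrite exprn_ile1 // ltW.
    apply: (@le_lt_trans _ _ (M * x)); last by rewrite mulrC -ltr_pdivlMr // mul1r.
    by rewrite ler_pM2l // ler_piMr // ltW.
  have itG n w : v (w - a) < s -> exists2 w', iter n G (Some w) = Some w' & v (w' - a) = v (w - a).
    move=> ws; elim: n => [|n [w' E h]]; first by exists w.
    by rewrite iterS E -h; apply: step; rewrite h.
  have m0 : 0 < Num.min s t by rewrite lt_min s0.
  have [c c0] := small_value m0.
  rewrite lt_min => /andP[cs ct]; have ac : a + c - a = c by rewrite addrAC subrr add0r.
  have vc : 0 < v c by rewrite v_gt0.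
  have [e e0 He] := chordal_small a vc.
  have [J HJ] := H e e0; have := HJ J (leqnn _) (Some (a + c)).
  have -> : chordal v (Some (a + c)) (Some a) < t.
    by apply: le_lt_trans (chordal_le _ _) _; rewrite ac.
  have [|w' -> h] := itG (N * J)%N (a + c); first by rewrite ac.
  by move=> /(_ isT) /He [b [<-]]; rewrite h ac ltxx.
move=> d0 rF Fz hu; case: z0 Fz hu => [a|] Fz hu; first exact: (fin F).
have [|||z1 z1n Fz1] := fin (conj_mob 0 F) 0 d0.
- exact: rat_deg_conj.
- by rewrite /conj_mob /= eqxx Fz.
- have -> : (fun j => iter (N * j) (conj_mob 0 F)) = (fun j => conj_mob 0 (iter (N * j) F)).
    by apply: funext => j; rewrite iter_conj_mob.
  exact: (iffRL (unif_mob 0 _ _ _) hu).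
exists (imob 0 z1); last by rewrite -{2}Fz1 /conj_mob /= mobK.
by move=> E; apply: z1n; rewrite -(imobK 0 z1) E.
Qed.

Lemma attracted_map F z0 x : attracted F z0 x -> attracted F z0 (F x).
Proof.
move=> [i H]; exists i.+1 => e /H [J HJ]; exists J => n Jn.
by rewrite iterS -!iterSr; apply: HJ; apply: leqW.
Qed.
Lemma attracted_fixed F z0 N z1 : (0 < N)%N -> iter N F z0 = z0 -> F z1 = z1 ->
  attracted F z0 z1 -> z1 = z0.
Proof.
move=> N0 Nz Fz1 [i H].
have fz1 n : iter n F z1 = z1 by elim: n => // n IH; rewrite iterS IH.
apply/eqP; apply: contraT => ne; have e0 : 0 < chordal v z1 z0 by rewrite chordal_gt0.
have [J HJ] := H _ e0; have le : (i <= N * (J + i))%N by apply: leq_trans (leq_pmull _ N0); apply: leq_addl.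
have := HJ (N * (J + i) - i)%N; rewrite fz1 -iterD subnK // iter_fix // ltxx; apply.
by rewrite leq_subRL // addnC leq_pmull.
Qed.
Lemma three_of_unlisted (A : set P1) : unlisted A -> exists a b c,
  [/\ a <> b, a <> c & b <> c] /\ [/\ A a, A b & A c].
Proof.
move=> uA; have [a Aa _] := uA [::]; have [b Ab] := uA [:: a]; rewrite inE => /eqP ba.
have [c Ac] := uA [:: a; b]; rewrite !inE negb_or => /andP[/eqP ca /eqP cb].
by exists a, b, c; split; split=> // E; [apply: ba|apply: ca|apply: cb].
Qed.

(** A fixed point z1 different from z0 is not attracted. Either it has another preimage u, and then
    u and a preimage u' of u are not attracted either, or it attracts a neighbourhood, whose points
    are therefore lost for the cycle of z0. *)
Lemma attracted_complement d F N z0 : (1 < d)%N -> rat_deg d F -> (0 < N)%N ->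
  unif (fun j => iter (N * j) F) (fun=> z0) z0 -> exists a b c,
  [/\ a <> b, a <> c & b <> c] /\ [/\ ~ attracted F z0 a, ~ attracted F z0 b & ~ attracted F z0 c].
Proof.
move=> d1 rF N0 hu; have rF' := rat_deg_ratmap rF; have Nz := unif_fixed rF' hu.
have [z1 Fz1 nz1] : exists2 z1, F z1 = z1 & ~ attracted F z0 z1.
  have [Fz0|nF] := pselect (F z0 = z0).
    have [z1 z1n Fz1] := second_fixed_point (ltnW d1) rF Fz0 hu; exists z1 => //.
    by move=> /(attracted_fixed N0 Nz Fz1).
  have [z1 Fz1] := fixed_point_exists rF; exists z1 => //.
  by move=> /(attracted_fixed N0 Nz Fz1) E; apply: nF; rewrite -E.
have [[u uz Fu]|[t t0 at1]] := preimage_or_attracts d1 rF Fz1.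
  have [P [Q rPQ]] := rF; have [u' Fu'] := rat_surj rPQ (ltnW d1) u.
  have nu : ~ attracted F z0 u by move=> /attracted_map; rewrite Fu.
  have nu' : ~ attracted F z0 u' by move=> /attracted_map; rewrite Fu'.
  exists z1, u, u'; split=> //; split=> E.
  - by apply: uz.
  - by apply: uz; rewrite -Fu' -E.
  - by apply: uz; rewrite -Fu E Fu'.
suff /three_of_unlisted [a [b [c [? [[? _] [? _] [? _]]]]]] :
    unlisted [set w | ~ attracted F z0 w /\ w <> z1] by exists a, b, c.
move=> l; have [w [wt wz] wl] := unlisted_near z1 t0 l; exists w => //; split=> // -[i H].
apply: nz1; exists i => e e0; have [J HJ] := H e e0; have [J' HJ'] := at1 w wt e e0.
exists (maxn J J') => n; rewrite geq_max => /andP[h1 h2].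
apply: (chordal_tri_lt _ (HJ n h1)); rewrite chordal_sym.
by rewrite (_ : iter n F z1 = z1); [apply: HJ'|elim: (n) => //= k ->].
Qed.

Lemma recurs_map F x : ratmap F -> recurs F x -> recurs F (F x).
Proof.
move=> rF H e J e0; have [t t0 Ht] := ratmap_continuous x rF e0.
by have [n Jn h] := H t J t0; exists n => //; rewrite -iterSr; apply: Ht.
Qed.
(** A point other than the fixed point z1 that reaches z1 never comes back. If z1 has no other
    preimage, it attracts its neighbours, which are not recurrent. *)
Lemma nonrecurrent_points d F : (1 < d)%N -> rat_deg d F -> exists a b c,
  [/\ a <> b, a <> c & b <> c] /\ [/\ ~ recurs F a, ~ recurs F b & ~ recurs F c].
Proof.
move=> d1 rF; have [z1 Fz1] := fixed_point_exists rF.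
have fz1 n : iter n F z1 = z1 by elim: n => //= n ->.
have [[u uz Fu]|[t t0 at1]] := preimage_or_attracts d1 rF Fz1; last first.
  suff /three_of_unlisted : unlisted [set w | ~ recurs F w] by [].
  move=> l; have [w [wt wz] wl] := unlisted_near z1 t0 l; exists w => // rw.
  have e0 : 0 < chordal v w z1 by rewrite chordal_gt0; apply/eqP.
  have [J HJ] := at1 w wt _ e0; have [n Jn h] := rw _ J e0.
  by rewrite chordal_sym in h; have := chordal_tri_lt h (HJ n Jn); rewrite ltxx.
have [P [Q rPQ]] := rF; have [u' Fu'] := rat_surj rPQ (ltnW d1) u.
have [u'' Fu''] := rat_surj rPQ (ltnW d1) u'.
have nr w m : w <> z1 -> iter m F w = z1 -> ~ recurs F w.
  move=> wz E H; have e0 : 0 < chordal v z1 w by rewrite chordal_gt0 eq_sym; apply/eqP.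
  by have [n mn] := H _ m e0; rewrite -(subnK mn) iterD E fz1 ltxx.
exists u, u', u''; split; split.
- by move=> E; apply: uz; rewrite -Fu E Fu'.
- by move=> E; apply: uz; rewrite -Fu' -Fu'' -E Fu Fz1.
- move=> E; have E2 : u = u' by rewrite -{1}Fu' {1}E.
  by apply: uz; rewrite -Fu {2}E2 Fu'.
- by apply: (nr _ 1%N).
- by apply: (nr _ 2); rewrite /= ?Fu' //; move=> E; apply: uz; rewrite -Fu' E.
- apply: (nr _ 3); rewrite /= ?Fu'' ?Fu' // => E; apply: uz; rewrite -Fu' -Fu'' E.
  by rewrite !Fz1.
Qed.

(** If |l| >= 1, the n-th iterate does not decrease distances to a nearby, so the orbit of a + c
    stays at distance at least |c| from a, against the uniform convergence. *)
Lemma attracting_multiplier F a n N : ratmap F -> (0 < n)%N -> iter n F (Some a) = Some a ->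
  (0 < N)%N -> unif (fun j => iter (N * j) F) (fun=> Some a) (Some a) ->
  exists2 l, has_derivative_at v (iter n F) a l & v l < 1.
Proof.
move=> rF n0 Fa N0 hu; have [d [P [Q rG]]] := ratmap_iter n rF.
have Qa : Q.[a] != 0 by move: Fa; rewrite (ratE rG); case: eqP.
have : root (P - a *: Q) a by apply/(rat_fiber rG).
move=> /factor_theorem[T TE]; pose l := T.[a] / Q.[a].
have [r [M [r0 M0 H]]] := @quotient_local T Q a l Qa erefl.
have slope z : z != a -> v (z - a) < r -> exists2 w, iter n F (Some z) = Some w &
    v ((w - a) / (z - a) - l) <= M * v (z - a).
  move=> za zr; have [q0 h] := H z zr; exists (P.[z] / Q.[z]); first by rewrite (ratE rG) (negbTE q0).
  have -> : (P.[z] / Q.[z] - a) / (z - a) = T.[z] / Q.[z] => //.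
  have za0 : z - a != 0 by rewrite subr_eq0.
  apply: (mulIf za0); rewrite divfK // mulrAC -[_ * (z - a)](_ : (P - a *: Q).[z] = _).
    by rewrite hornerD hornerN hornerZ mulrBl mulfK.
  by rewrite TE hornerM hornerXsubC.
have der e : 0 < e -> exists2 t, 0 < t & forall z, z != a -> v (z - a) < t ->
    exists2 w, iter n F (Some z) = Some w & v ((w - a) / (z - a) - l) < e.
  move=> e0; exists (Num.min r (e / M)); first by rewrite lt_min r0 divr_gt0.
  move=> z za; rewrite lt_min => /andP[zr ze]; have [w E h] := slope z za zr; exists w => //.
  by apply: le_lt_trans h _; rewrite mulrC -ltr_pdivlMr.
exists l; first exact: der.
rewrite ltNge; apply/negP => l1; have l0 := lt_le_trans ltr01 l1.
have [t t0 Ht] := der _ l0.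
have expand z : z != a -> v (z - a) < t -> exists2 w, iter n F (Some z) = Some w &
    v (z - a) <= v (w - a).
  move=> za zt; have [w E h] := Ht z za zt; exists w => //.
  have vw : v ((w - a) / (z - a)) = v l by rewrite -[_ / _](subrK l) vD_eq.
  have z0 : 0 < v (z - a) by rewrite v_gt0 subr_eq0.
  by move: l1; rewrite -vw vM vV ler_pdivlMr // mul1r.
have Nz := unif_fixed rF hu; have [d' d'0 Hall] := unif_all rF N0 Nz hu.
have [e e0 He] := chordal_small a t0; have [J HJ] := Hall e e0.
have [d'' d''0 Hup] := equicontinuous_upto (Some a) J rF e0.
have m0 : 0 < Num.min d' d'' by rewrite lt_min d'0.
have [c c0] := small_value m0.
rewrite lt_min => /andP[cd' cd'']; have ac : a + c - a = c by rewrite addrAC subrr add0r.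
have wd : chordal v (Some (a + c)) (Some a) <= v c by apply: le_trans (chordal_le _ _) _; rewrite ac.
(* Iterates beyond J are close by uniform convergence, the earlier ones by continuity. *)
have near m : exists2 w, iter (n * m) F (Some (a + c)) = Some w & v (w - a) < t.
  apply: He; rewrite -{1}(iter_fix m Fa); have [Jm|mJ] := leqP J (n * m); first exact/HJ/le_lt_trans/cd'.
  exact/Hup/le_lt_trans/cd''.
have grow m : exists2 w, iter (n * m) F (Some (a + c)) = Some w & v c <= v (w - a).
  elim: m => [|m [w E h]]; first by exists (a + c); rewrite ?muln0 ?ac.
  have [w' E' h'] := near m; move: E'; rewrite E => -[E']; subst w'.
  have wa : w != a by rewrite -subr_eq0 -v_gt0 (lt_le_trans _ h) // v_gt0.
  have [w'' E'' h''] := expand w wa h'; exists w''; first by rewrite mulnS iterD E.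
  exact: le_trans h''.
have vc : 0 < v c by rewrite v_gt0.
have [s s0 Hs] := chordal_small a vc; have [J' HJ'] := Hall s s0.
have [w E h] := grow J'; have := HJ' (n * J')%N; rewrite leq_pmull // => /(_ isT (Some (a + c))).
by rewrite (le_lt_trans wd cd') E (iter_fix _ Fa) => /(_ isT) /Hs [b [<-]]; rewrite ltNge h.
Qed.

(** * Components of the Fatou set *)

Lemma cvg0P (u : nat -> R) : (forall n, 0 <= u n) -> (u n @[n --> \oo] --> (0 : R)) <->
  forall e, 0 < e -> exists J, forall n, (J <= n)%N -> u n < e.
Proof.
move=> u0; split=> [/cvgrPdist_lt H e /H [J _ HJ]|H].
  by exists J => n /HJ /=; rewrite sub0r normrN ger0_norm.
apply/cvgrPdist_lt => e /H [J HJ]; exists J => // n /HJ.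
by rewrite /= sub0r normrN ger0_norm.
Qed.

Section Component.
Variable f : {fraction {poly K}}.
Hypothesis f_deg : (2 <= ratdeg f)%N.
Local Notation F := (rateval f).
Let rF : rat_deg (ratdeg f) F. Proof. by do 2 eexists; apply: ratmap_rateval. Qed.
Let rmF : ratmap F. Proof. exact: rat_deg_ratmap rF. Qed.

Lemma orbit_unionE X : orbit_union f X = orbits F X.
Proof. by apply/seteqP; split=> [w [n _ [z Xz E]]|w [n [z Xz E]]]; exists n => //; exists z. Qed.
Lemma basinE z0 x : basin v f z0 x <-> converges F z0 x.
Proof. by apply: cvg0P => n; apply: chordal_ge0. Qed.
Lemma recurrent_recurs x : recurrent v f x -> recurs F x.
Proof.
move=> [s /cvgnyPge hs /cvg0P H] e J e0; have [J1 _ h1] := hs J.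
have [|J2 h2] := H _ e e0; first by move=> n; apply: chordal_ge0.
exists (s (maxn J1 J2)); first by apply: h1; rewrite /= leq_maxl.
by apply: h2; rewrite leq_maxr.
Qed.

Lemma affinoid_in_Fatou X : open_affinoid v X -> omits3 (orbits F X) -> X `<=` Fatou v f.
Proof.
move=> [n [B [bB XE _]]] oX w Xw; exists X; last by rewrite orbit_unionE.
by have [e e0 He] := affinoid_nbhs (conj bB XE) Xw; exists e => // u /=; rewrite chordal_sym; apply: He.
Qed.
Lemma componentI X x y : open_affinoid v X -> omits3 (orbits F X) -> X x -> X y ->
  Fatou_component v f x y.
Proof.
by move=> aX oX Xx Xy; exists X => //; split=> //; [apply: affinoid_in_Fatou|rewrite orbit_unionE].
Qed.
Lemma componentE x y : Fatou_component v f x y -> exists X,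
  [/\ open_affinoid v X, omits3 (orbits F X), X x & X y].
Proof. by move=> [X [aX _ Xx]]; rewrite orbit_unionE => oX Xy; exists X. Qed.
Lemma component_refl x : Fatou v f x -> Fatou_component v f x x.
Proof.
move=> [X [e e0 HX]]; rewrite orbit_unionE => -[a [b [c [ne [na nb nc]]]]].
have [B [bB Bx HB]] := small_ball x e0.
have sub w : orbits F B w -> orbits F X w.
  by move=> [m [z Bz <-]]; exists m, z => //; apply: HX; rewrite /= chordal_sym; apply: HB.
apply: (@componentI B) => //.
  by have [h1 h2] := ball_rep bB; exists 0%N, (fun=> B); split=> //; exists x.
by exists a, b, c; split=> //; split=> /sub.
Qed.

(** The complement of the orbit of X is backward invariant, so the three omitted values yield
    infinitely many. *)
Lemma vitali_orbit X s phi x y : open_affinoid v X -> omits3 (orbits F X) -> X x -> X y ->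
  (phi = id \/ exists z0, phi = fun=> z0) ->
  unif (fun j => iter (s j) F) phi x -> unif (fun j => iter (s j) F) phi y.
Proof.
move=> [n [B [bB XE _]]] [a [b [c [[ab ac bc] [na nb nc]]]]] Xx Xy hphi.
apply: (vitali (A := ~` orbits F X) (conj bB XE) Xx Xy) => //.
- apply: (backward_invariant_infinite f_deg rF _ na nb nc).
    by move=> z nz Oz; apply: nz; apply: orbits_map.
  by rewrite /= !inE negb_or !andbT; apply/andP; split; [apply/andP; split|]; apply/eqP.
- by move=> j; apply: ratmap_iter.
- move=> w nw; split=> [/(sub_orbits F)|j z Xz E] //.
  by apply: nw; exists (s j), z.
Qed.

(** N is only a multiple of the primitive period, which is obtained as a least element; at infinity
    the multiplier is found after conjugation with z -> 1 / z. *)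
Lemma attracting_of_unif z0 N : (0 < N)%N ->
  unif (fun j => iter (N * j) F) (fun=> z0) z0 -> attracting_periodic v f z0.
Proof.
move=> N0 hu; have Nz := unif_fixed rmF hu.
pose per n := (0 < n)%N && (iter n F z0 == z0).
have exper : exists n, per n by exists N; rewrite /per N0 Nz eqxx.
case: (ex_minnP exper) => n /andP[n0 /eqP nz] nmin.
have pp : primitive_period f z0 n.
  by split=> // m m0 mz; apply: nmin; rewrite /per m0; apply/eqP.
exists n; case: z0 hu Nz nz pp {per exper nmin} => [a|] hu Nz nz pp.
  by have [l dl l1] := attracting_multiplier rmF n0 nz N0 hu; exists l.
have rG := ratmap_conj_mob 0 rmF.
have E m : iter m (conj_mob 0 F) = conj_mob 0 (iter m F) := iter_conj_mob 0 F m.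
have hu' : unif (fun j => iter (N * j) (conj_mob 0 F)) (fun=> Some 0) (Some 0).
  have -> : (fun j => iter (N * j) (conj_mob 0 F)) = (fun j => conj_mob 0 (iter (N * j) F)).
    by apply: funext => j; rewrite E.
  exact: (iffRL (unif_mob 0 _ _ _) hu).
have nz' : iter n (conj_mob 0 F) (Some 0) = Some 0 by rewrite E /conj_mob /= eqxx nz.
have [l dl l1] := attracting_multiplier rG n0 nz' N0 hu'; exists l; split=> //.
move: dl; rewrite E /has_multiplier /conj_mob mob0E.
suff -> : imob 0 = @P1_inv K by [].
by apply: funext => -[w|] //=; rewrite add0r.
Qed.

Lemma classification C0 :
  (exists2 x, Fatou v f x & C0 = Fatou_component v f x) ->
  (exists2 k : nat, (1 <= k)%N & ratiter f k @` C0 = C0) ->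
  (exists2 z0, attracting_periodic v f z0 & C0 = immediate_basin v f z0)
  \/ (exists2 x, quasi_periodicity_domain v f x
        & C0 = analytic_component v (quasi_periodicity_domain v f) x).
Proof.
move=> [x Fx CE] [k k0 kC].
have CP y : C0 y <-> exists X, [/\ open_affinoid v X, omits3 (orbits F X), X x & X y].
  rewrite CE; split; first exact: componentE.
  by move=> [X [aX oX Xx Xy]]; apply: componentI aX oX Xx Xy.
have Cx : C0 x by rewrite CE; apply: component_refl.
have sub X y : open_affinoid v X -> omits3 (orbits F X) -> X x -> X y -> C0 y.
  by move=> aX oX Xx Xy; apply/CP; exists X.
have gC y : C0 y -> C0 (iter k F y) by move=> Cy; rewrite -kC; exists y.
have /CP[X1 [aX1 oX1 X1x X1gx]] := gC x Cx.
have rg := ratmap_iter k rmF.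
have orbC y : orbits (iter k F) X1 y -> C0 y.
  move=> [m [z X1z <-]]; elim: m => [|m IH]; first exact: sub X1z.
  by rewrite iterS; apply: gC.
have orbF y : orbits (iter k F) X1 y -> orbits F X1 y.
  move=> [m [z X1z <-]]; exists (k * m)%N, z => //.
  by elim: m => [|m IH]; rewrite ?muln0 // mulnS iterD IH.
have [z Vz gz] : has_good (iter k F) (orbits (iter k F) X1).
  have [a [b [c [[ab _ _] [na nb _]]]]] := oX1; have [n [B [bB XE _]]] := aX1.
  by apply: (good_exists (conj bB XE) rg X1x X1gx ab) => /orbF.
have {gz} gz := good_iter k0 gz; have Cz := orbC _ Vz.
(* Two affinoids through the base point lead from z to x and from x to y. *)
have spread s phi y : (phi = id \/ exists z0, phi = fun=> z0) ->
    unif (fun j => iter (s j) F) phi z -> C0 y -> unif (fun j => iter (s j) F) phi y.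
  move=> hphi hz /CP[Y [aY oY Yx Yy]]; have /CP[Z [aZ oZ Zx Zz]] := Cz.
  exact: (vitali_orbit aY oY Yx Yy hphi (vitali_orbit aZ oZ Zz Zx hphi hz)).
case: gz => [[z0 [N [N0 hz hz0]]]|[s sj hz]].
  left; have hC y := spread (fun j => N * j)%N (fun=> z0) y (or_intror (ex_intro _ z0 erefl)) hz.
  have Nz := unif_fixed rmF hz0.
  have bC y : C0 y -> converges F z0 y.
    move=> /hC /(unif_all rmF N0 Nz) [d d0 H] e /H [J HJ]; exists J => n Jn.
    by apply: HJ => //; rewrite chordal_xx.
  have [a [b [c [ne [na nb nc]]]]] := attracted_complement f_deg rF N0 hz0.
  have att y : converges F z0 y -> attracted F z0 y by exists 0%N.
  have omits X : (forall y, X y -> converges F z0 y) -> omits3 (orbits F X).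
    move=> HX; have HX' w : orbits F X w -> attracted F z0 w.
      move=> [m [u Xu <-]]; elim: m => [|m IH]; first exact/att/HX.
      by rewrite iterS; apply: attracted_map.
    by exists a, b, c; split=> //; split=> /HX'.
  (* Maximality: an affinoid of attracted points that meets one in the component can be added to it,
     as the union is again an affinoid and omits a, b and c. *)
  have join X Y w : open_affinoid v X -> open_affinoid v Y -> X w -> Y w ->
      (forall y, X y -> converges F z0 y) -> (forall y, Y y -> converges F z0 y) ->
      open_affinoid v (X `|` Y) /\ omits3 (orbits F (X `|` Y)).
    move=> aX aY Xw Yw bX bY; split; last by apply: omits => y [/bX|/bY].
    by apply: (affinoid_union aX aY Xw Yw (w := a)) => [/bX/att|/bY/att].
  (* The iterate of x of order k N J stays in C0, being a multiple of k, and is close to z0, being a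
     multiple of N. So it lies in a small ball D of the basin, which is joined to C0. *)
  have Cz0 : C0 z0.
    have [d d0 H] := unif_all rmF N0 Nz hz0; have [D [bD Dz0 HD]] := small_ball z0 d0.
    have bDc y : D y -> converges F z0 y.
      by move=> /HD Dy e /H [J HJ]; exists J => n Jn; apply: HJ.
    have aD : open_affinoid v D.
      by have [h1 h2] := ball_rep bD; exists 0%N, (fun=> D); split=> //; exists z0.
    have [e e0 He] := affinoid_nbhs (ball_rep bD) Dz0.
    have [J HJ] := bC x Cx e e0; pose w := iter (k * (N * J)) F x.
    have Dw : D w.
      apply: He; rewrite -{1}(iter_fix (k * J) Nz) mulnCA; apply: HJ.
      by rewrite mulnA leq_pmull // muln_gt0 k0.
    have Cw : C0 w by rewrite /w; elim: (N * J)%N => [|m IH]; rewrite ?muln0 // mulnS iterD; apply: gC.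
    have /CP[Y [aY oY Yx Yw]] := Cw.
    have bY y : Y y -> converges F z0 y by move=> Yy; apply/bC/(sub Y).
    have [aU oU] := join Y D w aY aD Yw Dw bY bDc.
    by apply: (sub _ _ aU oU); [left|right].
  have /CP[Z [aZ oZ Zx Zz0]] := Cz0.
  have bZ y : Z y -> converges F z0 y by move=> Zy; apply/bC/(sub Z).
  exists z0; first exact: attracting_of_unif hz0.
  apply/seteqP; split=> [y /CP[Y [aY oY Yx Yy]]|y [Y [aY bY Yz0] Yy]].
    have bY u : Y u -> converges F z0 u by move=> Yu; apply/bC/(sub Y).
    have [aU oU] := join Y Z x aY aZ Yx Zx bY bZ.
    exists (Y `|` Z); last by left.
    by split=> //; [move=> u [/bY|/bZ] /basinE|right].
  have bY' u : Y u -> converges F z0 u by move=> /bY /basinE.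
  have [aU oU] := join Y Z z0 aY aZ Yz0 Zz0 bY' bZ.
  by apply: (sub _ _ aU oU); [right|left].
right; have hC y := spread s id y (or_introl erefl) hz.
have rC y : C0 y -> recurrent v f y.
  move=> /hC [d d0 H]; exists s.
    by apply/cvgnyPge => A; exists A => // j /= Aj; apply: leq_trans (sj j).
  apply/cvg0P => [n|e /H [J HJ]]; first exact: chordal_ge0.
  by exists J => n Jn; apply: HJ; rewrite ?chordal_xx.
have EC y : C0 y -> quasi_periodicity_domain v f y.
  move=> /CP[Y [aY oY Yx Yy]]; have [n [B [bB YE _]]] := aY.
  have [e e0 He] := affinoid_nbhs (conj bB YE) Yy; exists e => // w /=; rewrite chordal_sym => /He Yw.
  exact/rC/(sub Y).
exists x; first exact: EC.
apply/seteqP; split=> [y /CP[Y [aY oY Yx Yy]]|y [Y [aY eY Yx] Yy]].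
  by exists Y => //; split=> // w Yw; apply/EC/(sub Y).
(* Recurrence passes to images, so an affinoid of recurrent points has an orbit that omits the three
   nonrecurrent points. *)
have [a [b [c [ne [na nb nc]]]]] := nonrecurrent_points f_deg rF.
apply: (sub Y) => //; have HY w : orbits F Y w -> recurs F w.
  move=> [m [u Yu <-]]; elim: m => [|m IH]; last by rewrite iterS; apply: recurs_map.
  have [e e0 He] := eY u Yu; apply/recurrent_recurs/He; by rewrite /= chordal_xx.
by exists a, b, c; split=> //; split=> /HY.
Qed.
End Component.

End Dynamics.

(** * The field of p-adic complex numbers *)

Lemma finite_pigeonhole (T : finType) (c : nat -> T) : exists i j, (i < j)%N /\ c i = c j.
Proof.
pose l := [seq c i | i <- iota 0 #|T|.+1].
have : ~~ uniq l.
  by apply/negP => /card_uniqP; rewrite size_map size_iota => h; have := max_card (mem l); rewrite h ltnn.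
have sl : size l = #|T|.+1 by rewrite size_map size_iota.
have [x0 _] : exists x0 : T, true by exists (c 0%N).
move=> /(uniqPn x0) [i [j [ij jm]]]; rewrite sl in jm.
rewrite !(nth_map 0%N) ?size_iota ?(ltn_trans ij) // !nth_iota ?(ltn_trans ij) // !add0n => E.
by exists i, j.
Qed.

Section IntegersModP.
Variables (R : realType) (L : fieldType) (w : L -> R) (p : nat).
Hypotheses (w_um : ultrametric_abs w) (p_prime : prime p) (w_p : w p%:R < 1).

Lemma abs_int_le1 (m : int) : w m%:~R <= 1.
Proof.
case: m => n; first exact: v_nat_le1.
by rewrite NegzE mulrNz vN // v_nat_le1.
Qed.
Lemma abs_int_dvd (m : int) : (p %| m)%Z -> w m%:~R < 1.
Proof.
move=> /dvdzP[q ->]; rewrite intrM vM //; apply: le_lt_trans w_p.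
by rewrite ler_piMl ?v_ge0 ?abs_int_le1.
Qed.
Lemma bezout_prime (m : int) : ~~ (p %| m)%Z -> exists u t, u * m + t * p%:Z = 1.
Proof.
move=> pm; have /coprimezP[[u t] E] : coprimez m p.
  by rewrite coprimezE /= coprime_sym prime_coprime //.
by exists u, t.
Qed.
Lemma abs_int_unit (m : int) : ~~ (p %| m)%Z -> w m%:~R = 1.
Proof.
move=> /bezout_prime [u [t E]]; apply/eqP; rewrite eq_le abs_int_le1 leNgt; apply/negP => h.
have : w (u * m + t * p%:Z)%:~R < 1.
  rewrite intrD; apply: vD_lt => //; last by apply: abs_int_dvd; rewrite dvdz_mull.
  by rewrite intrM vM //; apply: le_lt_trans h; rewrite ler_piMl ?v_ge0 ?abs_int_le1.
by rewrite E v1 // ltxx.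
Qed.
(** If p divided the denominator, the numerator would be a unit and |b| > 1. Otherwise the
    denominator has an inverse u modulo p, and the numerator times u is the residue. *)
Lemma rat_residue (i : {rmorphism rat -> L}) b : w (i b) <= 1 -> exists e : int, w (i b - e%:~R) < 1.
Proof.
have bE : i b * (denq b)%:~R = (numq b)%:~R.
  rewrite -(rmorph_int i (denq b)) -(rmorph_int i (numq b)) -rmorphM -{1}(divq_num_den b) divfK //.
  by rewrite intr_eq0 denq_neq0.
have [pd b1|pd b1] := boolP (p %| denq b)%Z.
  have pn : ~~ (p %| numq b)%Z.
    apply/negP => pn; rewrite !dvdzE /= in pd pn.
    by have := coprime_dvdl pn (coprime_num_den b); rewrite prime_coprime // pd.
  have := abs_int_unit pn; rewrite -bE vM // => E; have := abs_int_dvd pd.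
  rewrite ltNge -E => /negP; case; by rewrite ler_piMl ?v_ge0.
have [u [t E]] := bezout_prime pd; exists (numq b * u).
rewrite -[ltLHS]mulr1 -[X in _ * X < _](abs_int_unit pd) -vM // mulrBl bE -intrM -intrB.
apply: abs_int_dvd; have -> : numq b - numq b * u * denq b = numq b * (1 - u * denq b) by ring.
by rewrite -E addrAC subrr add0r mulrA dvdz_mull.
Qed.
Lemma int_poly_le1 (S : {poly int}) x : w x <= 1 -> w (map_poly intr S).[x] <= 1.
Proof.
move=> x1; elim/poly_ind: S => [|S c IH]; first by rewrite map_poly0 horner0 v0.
rewrite rmorphD rmorphM /= map_polyX map_polyC /= hornerMXaddC; apply: vD_le => //.
  by rewrite vM // mulr_ile1 ?v_ge0.
exact: abs_int_le1.
Qed.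
End IntegersModP.

Lemma last_max (R : realType) (a : nat -> R) n : exists2 N, (N <= n)%N &
  forall i, (i <= n)%N -> a i <= a N /\ ((N < i)%N -> a i < a N).
Proof.
elim: n => [|n [N Nn H]]; first by exists 0%N => // i; rewrite leqn0 => /eqP ->.
have [h|h] := leP (a N) (a n.+1).
  exists n.+1 => // i; rewrite leq_eqVlt => /orP[/eqP ->|]; first by rewrite ltnn.
  rewrite ltnS => /[dup] iN /H [h' _]; split; first exact: le_trans h.
  by rewrite ltnNge ltnW.
exists N; first exact: leqW.
by move=> i; rewrite leq_eqVlt => /orP[/eqP ->|/H //]; split; rewrite ?(ltW h).
Qed.

Section AlgebraicResidues.
Variables (R : realType) (F K : fieldType) (w : F -> R) (v : K -> R) (j : {rmorphism F -> K}) (p : nat).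
Hypotheses (p_prime : prime p) (w_um : ultrametric_abs w) (v_um : ultrametric_abs v).
Hypotheses (vj : forall a, v (j a) = w a) (v_p : v p%:R < 1).
Hypothesis residue : forall a, w a <= 1 -> exists e : int, w (a - e%:~R) < 1.

(* Modulo the maximal ideal x is a root of a monic integer polynomial D, so its
   powers are represented by remainders modulo D with coefficients modulo p. *)
Lemma algebraic_residue x : algebraicOver j x -> v x <= 1 ->
  exists2 k, (0 < k)%N & v (x ^+ (p ^ k) - x) < 1.
Proof.
move=> [P P0 rP] x1.
(* Division by the last coefficient of largest absolute value makes P integral, with all
   coefficients beyond degree N in the maximal ideal; so its reduction is monic of degree N. *)
have [N NS HN] := last_max (fun i => w P`_i) (size P).-1.
have sP : (0 < size P)%N by rewrite size_poly_gt0.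
have aN : 0 < w P`_N.
  have [h _] := HN _ (leqnn _); apply: lt_le_trans h; rewrite v_gt0 //.
  by rewrite -lead_coefE lead_coef_eq0.
pose b i := P`_i / P`_N.
have wb i : w (b i) = w P`_i / w P`_N by rewrite vM // vV.
have all_le i : w P`_i <= w P`_N.
  have [h|h] := leqP i (size P).-1; first by have [] := HN i h.
  by rewrite nth_default ?v0 ?v_ge0 // -(prednK sP).
have b1 i : w (b i) <= 1 by rewrite wb ler_pdivrMr // mul1r.
have bN : b N = 1 by rewrite /b divff // -(v_gt0 w_um).
have b_gt i : (N < i)%N -> w (b i) < 1.
  move=> Ni; rewrite wb ltr_pdivrMr // mul1r.
  have [h|h] := leqP i (size P).-1; first by have [_] := HN i h; apply.
  by rewrite nth_default ?v0 // -(prednK sP).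
pose e i := xget 0 [set e : int | w (b i - e%:~R) < 1].
have eP i : w (b i - (e i)%:~R) < 1 by exact: (xgetPex 0 (residue (b1 i))).
pose D : {poly int} := 'X^N + \poly_(i < N) e i.
have sE : (size (\poly_(i < N) e i) < size ('X^N : {poly int}))%N.
  by rewrite size_polyXn ltnS size_poly.
have Dmonic : D \is monic by rewrite monicE lead_coefDl // lead_coefXn.
have sD : size D = N.+1 by rewrite size_polyDl // size_polyXn.
have D_x : v (map_poly intr D).[x] < 1.
  have sN : (N < size P)%N by rewrite -(prednK sP) ltnS.
  have E0 : \sum_(i < size P) j (b i) * x ^+ i = 0.
    have -> : \sum_(i < size P) j (b i) * x ^+ i = (j P`_N)^-1 * (map_poly j P).[x].
      rewrite (@horner_coef_wide _ (size P)) ?size_map_poly // mulr_sumr; apply: eq_bigr => i _.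
      by rewrite coef_map /b rmorphM fmorphV /=; ring.
    by rewrite (rootP rP) mulr0.
  rewrite (@horner_coef_wide _ (size P)); last first.
    by apply: leq_trans (size_poly _ _) _; rewrite sD.
  rewrite -[X in v X]subr0 -[X in v (_ - X)]E0 -sumrB; apply: (v_sum_lt v_um) => // -[i iP].
  rewrite -mulrBl /= vM // vX //.
  apply: (@le_lt_trans _ _ (v ((map_poly intr D)`_i - j (b i)))).
    by rewrite ler_piMr ?v_ge0 // exprn_ile1 ?v_ge0.
  rewrite coef_map /= coefD coefXn coef_poly.
  have [iN|Ni|->] := ltngtP i N.
  - by rewrite add0r (vB_sym v_um) -(rmorph_int j) -rmorphB vj.
  - by rewrite [X in X - _](_ : _ = 0) ?sub0r ?vN // vj b_gt.
  - by rewrite bN (rmorph1 j) addr0 [_%:~R](_ : _ = 1) ?subrr ?v0.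
pose r m := Pdiv.CommonRing.rmodp 'X^m D.
have xr m : v (x ^+ m - (map_poly intr (r m)).[x]) < 1.
  have := congr1 (fun S : {poly int} => (map_poly (intr : int -> K) S).[x])
    (Pdiv.RingMonic.rdivp_eq Dmonic 'X^m).
  rewrite map_polyXn hornerXn => ->; rewrite rmorphD rmorphM /= hornerD hornerM -/(r m) addrK.
  by rewrite vM //; apply: le_lt_trans D_x; rewrite ler_piMl ?v_ge0 ?int_poly_le1.
have D0 : D != 0 by apply: monic_neq0.
have sr m : (size (r m) <= N)%N.
  by rewrite -ltnS -sD; apply: Pdiv.CommonRing.ltn_rmodpN0.
have p0 := prime_gt0 p_prime.
pose c m : {ffun 'I_N -> 'I_p.-1.+1} := [ffun i : 'I_N => inord `|((r m)`_i %% p)%Z|%N].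
have same m m' : c m = c m' -> v (x ^+ m - x ^+ m') < 1.
  move=> E; apply: (vtri_lt v_um (xr m)); rewrite (vB_sym v_um).
  apply: (vtri_lt v_um (xr m')); rewrite (vB_sym v_um).
  rewrite -hornerN -hornerD -rmorphB /= (@horner_coef_wide _ N); last first.
    apply: leq_trans (size_poly _ _) _; apply: leq_trans (size_polyD _ _) _.
    by rewrite geq_max size_polyN !sr.
  apply: (v_sum_lt v_um) => // -[i iN] /=; rewrite vM // vX // coef_map /=.
  apply: (@le_lt_trans _ _ (v ((r m - r m')`_i)%:~R)).
    by rewrite ler_piMr ?v_ge0 // exprn_ile1 ?v_ge0.
  apply: (abs_int_dvd v_um v_p); rewrite coefB -eqz_mod_dvd.
  have := congr1 (fun g : {ffun 'I_N -> 'I_p.-1.+1} => val (g (Ordinal iN))) E.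
  have lt z : (`|(z %% p)%Z|%N < p.-1.+1)%N.
    rewrite (prednK p0) -ltz_nat gez0_abs ?modz_ge0 ?ltz_pmod //; by rewrite -lt0n.
  rewrite !ffunE /= !inordK // => E'; apply/eqP.
  have pz : (p : int) != 0 by rewrite -lt0n.
  by rewrite -(gez0_abs (modz_ge0 (r m)`_i pz)) -(gez0_abs (modz_ge0 (r m')`_i pz)) E'.
have [t [t' [tt E]]] := finite_pigeonhole (fun t => c (p ^ t)%N).
have {E} h := same _ _ E; exists (t' - t)%N; first by rewrite subn_gt0.
(* The p^t-th powers of y and x are congruent; Frobenius is additive and so injective modulo the
   maximal ideal, hence y and x are congruent. *)
set y := x ^+ _; have y1 : v y <= 1 by rewrite vX // exprn_ile1 ?v_ge0.
have yE : y ^+ (p ^ t) = x ^+ (p ^ t') by rewrite -exprM -expnD subnK // ltnW.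
have D1 : v (y - x) <= 1 by apply: vD_le; rewrite ?vN.
have := frobenius_add p_prime v_um v_p t D1 x1; rewrite subrK yE => h'.
rewrite ltNge; apply/negP => ge1.
have : v ((y - x) ^+ (p ^ t)) < 1.
  have -> : (y - x) ^+ (p ^ t) = - (x ^+ (p ^ t') - ((y - x) ^+ (p ^ t) + x ^+ (p ^ t))) +
      - (x ^+ (p ^ t) - x ^+ (p ^ t')) by ring.
  by apply: vD_lt; rewrite ?vN.
by rewrite vX // ltNge exprn_ege1.
Qed.
End AlgebraicResidues.

(** * Completion of an algebraically closed field *)

Section AlgebraicallyClosed.
Variables (R : realType) (F : closedFieldType) (K : fieldType) (v : K -> R) (i : {rmorphism F -> K}).
Hypotheses (v_um : ultrametric_abs v) (v_complete : complete_abs v).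
Hypothesis dense : forall y e, 0 < e -> exists x, v (y - i x) < e.

Lemma poly_bounded (S : {poly K}) B : exists2 M, 0 <= M & forall y, v y <= B -> v S.[y] <= M.
Proof.
elim/poly_ind: S => [|S c [M M0 HM]]; first by exists 0 => // y _; rewrite horner0 v0.
exists (Num.max (M * `|B|) (v c)); first by rewrite le_max (v_ge0 v_um) orbT.
move=> y yB; rewrite hornerMXaddC; apply: vD_le => //; last by rewrite le_max lexx orbT.
rewrite le_max vM // ler_pM ?v_ge0 ?HM //.
exact: le_trans yB (ler_norm _).
Qed.

(** P is replaced by a close monic Q over the dense closed field. |Q(x)| is the product of the
    distances from x to the n + 1 roots of Q, so one root is within del of x; there Q vanishes and P
    is small. *)
Lemma approximate_root (P : {poly K}) n x (del eta : R) : P \is monic -> size P = n.+2 -> 0 < del ->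
  v P.[x] <= del ^+ n.+1 -> 0 < eta -> exists x', v (x' - x) <= del /\ v P.[x'] <= eta.
Proof.
move=> Pm sP d0 Px e0; pose B := Num.max 1 (Num.max (v x) del).
have B1 : 1 <= B by rewrite le_max lexx.
have B0 : 0 < B := lt_le_trans ltr01 B1.
pose mu := Num.min (del ^+ n.+1) eta; have mu0 : 0 < mu by rewrite lt_min exprn_gt0.
(* B bounds |y| for y within del of x, so coefficient errors of this size change the values by at
   most mu. *)
have eps0 : 0 < mu / B ^+ n.+1 by rewrite divr_gt0 ?exprn_gt0.
pose q l := xget 0 [set z | v (P`_l - i z) < mu / B ^+ n.+1].
have qP l : v (P`_l - i (q l)) < mu / B ^+ n.+1 by exact: (xgetPex 0 (dense P`_l eps0)).
pose Q : {poly F} := 'X^(n.+1) + \poly_(l < n.+1) q l.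
have sE : (size (\poly_(l < n.+1) q l) < size ('X^(n.+1) : {poly F}))%N.
  by rewrite size_polyXn ltnS size_poly.
have lQ : lead_coef Q = 1 by rewrite lead_coefDl // lead_coefXn.
have sQ : size Q = n.+2 by rewrite size_polyDl // size_polyXn.
have close y : v (y - x) <= del -> v (P.[y] - (map_poly i Q).[y]) <= mu.
  move=> yx; have yB : v y <= B.
    rewrite -[y](subrK x); apply: vD_le => //; first by rewrite !le_max yx !orbT.
    by rewrite !le_max lexx !orbT.
  rewrite -hornerN -hornerD (@horner_coef_wide _ n.+2); last first.
    by apply: leq_trans (size_polyD _ _) _; rewrite size_polyN size_map_poly sP sQ maxnn.
  apply: v_sum_le => //; first exact: ltW.
  move=> [l /= ln]; rewrite vM // vX // coefB coef_map /= /Q coefD coefXn coef_poly.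
  have [l1|l1] := ltnP l n.+1.
    rewrite (ltn_eqF l1) add0r -[mu](divfK (lt0r_neq0 (exprn_gt0 n.+1 B0))).
    apply: ler_pM; [exact: v_ge0|by rewrite exprn_ge0 ?v_ge0|exact: ltW (qP l)|].
    apply: (@le_trans _ _ (B ^+ l)); first by rewrite lerXn2r ?nnegrE ?(v_ge0 v_um) ?(ltW B0).
    by rewrite ler_weXn2l // ltnW.
  have -> : l = n.+1 by apply/eqP; rewrite eqn_leq l1 -ltnS ln.
  rewrite eqxx addr0 rmorph1 (_ : P`_n.+1 = 1); first by rewrite subrr v0 // mul0r ltW.
  by move/monicP: Pm; rewrite lead_coefE sP.
have [s Es] := closed_field_poly_normal Q; rewrite lQ scale1r in Es.
have ss : size s = n.+1 by move: sQ; rewrite Es size_prod_XsubC => -[].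
have xx : v (x - x) <= del by rewrite subrr v0 // ltW.
have Qx : v (map_poly i Q).[x] <= del ^+ n.+1.
  rewrite -[_.[x]](subrK P.[x]); apply: vD_le => //; rewrite vB_sym //.
  by apply: le_trans (close x xx) _; rewrite ge_min lexx.
have hp : v (map_poly i Q).[x] = \prod_(z <- s) v (x - i z).
  rewrite Es rmorph_prod horner_prod v_prod //; apply: eq_bigr => z _.
  by rewrite /= map_polyXsubC hornerXsubC.
have [z zx] : exists z, v (i z - x) <= del /\ z \in s.
  apply: contrapT => nz; have far z : z \in s -> del < v (x - i z).
    by move=> zs; rewrite ltNge vB_sym //; apply/negP => h; apply: nz; exists z.
  move: Qx; rewrite hp leNgt => /negP; apply; rewrite -ss.
  have : (0 < size s)%N by rewrite ss.
  elim: (s) far => // z s' IH far _; rewrite big_cons /= exprS.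
  have hz : del < v (x - i z) by apply: far; rewrite inE eqxx.
  case: s' IH far => [|z' s'] IH far; first by rewrite big_nil mulr1 expr0 mulr1.
  apply: ltr_pM; rewrite ?exprn_ge0 ?(ltW d0) //; apply: IH => // u us.
  by apply: far; rewrite inE us orbT.
case: zx => zx zs; exists (i z); split=> //.
rewrite -[P.[_]](subr0) (_ : 0 = (map_poly i Q).[i z]).
  by apply: le_trans (close _ zx) _; rewrite ge_min lexx orbT.
by rewrite horner_map /= (rootP _) ?rmorph0 // Es root_prod_XsubC.
Qed.

(** Iterating [approximate_root] with precision D / 2^m gives a Cauchy sequence along which P tends
    to 0; it can start at 0 because |P(0)| <= D <= D^(n+1). *)
Lemma monic_root (P : {poly K}) n : P \is monic -> size P = n.+2 -> exists x, root P x.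
Proof.
move=> Pm sP; pose D := Num.max 1 (v P.[0]); have D1 : 1 <= D by rewrite le_max lexx.
have D0 : 0 < D := lt_le_trans ltr01 D1.
pose del m : R := D * (1 / 2) ^+ m.
have h01 : (0 : R) <= 1 / 2 by rewrite divr_ge0.
have h1 : (1 / 2 : R) < 1 by rewrite ltr_pdivrMr // mul1r ltr1n.
have h0 : (0 : R) < 1 / 2 by rewrite divr_gt0.
have del0 m : 0 < del m by rewrite mulr_gt0 ?exprn_gt0.
pose next m x := xget 0 [set x' | v (x' - x) <= del m /\ v P.[x'] <= del m.+1 ^+ n.+1].
pose u := fix u (m : nat) : K := if m is m'.+1 then next m' (u m') else 0.
have uP m : v P.[u m] <= del m ^+ n.+1.
  case: m => [|m].
    rewrite /u /= /del expr0 mulr1; apply: (@le_trans _ _ D); first by rewrite le_max lexx orbT.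
    by rewrite -{1}[D]expr1 ler_weXn2l.
  elim: m => [|m IH].
    have H0 : v P.[0] <= del 0%N ^+ n.+1.
      rewrite /del expr0 mulr1; apply: (@le_trans _ _ D); first by rewrite le_max lexx orbT.
      by rewrite -{1}[D]expr1 ler_weXn2l.
    by have [] := xgetPex 0 (approximate_root Pm sP (del0 0%N) H0 (exprn_gt0 n.+1 (del0 1%N))).
  by have [] := xgetPex 0 (approximate_root Pm sP (del0 m.+1) IH (exprn_gt0 n.+1 (del0 m.+2))).
have u_step m : v (u m.+1 - u m) <= del m.
  by have [] := xgetPex 0 (approximate_root Pm sP (del0 m) (uP m) (exprn_gt0 n.+1 (del0 m.+1))).
have del_anti m m' : (m <= m')%N -> del m' <= del m.
  by move=> mm; rewrite ler_pM2l // expr_anti.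
have u_far m m' : (m <= m')%N -> v (u m' - u m) <= del m.
  elim: m' => [|m' IH]; first by rewrite leqn0 => /eqP ->; rewrite subrr v0 // ltW.
  rewrite leq_eqVlt => /orP[/eqP ->|]; first by rewrite subrr v0 // ltW.
  rewrite ltnS => mm; apply: (vtri_le v_um _ (IH mm)).
  exact: le_trans (u_step m') (del_anti _ _ mm).
have small e : 0 < e -> exists m, del m < e.
  move=> e0; have [m hm] := expr_lt_eps h01 h1 (divr_gt0 e0 D0); exists m.
  by rewrite /del mulrC -ltr_pdivlMr.
have [l /cvg0P hl] : exists l, v (u m - l) @[m --> \oo] --> (0 : R).
  apply: v_complete => e /small [N hN]; exists N => m m' Nm Nm'; apply: le_lt_trans hN.
  by apply: (vtri_le v_um (u_far _ _ Nm)); rewrite vB_sym // u_far.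
exists l; apply/rootP/eqP; rewrite -(v_eq0 v_um) eq_le v_ge0 // andbT leNgt; apply/negP => pos.
have : root (P - P.[l]%:P) l by rewrite rootE hornerD hornerN hornerC subrr.
move=> /factor_theorem[T TE]; have [M M0 HM] := poly_bounded T (Num.max (v l) 1).
have M1 : 0 < M + 1 by rewrite ltr_wpDl.
have t0 : 0 < Num.min 1 (v P.[l] / (M + 1)) by rewrite lt_min ltr01 divr_gt0.
have [|J HJ] := hl _ _ t0; first by move=> m; apply: v_ge0.
have [m1 hm1] : exists m1, del m1 ^+ n.+1 < v P.[l].
  have c0 : 0 < Num.min 1 (v P.[l]) by rewrite lt_min ltr01.
  have [m1] := small _ c0; rewrite lt_min => /andP[h2 h3]; exists m1; apply: le_lt_trans h3.
  by rewrite exprS ler_piMr ?exprn_ile1 ?(ltW (del0 _)) ?(ltW h2).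
pose s := maxn J m1; have := HJ s (leq_maxl _ _); rewrite lt_min => /andP[s1 s2].
have hs : v P.[u s] < v P.[l].
  apply: le_lt_trans (uP s) (le_lt_trans _ hm1).
  by rewrite lerXn2r ?nnegrE ?(ltW (del0 _)) // del_anti // leq_maxr.
have us : v (u s) <= Num.max (v l) 1.
  rewrite -[u s](subrK l); apply: vD_le => //; last by rewrite le_max lexx.
  by rewrite le_max (ltW s1) orbT.
have : v (P.[u s] - P.[l]) < v P.[l].
  have -> : P.[u s] - P.[l] = (P - P.[l]%:P).[u s] by rewrite hornerD hornerN hornerC.
  rewrite TE hornerM vM // hornerXsubC; apply: (@le_lt_trans _ _ (M * v (u s - l))).
    by rewrite ler_wpM2r ?v_ge0 ?HM.
  apply: (@le_lt_trans _ _ ((M + 1) * v (u s - l))).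
    by rewrite ler_wpM2r ?v_ge0 // lerDl.
  by rewrite mulrC -ltr_pdivlMr.
move=> h; suff : v P.[l] < v P.[l] by rewrite ltxx.
rewrite {1}(_ : P.[l] = P.[u s] - (P.[u s] - P.[l])); last by ring.
by apply: vD_lt; rewrite ?vN.
Qed.

Lemma completion_closed (P : {poly K}) : (1 < size P)%N -> exists x, root P x.
Proof.
move=> sP; have P0 : P != 0 by rewrite -size_poly_gt0 ltnW.
have l0 : lead_coef P != 0 by rewrite lead_coef_eq0.
have [||x rx] := @monic_root ((lead_coef P)^-1 *: P) (size P).-2.
- by rewrite monicE lead_coefZ mulVf.
- by rewrite size_scale ?invr_eq0 //; case: (size P) sP => [|[]].
by exists x; move: rx; rewrite rootZ ?invr_eq0.
Qed.
End AlgebraicallyClosed.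

Theorem mainTheorem1 (R : realType) (p : nat) (p_prime : prime p)
    (Cp : fieldType) (v : Cp -> R) (v_Cp : is_Cp p v)
    (f : {fraction {poly Cp}}) (f_deg : (2 <= ratdeg f)%N)
    (C0 : set (proj_line Cp))
    (C0_component : exists2 x, Fatou v f x & C0 = Fatou_component v f x)
    (C0_periodic : exists2 k : nat, (1 <= k)%N & ratiter f k @` C0 = C0) :
  (exists2 z0, attracting_periodic v f z0 & C0 = immediate_basin v f z0)
  \/ (exists2 x, quasi_periodicity_domain v f x
        & C0 = analytic_component v (quasi_periodicity_domain v f) x).
Proof.
have [Qp [w [i [Qa [wa [j [k [[w_um wi di _] alg [wa_um wj] [v_um vk dk v_complete]]]]]]]]] := v_Cp.
have w_p : w p%:R < 1.
  rewrite -(rmorph_nat i) wi /padic_abs.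
  have p0 := prime_gt0 p_prime; have pq : p%:R != 0 :> rat by rewrite pnatr_eq0 -lt0n.
  have pE : p%:R = (p%:Z)%:~R :> rat by [].
  rewrite (negbTE pq) pE numq_int denq_int /= logn1 logn_prime // eqxx.
  by rewrite sub0r exprN1 invf_lt1 ?ltr0n // ltr1n prime_gt1.
have v_p : v p%:R < 1.
  by rewrite -(rmorph_nat k) vk -(rmorph_nat j) wj.
(* By density an integral element of Q_p is congruent to an integral rational, hence to an
   integer. *)
have res a : w a <= 1 -> exists e : int, w (a - e%:~R) < 1.
  move=> a1; have [b ab] := di a 1 ltr01.
  have [|e he] := rat_residue w_um p_prime w_p (i := i) (b := b).
    by rewrite -[i b](subrK a) vD_le // vB_sym // ltW.
  by exists e; apply: (vtri_lt w_um ab).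
pose jk : {rmorphism Qp -> Cp} := k \o j.
have vjk a : v (jk a) = w a by rewrite /= vk wj.
apply: (classification p_prime v_um v_complete _ v_p) => //.
- exact: completion_closed v_um v_complete dk.
- move=> n n0; rewrite -(rmorph_nat k) fmorph_eq0 -(rmorph_nat j) fmorph_eq0.
  by rewrite -(rmorph_nat i) fmorph_eq0 pnatr_eq0 -lt0n.
(* Completion does not enlarge the residue field: z is congruent to some x algebraic over Q_p, and
   Frobenius carries the relation for x over to z. *)
move=> z z1; have [x zx] := dk z 1 ltr01.
have x1 : v (k x) <= 1 by rewrite -[k x](subrK z) vD_le // vB_sym // ltW.
have [P P0 rP] := alg x.
have algx : algebraicOver jk (k x).
  by exists P => //; rewrite map_poly_comp /= fmorph_root.
have [m m0 hm] := algebraic_residue p_prime w_um v_um vjk v_p res algx x1; exists m => //.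
have D1 : v (z - k x) <= 1 by exact: ltW.
have := frobenius_add p_prime v_um v_p m D1 x1; rewrite subrK => h.
have hq : v (z ^+ (p ^ m) - k x ^+ (p ^ m)) < 1.
  have -> : z ^+ (p ^ m) - k x ^+ (p ^ m) =
    (z ^+ (p ^ m) - ((z - k x) ^+ (p ^ m) + k x ^+ (p ^ m))) + (z - k x) ^+ (p ^ m) by ring.
  apply: vD_lt => //; rewrite vX //; have pm : (0 < p ^ m)%N by rewrite expn_gt0 prime_gt0.
  by rewrite -(prednK pm) exprS; apply: le_lt_trans zx; rewrite ler_piMr ?v_ge0 // exprn_ile1 ?v_ge0.
apply: (vtri_lt v_um hq); apply: (vtri_lt v_um hm); by rewrite vB_sym.
Qed.
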